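(* Let $n \geq 7$, let $G$ be an $n$-dimensional twisted hypercube-like network, and let $F \subseteq V(G)\cup E(G)$ with $|F| \leq 2n-10$. Then for any two nodes $s,t \in V(G-F)$ such that $N_{G-F}(s)\setminus\{t\}\neq\emptyset$ and $N_{G-F}(t)\setminus\{s\}\neq\emptyset$, there exists a hamiltonian path or a near-hamiltonian path between $s$ and $t$ in $G-F$.
   Context: Twisted hypercube-like networks (THLNs) are defined recursively. For $n=3$, an $3$-dimensional THLN is a graph isomorphic to the following cubic graph on $8$ vertices (the $3$-dimensional locally twisted cube): vertices $a_0,a_1,a_2,a_3,b_0,b_1,b_2,b_3$, with edges forming the two $4$-cycles $a_0a_1a_2a_3a_0$ and $b_0b_1b_2b_3b_0$, together with the edges $a_0b_0$, $a_1b_1$, $a_2b_3$, $a_3b_2$. For $n\geq 4$, an $n$-dimensional THLN is any graph $G$ obtained from two $(n-1)$-dimensional THLNs $G_1,G_2$ (on disjoint vertex sets) and a bijection $\phi:V(G_1)\to V(G_2)$ by setting $V(G)=V(G_1)\cup V(G_2)$ and $E(G)=E(G_1)\cup E(G_2)\cup\{(u,\phi(u)) : u\in V(G_1)\}$. For $F\subseteq V(G)\cup E(G)$, $G-F$ is the graph with vertex set $V(G)\setminus F$ and edge set $\{(u,v)\in E(G): u,v\in V(G)\setminus F,\ (u,v)\notin F\}$. $N_{H}(u)$ denotes the set of neighbors of $u$ in the graph $H$. A hamiltonian path in a graph is a path passing through every node exactly once; a near-hamiltonian path is a path passing through every node but one exactly once. *)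

(* Defs.v *)
From mathcomp Require Import all_boot.
Set Implicit Arguments. Unset Strict Implicit. Unset Printing Implicit Defensive.

(* The 3-dimensional locally twisted cube on 'I_8:
   a_i is vertex i, b_i is vertex 4+i (i = 0..3). *)
Definition ltq3_edges : seq (nat * nat) :=
  [:: (0,1); (1,2); (2,3); (3,0);
      (4,5); (5,6); (6,7); (7,4);
      (0,4); (1,5); (2,7); (3,6)].

Definition ltq3 : rel 'I_8 := fun i j =>
  ((val i, val j) \in ltq3_edges) || ((val j, val i) \in ltq3_edges).

Definition thl_join (T1 T2 : finType) (e1 : rel T1) (e2 : rel T2)
  (phi : T1 -> T2) : rel (T1 + T2) := fun x y =>
  match x, y with
  | inl u, inl v => e1 u v
  | inr u, inr v => e2 u v
  | inl u, inr v => phi u == v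
  | inr v, inl u => phi u == v
  end.

Inductive THLN : nat -> forall T : finType, rel T -> Prop :=
| THLN_base (T : finType) (e : rel T) (f : T -> 'I_8) :
    bijective f -> (forall x y, e x y = ltq3 (f x) (f y)) -> THLN 3 e
| THLN_step (n : nat) (T1 T2 : finType) (e1 : rel T1) (e2 : rel T2)
    (phi : T1 -> T2) (T : finType) (e : rel T) (g : T -> (T1 + T2)%type) :
    3 <= n -> THLN n e1 -> THLN n e2 -> bijective phi ->
    bijective g -> (forall x y, e x y = thl_join e1 e2 phi (g x) (g y)) ->
    THLN n.+1 e.

Definition edge_set (T : finType) (e : rel T) (Fe : {set {set T}}) : Prop :=
  forall A, A \in Fe -> exists x y, e x y /\ A = [set x; y].

(* Adjacency of G - F, where F = Fv (faulty vertices) \cup Fe (faulty edges). *)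
Definition del_adj (T : finType) (e : rel T) (Fv : {set T}) (Fe : {set {set T}})
  : rel T := fun x y =>
  [&& e x y, x \notin Fv, y \notin Fv & [set x; y] \notin Fe].

Definition simple_path (T : finType) (r : rel T) (s t : T) (p : seq T) : Prop :=
  [/\ path r s p, last s p = t & uniq (s :: p)].

Definition ham_or_near_ham (T : finType) (Fv : {set T}) (s : T) (p : seq T) : Prop :=
  #|[set x | (x \notin Fv) && (x \notin s :: p)]| <= 1.

(* Main.v *)
(* Both halves [V1], [V2] of a network of dimension n + 1 have dimension n and are joined by a perfect
   matching, so a path of [V1] that is cut open at two matched vertices can be rerouted through [V2].
   By induction on n, with the faults distributed over the halves, the network is Hamilton-connected
   for at most n - 3 faults, hamiltonian for at most n - 2, and has a spanning pair of disjoint paths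
   with prescribed ends for at most n - 5; the cases n = 3 and n = 4 are a computation on the
   8-vertex network. From this one gets, for n >= 7, a cycle missing at most one vertex for at most
   2n - 9 faults, and then the paths of the theorem. If a half holds almost all the faults, one or two
   of them are repaired, the induction hypothesis is applied to that half, and the path is cut at the
   repaired faults into at most three segments, which are rejoined through the other half, where at
   most one fault is left. If these faults isolate too much, a vertex is given up, or put back next to
   one of its neighbours: two vertices have at most two common neighbours, so together they lose at
   most f + 3 of their neighbours to f faults. *)
Require Import Defs.
From mathcomp Require Import all_boot zify.
Set Implicit Arguments. Unset Strict Implicit. Unset Printing Implicit Defensive.

(** The constants come from dimension 7, where 2n - 10 = n - 3 and 2n - 9 = n - 2, so that the last
    two inductions start from [HC] and [HH]; each further dimension has to absorb two more faults.
    With at most 2n - 8 faults in dimension n + 1, either both halves satisfy the induction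
    hypothesis, or one half holds at least 2n - 9 faults and at most one is left for the other half
    and the matching. In the second case the trouble is on the heavy side: its segments must be left
    at vertices whose cross edge survives, and a segment of one vertex cannot be both entered and
    left through the matching, because it has only one cross edge. Moreover, that s has a neighbour
    other than t may fail inside a half although it holds in the network; a repair is then spent at
    s. Faults are lists of pairs and subnetworks are lists of vertices of one graph, so that
    repairing a fault is filtering, deleting a vertex is prefixing a pair, and spanning is
    [perm_eq]. *)

Ltac perm_count :=
  let a := fresh "a" in
  apply/permP => a;
  repeat match goal with H : is_true (perm_eq _ _) |- _ =>
    move/permP/(_ a): H end;
  rewrite -?cats1 ?rev_cat ?rev_cons -?cats1 ?(count_cat, count_rev) /=;
  do ?[progress rewrite ?(count_cat, count_rev) /=]; clear; lia.

(* [lia] is slow when the context holds many non-arithmetic facts. *)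
Ltac arith :=
  repeat match goal with H : ?P |- _ =>
    lazymatch P with
    | is_true (leq _ _) => fail
    | is_true (negb (leq _ _)) => fail
    | @eq ?A _ _ => tryif unify A nat then fail else clear H
    | or _ _ => fail
    | nat => fail
    | _ => clear H
    end
  end; lia.

(** * Walks as lists of all their vertices *)

Section Walks.
Variable T : eqType.
Implicit Types (r : rel T) (p q z : seq T) (s t a b w : T).

(** Unlike the list of [path], [p] contains both ends, so gluing and cutting walks is concatenating
    and splitting lists. *)
Definition walk r s p t :=
  if p is x :: p' then [&& x == s, path r s p' & last s p' == t] else false.

Lemma walk1 r s : walk r s [:: s] s.
Proof. by rewrite /= !eqxx. Qed.

Lemma walk_nil r s p t : walk r s p t -> p != [::].
Proof. by case: p. Qed.

Lemma walk_cons r s p t a : r s a -> walk r a p t -> walk r s (s :: p) t.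
Proof.
by case: p => //= x p ra /and3P[/eqP-> hp hl]; rewrite eqxx ra hp hl.
Qed.

Lemma walk_cat r s p a b q t :
  walk r s p a -> r a b -> walk r b q t -> walk r s (p ++ q) t.
Proof.
case: p => //= x p /and3P[-> hp /eqP hl] ra; case: q => //= y q /and3P[/eqP-> hq hl'].
by rewrite cat_path hp hl /= ra hq last_cat /= hl'.
Qed.

Lemma walk_catP r s p q t : walk r s (p ++ q) t -> p != [::] -> q != [::] ->
  exists a b, [/\ walk r s p a, r a b & walk r b q t].
Proof.
case: p => [|x p]; case: q => [|y q] //= /and3P[/eqP-> hc hl] _ _.
move: hc hl; rewrite cat_path last_cat /= => /and3P[hp ra hq] hl.
by exists (last s p), y; rewrite /= !eqxx hp hq hl.
Qed.

Lemma walk_rev r s p t : symmetric r -> walk r s p t -> walk r t (rev p) s.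
Proof.
move=> rS; elim: p s => // x p IH s.
case: p IH => [|y p] IH; first by move=> /= /andP[/eqP-> /eqP->]; rewrite !eqxx.
move=> h.
have [//|//|a [b [h1 ra h2]]] := walk_catP (p := [:: x]) h.
rewrite rev_cons -cats1; apply: (walk_cat (IH b h2) (b := a)); first by rewrite rS.
by move: h1 => /= /andP[/eqP-> /eqP->]; rewrite !eqxx.
Qed.

Lemma sub_walk r r' s p t : {in p &, subrel r r'} -> walk r s p t -> walk r' s p t.
Proof.
case: p => //= x p h /and3P[/eqP xs hp ->]; subst x; rewrite eqxx andbT /=.
elim: p s h hp => //= y p IH s h /andP[h1 h2]; apply/andP; split.
  by apply: h h1; rewrite !inE eqxx ?orbT.
by apply: IH h2 => u v hu hv; apply: h; rewrite inE ?hu ?hv orbT.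
Qed.

Lemma walk_mem1 r s p t : walk r s p t -> s \in p.
Proof. by case: p => //= x p /and3P[/eqP-> _ _]; rewrite mem_head. Qed.

Lemma walk_mem2 r s p t : walk r s p t -> t \in p.
Proof. by case: p => //= x p /and3P[/eqP-> _ /eqP<-]; rewrite mem_last. Qed.

Lemma walk_before r s p t w : walk r s p t -> w \in p -> w != s ->
  exists A a B, [/\ p = A ++ w :: B, walk r s A a, r a w & walk r w (w :: B) t].
Proof.
move=> hp /splitPr wp; case: wp hp => A B hp ws.
have An : A != [::].
  by apply: contra_neq ws => A0; move: hp; rewrite A0 /= => /and3P[/eqP].
have [//|a [b [h1 h2 h3]]] := walk_catP hp An.
have bw : b = w by case/and3P: h3 => /eqP.
by subst b; exists A, a, B.
Qed.

Lemma walk_rcons_end r s A w a : walk r s (rcons A w) a -> a = w.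
Proof.
by case: A => [|x A] /=; [case/andP=> /eqP-> /eqP | case/and3P=> _ _ /eqP<-; rewrite last_rcons].
Qed.

Lemma walk_cons_start r s x p t : walk r s (x :: p) t -> s = x.
Proof. by case/and3P => /eqP. Qed.

Lemma walk_after r s p t w : walk r s p t -> w \in p -> w != t ->
  exists A b B, [/\ p = rcons A w ++ B, walk r s (rcons A w) w, r w b & walk r b B t].
Proof.
move=> hp /splitPr wp; case: wp hp => A B; rewrite -cat_rcons => hp wt.
have Bn : B != [::].
  apply: contra_neq wt => B0; move: hp; rewrite B0 cats0 => hp.
  by rewrite (walk_rcons_end hp).
have [|a [b [h1 h2 h3]]] := walk_catP hp _ Bn; first by case: (A).
have aw := walk_rcons_end h1.
by subst a; exists A, b, B.
Qed.

Lemma cycle_walk r p : cycle r p -> p != [::] ->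
  exists x y, walk r x p y /\ r y x.
Proof.
case: p => // x p; rewrite /= rcons_path => /andP[h1 h2] _.
by exists x, (last x p); rewrite !eqxx h1.
Qed.

Lemma walk_cycle r p x y : walk r x p y -> r y x -> cycle r p.
Proof. by case: p => // a p /= /and3P[/eqP-> h /eqP hl] ryx; rewrite rcons_path h hl. Qed.

Lemma cycle_swap r p q : cycle r (p ++ q) = cycle r (q ++ p).
Proof. by rewrite -rot_size_cat rot_cycle. Qed.

(** If c entries are bad, at least c + 2 good ones are spread over at most c + 1 runs, so some run
    has two. *)
Lemma adj_avoid (a : pred T) p : 2 * count a p + 2 <= size p ->
  exists p1 u v p2, [/\ p = p1 ++ u :: v :: p2, ~~ a u & ~~ a v].
Proof.
elim: {p}(size p) {-2}p (leqnn (size p)) => [|n IH] [|x [|y p]] //=; try lia.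
move=> hn hc.
have [ax|nax] := boolP (a x).
  have [||p1 [u [v [p2 [-> h1 h2]]]]] := IH (y :: p); rewrite /=; try lia.
  by exists (x :: p1), u, v, p2.
have [ay|nay] := boolP (a y); last by exists [::], x, y, p.
have [||p1 [u [v [p2 [-> h1 h2]]]]] := IH p; try lia.
by exists [:: x, y & p1], u, v, p2.
Qed.

Lemma pick_avoid (X Y : seq T) : uniq X -> size Y < size X ->
  exists2 x, x \in X & x \notin Y.
Proof.
move=> uX h; apply/hasP; apply/negP => /negP /hasPn hn.
have: size X <= size Y.
  by apply: uniq_leq_size => // x /hn; rewrite negbK.
lia.
Qed.

Lemma sub_nil (X : seq T) : {subset [::] <= X}. Proof. by []. Qed.

End Walks.

(** * The ambient graph, its subnetworks, and counting of faults *)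

Definition ltqn : rel nat := fun i j =>
  ((i, j) \in ltq3_edges) || ((j, i) \in ltq3_edges).

(** A half has 2 ^ n vertices, and 6n + 2 dominates the numbers of vertices that have to be avoided.
    Equality holds at m = 5; arguments that need the bound from dimension 4 on split off that
    case. *)
Lemma pow_ge m : 5 <= m -> 6 * m + 2 <= 2 ^ m.
Proof.
elim: m => // m IH; rewrite leq_eqVlt => /orP[/eqP<- //|h].
by rewrite expnS; have := IH h; lia.
Qed.

Lemma pow_ge_double m : 3 <= m -> 2 * m <= 2 ^ m.
Proof.
have [|? ?] := leqP 5 m; first by move/pow_ge; lia.
by have [->|->] : m = 3 \/ m = 4 by lia.
Qed.

(** One ambient graph for all subnetworks: both halves and their faults then share a type, and no
    sum types occur. *)
Structure sgraph := SGraph {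
  vertex :> eqType;
  edge : rel vertex;
  edge_sym : symmetric edge;
  edge_irr : irreflexive edge }.

Section Net.
Variable G : sgraph.
Local Notation T := (vertex G).
Local Notation e := (@edge G).
Local Notation e_sym := (@edge_sym G).
Local Notation e_irr := (@edge_irr G).
Implicit Types (F : seq (T * T)) (V X Y p q z : seq T) (x y s t u v w : T) (mu : T -> T).

(* A fault list [F] holds [(x, x)] for a faulty vertex [x], and [(x, y)] or [(y, x)] for a faulty
   edge. *)
Definition good F x := (x, x) \notin F.
Definition adj F : rel T := fun x y =>
  [&& e x y, good F x, good F y, (x, y) \notin F & (y, x) \notin F].
Definition gd F V := filter (good F) V.
Definition inside V (f : T * T) := (f.1 \in V) && (f.2 \in V).
(** Both ends have to lie in [V], so a faulty edge between the two halves counts for neither of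
    them. *)
Definition nf V F := count (inside V) F.

(* [V] lists the vertices of an [n]-dimensional network; [mu] exchanges the ends of the edges
   between its two halves. *)
Inductive sub : nat -> seq T -> Prop :=
| sub3 (h : nat -> T) : uniq (map h (iota 0 8)) ->
    (forall i j, i < 8 -> j < 8 -> e (h i) (h j) = ltqn i j) ->
    sub 3 (map h (iota 0 8))
| subS n V V1 V2 mu : 3 <= n -> sub n V1 -> sub n V2 -> uniq V ->
    perm_eq V (V1 ++ V2) ->
    {in V1, forall x, mu x \in V2} -> {in V2, forall x, mu x \in V1} ->
    {in V, forall x, mu (mu x) = x} ->
    {in V1 & V2, forall x y, e x y = (y == mu x)} ->
    sub n.+1 V.

Record bisection n V V1 V2 mu : Prop := Bisection {
  split_sub1 : sub n V1;
  split_sub2 : sub n V2;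
  split_uniq : uniq V;
  split_perm : perm_eq V (V1 ++ V2);
  split_mu1 : {in V1, forall x, mu x \in V2};
  split_mu2 : {in V2, forall x, mu x \in V1};
  split_muK : {in V, forall x, mu (mu x) = x};
  split_e : {in V1 & V2, forall x y, e x y = (y == mu x)} }.

Lemma sub_split n V : 3 <= n -> sub n.+1 V -> exists V1 V2 mu, bisection n V V1 V2 mu.
Proof.
move=> n3 h; move: {-2}(n.+1) (erefl n.+1) h => k kn h.
case: h kn => [h _ _ [] kn|{}k {}V V1 V2 mu _ h1 h2 h3 h4 h5 h6 h7 h8 [kn]].
  by move: n3; rewrite -kn.
by subst k; exists V1, V2, mu.
Qed.

Lemma split_mem n V V1 V2 mu : bisection n V V1 V2 mu ->
  forall x, (x \in V) = (x \in V1) || (x \in V2).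
Proof. by move=> sp x; rewrite (perm_mem (split_perm sp)) mem_cat. Qed.

Lemma split_disj n V V1 V2 mu : bisection n V V1 V2 mu ->
  forall x, x \in V1 -> x \in V2 -> False.
Proof.
move=> sp x h1 h2; have := split_uniq sp.
rewrite (perm_uniq (split_perm sp)) cat_uniq => /and3P[_ /hasPn h _].
by move: (h _ h2); rewrite /= h1.
Qed.

Lemma split_sym n V V1 V2 mu : bisection n V V1 V2 mu -> bisection n V V2 V1 mu.
Proof.
move=> sp; have mem := split_mem sp; case: sp => a b c d f g h i; split => //.
  by rewrite perm_sym perm_catC perm_sym.
move=> x y hx hy; rewrite e_sym i //; apply/eqP/eqP => [->|->]; rewrite h //.
  by rewrite mem hy.
by rewrite mem hx orbT.
Qed.

Lemma sub_uniq n V : sub n V -> uniq V. Proof. by case. Qed.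

Lemma sub_size n V : sub n V -> size V = 2 ^ n.
Proof.
elim=> {n V} [h _ _|n V V1 V2 mu _ _ h1 _ h2 _ hp _ _ _ _]; first by rewrite size_map size_iota.
by rewrite (perm_size hp) size_cat h1 h2 expnS mul2n addnn.
Qed.

Lemma adj_sym F : symmetric (adj F).
Proof. by move=> x y; rewrite /adj e_sym; apply/and5P/and5P => -[]. Qed.

Lemma adj_e F x y : adj F x y -> e x y. Proof. by case/and5P. Qed.
Lemma adj_good F x y : adj F x y -> good F x /\ good F y. Proof. by case/and5P. Qed.
Lemma adj_neq F x y : adj F x y -> x != y.
Proof. by move/adj_e; apply: contraTneq => ->; rewrite e_irr. Qed.

Lemma mem_gd F V x : (x \in gd F V) = good F x && (x \in V).
Proof. by rewrite mem_filter. Qed.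

Lemma gd_uniq n F V : sub n V -> uniq (gd F V).
Proof. by move=> /sub_uniq h; apply: filter_uniq. Qed.

(** [dec] reads off from a fault the element of [A] that it accounts for; hence distinct elements
    have distinct faults. *)
Lemma size_inj (S : eqType) (A : seq S) (dec : T * T -> S) (a : pred (T * T)) F : uniq A ->
  (forall x : S, x \in A -> exists2 f, (f \in F) && a f & dec f = x) -> size A <= count a F.
Proof.
move=> uA h; rewrite -size_filter -(size_map dec); apply: uniq_leq_size => // x /h[f hf <-].
by apply: map_f; rewrite mem_filter andbC.
Qed.

Lemma size_gd n F V : sub n V -> 2 ^ n <= size (gd F V) + nf V F.
Proof.
move=> sV; rewrite -(sub_size sV) -(count_predC (good F) V) -size_filter leq_add2l -size_filter.
apply: (@size_inj _ _ (fun f => f.1)); first exact: filter_uniq (sub_uniq sV).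
move=> x; rewrite mem_filter /= /good negbK => /andP[h1 h2].
by exists (x, x); rewrite // h1 /inside /= h2.
Qed.

Section Split.
Variables (n : nat) (V V1 V2 : seq T) (mu : T -> T).
Hypothesis sp : bisection n V V1 V2 mu.
Let spS := split_sym sp.

Definition link F mu x := adj F x (mu x).

Lemma split_inV1 x : x \in V1 -> x \in V. Proof. by rewrite (split_mem sp) => ->. Qed.
Lemma split_inV2 x : x \in V2 -> x \in V. Proof. by rewrite (split_mem sp) orbC => ->. Qed.

Lemma split_muK1 x : x \in V1 -> mu (mu x) = x.
Proof. by move/split_inV1; apply: (split_muK sp). Qed.

Lemma split_muK2 x : x \in V2 -> mu (mu x) = x.
Proof. by move/split_inV2; apply: (split_muK sp). Qed.

Lemma split_mu_inj x y : x \in V1 -> y \in V1 -> (mu x == mu y) = (x == y).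
Proof.
move=> hx hy; apply/eqP/eqP => [h|-> //].
by rewrite -[x]split_muK1 // h split_muK1.
Qed.

Lemma split_mu_eq x t : x \in V1 -> t \in V2 -> (mu x == t) = (x == mu t).
Proof.
by move=> hx ht; apply/eqP/eqP => [<-|->]; [rewrite split_muK1 | rewrite split_muK2].
Qed.

Lemma split_gd F : perm_eq (gd F V) (gd F V1 ++ gd F V2).
Proof. by rewrite /gd -filter_cat; apply: perm_filter; apply: split_perm sp. Qed.

Lemma link_gd2 F x : x \in V1 -> link F mu x -> mu x \in gd F V2.
Proof. by move=> hx /adj_good[h1 h2]; rewrite mem_gd h2 (split_mu1 sp). Qed.

Lemma split_e_mu x : x \in V1 -> e x (mu x).
Proof. by move=> hx; rewrite (split_e sp) // (split_mu1 sp). Qed.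

Lemma nf_split F : nf V1 F + nf V2 F <= nf V F.
Proof.
rewrite /nf -count_predUI (@eq_count _ (predI _ _) pred0) ?count_pred0 ?addn0.
  apply: sub_count => f /= /orP[] /andP[h1 h2]; apply/andP; split; auto using split_inV1, split_inV2.
move=> f /=; apply/negP => /andP[/andP[h1 _] /andP[h2 _]]; exact: (split_disj sp h1 h2).
Qed.

(** A healthy x of [V1] whose cross edge is lost has a fault outside [V1]: its mate or the cross
    edge in one of two orders. [dec] recovers x from each of the three. *)
Lemma nf_link F : nf V1 F + count (predC (link F mu)) (gd F V1) <= nf V F.
Proof.
have -> : nf V F = nf V1 F + count (predD (inside V) (inside V1)) F.
  rewrite /nf -count_predUI (@eq_count _ (predI _ _) pred0) ?count_pred0 ?addn0.
    apply: eq_count => f /=; case h : (inside V1 f) => //=.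
    by case/andP: h => h1 h2; rewrite /inside !split_inV1.
  by move=> f /=; case: (inside V1 f).
rewrite leq_add2l -size_filter.
pose dec f := if f.1 \in V1 then f.1 else if f.2 \in V1 then f.2 else mu f.2.
apply: (@size_inj _ _ dec); first exact/filter_uniq/gd_uniq/(split_sub1 sp).
move=> x; rewrite mem_filter mem_gd /= => /and3P[nl gx hx].
have hm := split_mu1 sp hx; have hmx := split_inV2 hm; have hxx := split_inV1 hx.
have nm : (mu x \in V1) = false by apply/negP => h; apply: (split_disj sp h hm).
move: nl; rewrite /link /adj split_e_mu // gx /= !negb_and !negbK => /or3P[h|h|h].
- by exists (mu x, mu x); rewrite ?h /dec /inside /= !nm ?hmx //= split_muK1.
- by exists (x, mu x); rewrite ?h /dec /inside /= !nm ?hmx ?hx ?hxx.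
- by exists (mu x, x); rewrite ?h /dec /inside /= !nm ?hmx ?hx ?hxx.
Qed.

End Split.

Lemma ltqn_reg : all (fun i => count (ltqn i) (iota 0 8) == 3) (iota 0 8).
Proof. by []. Qed.

Lemma ltqn_common : all (fun i => all (fun j => (i == j) ||
  (count (fun k => ltqn i k && ltqn j k) (iota 0 8) <= 2)) (iota 0 8)) (iota 0 8).
Proof. by []. Qed.

Lemma sub_reg n V u : sub n V -> u \in V -> count (e u) V = n.
Proof.
move=> sV; elim: sV u => {n V} [h uh he u|n V V1 V2 mu n3 s1 IH1 s2 IH2 uV pV m1 m2 mK he u].
  case/mapP=> i; rewrite mem_iota => /andP[_ hi] ->; rewrite count_map.
  rewrite -[RHS](eqP (allP ltqn_reg i _)) ?mem_iota //; apply: eq_in_count => j.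
  by rewrite mem_iota => /andP[_ hj]; rewrite /preim /= he.
have sp : bisection n V V1 V2 mu by [].
wlog hu : V1 V2 s1 IH1 s2 IH2 pV m1 m2 he sp / u \in V1 => [W|].
  move=> hu; have := hu; rewrite (split_mem sp) => /orP[h|h]; first by apply: (W V1 V2).
  have spS := split_sym sp; case: (spS) => *; exact: (W V2 V1).
move=> _; rewrite (permP pV) count_cat IH1 // -[RHS]addn1; congr addn.
rewrite (@eq_in_count _ _ (pred1 (mu u))) ?count_uniq_mem ?m1 ?(sub_uniq s2) //.
by move=> y hy; rewrite he.
Qed.

(** Within one half, cross edges add no common neighbour, since mates of distinct vertices are
    distinct. For u in [V1] and v in [V2] the only candidates are [mu v] and [mu u]. *)
Lemma sub_common n V u v : sub n V -> u \in V -> v \in V -> u != v ->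
  count (fun w => e u w && e v w) V <= 2.
Proof.
move=> sV; elim: sV u v => {n V} [h uh he u v|n V V1 V2 mu n3 s1 IH1 s2 IH2 uV pV m1 m2 mK he u v].
  case/mapP=> i; rewrite mem_iota => /andP[_ hi] ->.
  case/mapP=> j; rewrite mem_iota => /andP[_ hj] -> ij.
  have {}ij : i != j by apply: contra_neq ij => ->.
  rewrite count_map; have hi' : i \in iota 0 8 by rewrite mem_iota.
  have hj' : j \in iota 0 8 by rewrite mem_iota.
  have := allP (allP ltqn_common i hi') j hj'; rewrite (negPf ij).
  rewrite (@eq_in_count _ (preim h _) (fun k => ltqn i k && ltqn j k)) // => k.
  by rewrite mem_iota => /andP[_ hk]; rewrite /preim /= !he.
have sp : bisection n V V1 V2 mu by [].
wlog hu : V1 V2 s1 IH1 s2 IH2 pV m1 m2 he sp / u \in V1 => [W|].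
  move=> hu; have := hu; rewrite (split_mem sp) => /orP[h|h]; first by apply: (W V1 V2).
  have spS := split_sym sp; case: (spS) => *; exact: (W V2 V1).
move=> _ hv uv; rewrite (permP pV) count_cat.
have c2 w : w \in V1 -> count (pred1 (mu w)) V2 = 1.
  by move=> hw; rewrite count_uniq_mem ?m1 ?(sub_uniq s2).
have [hv1|hv2] := orP (etrans (esym (split_mem sp v)) hv).
  rewrite [X in _ + X](_ : _ = 0) ?addn0 ?IH1 //.
  rewrite (@eq_in_count _ _ pred0) ?count_pred0 // => w hw /=.
  rewrite !he //; apply/negP => /andP[/eqP-> ]; rewrite (split_mu_inj sp) //; exact/negP.
have h2 : count (fun w => e u w && e v w) V2 <= 1.
  rewrite -(c2 _ hu) -!size_filter !size_filter.
  apply: leq_trans (_ : count (e u) V2 <= _); first by apply: sub_count => w /andP[].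
  by rewrite (@eq_in_count _ (e u) (pred1 (mu u))) // => w hw; rewrite he.
have spS := split_sym sp.
have h1 : count (fun w => e u w && e v w) V1 <= 1.
  have <- : count (pred1 (mu v)) V1 = 1.
    by rewrite count_uniq_mem ?(sub_uniq s1) ?m2.
  apply: leq_trans (_ : count (e v) V1 <= _); first by apply: sub_count => w /andP[].
  by rewrite (@eq_in_count _ (e v) (pred1 (mu v))) // => w hw; rewrite (split_e spS).
lia.
Qed.

Definition gnb F V u := [seq w <- V | adj F u w].
Definition bnb F V u := [seq w <- V | e u w && ~~ adj F u w].

Lemma nb_size n F V u : sub n V -> u \in V -> size (gnb F V u) + size (bnb F V u) = n.
Proof.
move=> sV hu; rewrite -(sub_reg sV hu) !size_filter -count_predUI.
rewrite (@eq_count _ (predI _ _) pred0) ?count_pred0 ?addn0.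
  apply: eq_count => w /=; case h : (adj F u w); rewrite ?(adj_e h) ?andbT ?orbF //.
by move=> w /=; case: (adj F u w); rewrite ?andbF.
Qed.

Lemma mem_gnb F V u w : (w \in gnb F V u) = adj F u w && (w \in V).
Proof. by rewrite mem_filter. Qed.

Lemma mem_bnb F V u w : good F u -> (w \in bnb F V u) =
  [&& w \in V, e u w & [|| ~~ good F w, (u, w) \in F | (w, u) \in F]].
Proof.
move=> gu; rewrite mem_filter /adj gu /=; case: (e u w); rewrite ?andbF //= andbC.
by rewrite !negb_and !negbK.
Qed.

(** A fault costs both u and v a neighbour only if it is one of their at most two common neighbours
    or the edge uv. The list [C] sets aside these at most three lost neighbours of u; all others are
    charged to distinct faults. *)
Lemma bnb2 n F V u v : sub n V -> u \in gd F V -> v \in gd F V -> u != v ->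
  size (bnb F V u) + size (bnb F V v) <= nf V F + 3.
Proof.
move=> sV; rewrite !mem_gd => /andP[gu hu] /andP[gv hv] uv.
pose C := v :: [seq w <- V | e u w && e v w].
have sC : size C <= 3 by rewrite /= size_filter ltnS (sub_common sV).
pose A := [seq w <- bnb F V u | w \notin C].
have hA : size (bnb F V u) <= size A + 3.
  rewrite -(count_predC (mem C) (bnb F V u)) addnC size_filter leq_add2l.
  apply: leq_trans sC; rewrite -size_filter; apply: uniq_leq_size.
    exact/filter_uniq/filter_uniq/(sub_uniq sV).
  by move=> w; rewrite mem_filter => /andP[].
suff: size (map (pair true) A ++ map (pair false) (bnb F V v)) <= nf V F.
  by rewrite size_cat !size_map; lia.
(* The boolean is [true] if the fault is charged to u and [false] if to v, with ties going to v; the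
   second component is the lost neighbour. *)
pose dec (f : T * T) : bool * T :=
  if f.1 == f.2 then (~~ e v f.1, f.1) else
  if f.1 == v then (false, f.2) else if f.2 == v then (false, f.1) else
  (true, if f.1 == u then f.2 else f.1).
apply: (@size_inj _ _ dec).
  rewrite cat_uniq !map_inj_uniq; try by move=> ? ? [].
  rewrite !filter_uniq ?(sub_uniq sV) //= andbT.
  by apply/hasPn => _ /mapP[w _ ->]; apply/mapP => -[].
move=> bw; rewrite mem_cat => /orP[] /mapP[w hw ->].
  move: hw; rewrite mem_filter inE negb_or mem_bnb // mem_filter.
  case/andP=> /andP[wv nc] /and3P[hwV uw]; move: nc; rewrite hwV uw andbT /= => nvw.
  have wu : w != u by apply: contraTneq uw => ->; rewrite e_irr.
  case/or3P=> [/negPn h|h|h].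
  - by exists (w, w); rewrite ?h /inside /dec /= ?hwV // eqxx nvw.
  - exists (u, w); rewrite ?h /inside /dec /= ?hwV ?hu //.
    by rewrite eq_sym (negPf wu) (negPf uv) (negPf wv) eqxx.
  - exists (w, u); rewrite ?h /inside /dec /= ?hwV ?hu //.
    by rewrite (negPf wu) (negPf uv) (negPf wv).
move: hw; rewrite mem_bnb // => /and3P[hwV vw].
have wv : w != v by apply: contraTneq vw => ->; rewrite e_irr.
case/or3P=> [/negPn h|h|h].
- by exists (w, w); rewrite ?h /inside /dec /= ?hwV // eqxx vw.
- exists (v, w); rewrite ?h /inside /dec /= ?hwV ?hv //.
  by rewrite eq_sym (negPf wv) eqxx.
- exists (w, v); rewrite ?h /inside /dec /= ?hwV ?hv //.
  by rewrite (negPf wv) eqxx.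
Qed.

End Net.

(** * The connectivity properties and detours through the other half *)

Lemma perm_cat_filter (T : eqType) (D X : seq T) : uniq D -> uniq X ->
  {subset D <= X} -> perm_eq (D ++ [seq x <- X | x \notin D]) X.
Proof.
move=> uD uX DX; apply: uniq_perm => //.
  rewrite cat_uniq uD filter_uniq // andbT; apply/hasPn => x.
  by rewrite mem_filter => /andP[].
by move=> x; rewrite mem_cat mem_filter; case h: (x \in D) => //=; rewrite (DX _ h).
Qed.

Lemma walk_insert (T : eqType) (r : rel T) s p1 u v p2 t x q y :
  walk r s (p1 ++ u :: v :: p2) t -> r u x -> walk r x q y -> r y v ->
  walk r s (rcons p1 u ++ q ++ v :: p2) t.
Proof.
rewrite -cat_rcons => hp rux hq ryv.
have [||a [b [h1 h2 h3]]] := walk_catP hp; rewrite -?size_eq0 ?size_rcons //.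
have au := walk_rcons_end h1; have bv := walk_cons_start h3.
by subst a b; apply: walk_cat h1 rux _; apply: walk_cat hq ryv _.
Qed.

Section Conn.
Variable G : sgraph.
Local Notation T := (vertex G).
Implicit Types (F : seq (T * T)) (V X Y D p q z : seq T) (x y s t u v w : T) (mu : T -> T).

Definition HC n := forall V F s t, sub n V -> nf V F <= n - 3 ->
  s \in gd F V -> t \in gd F V -> s != t ->
  exists2 p, walk (adj F) s p t & perm_eq p (gd F V).

Definition HH n := forall V F, sub n V -> nf V F <= n - 2 ->
  exists2 p, cycle (adj F) p & perm_eq p (gd F V).

(** Subtraction is truncated: for n = 4 and n = 5 this is the statement without faults. *)
Definition D2 n := forall V F a b c d, sub n V -> nf V F <= n - 5 ->
  uniq [:: a; b; c; d] -> {subset [:: a; b; c; d] <= gd F V} ->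
  exists p q, [/\ walk (adj F) a p b, walk (adj F) c q d & perm_eq (p ++ q) (gd F V)].

(** Prefixing the pairs [(x, x)] for x in [D] deletes these vertices too: a path that has to avoid
    [D] is obtained at the price of [size D] more faults. *)
Lemma adj_cat D F x y :
  adj (map (fun x => (x, x)) D ++ F) x y = [&& adj F x y, x \notin D & y \notin D].
Proof.
have gE w : good (map (fun x => (x, x)) D ++ F) w = (w \notin D) && good F w.
  rewrite /good mem_cat negb_or; congr andb; congr negb.
  by apply/mapP/idP => [[v hv [->]] // | h]; exists w.
rewrite /adj !gE !mem_cat !negb_or.
have [->|xy] := eqVneq x y; first by rewrite edge_irr.
have nm u v : u != v -> (u, v) \notin map (fun x => (x, x)) D.
  by move=> uv; apply/mapP => -[w _ [h1 h2]]; move: uv; rewrite h1 h2 eqxx.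
have yx : y != x by rewrite eq_sym.
by rewrite !nm //=; case: (x \in D); case: (y \in D); rewrite ?andbF ?andbT.
Qed.

Lemma gd_cat D F V : gd (map (fun x => (x, x)) D ++ F) V = [seq x <- gd F V | x \notin D].
Proof.
rewrite /gd -filter_predI; apply: eq_filter => w /=.
rewrite /good mem_cat negb_or; congr andb; congr negb.
by apply/mapP/idP => [[v hv [->]] // | h]; exists w.
Qed.

Lemma nf_cat D F V : nf V (map (fun x => (x, x)) D ++ F) <= size D + nf V F.
Proof.
by rewrite /nf count_cat leq_add2r (leq_trans (count_size _ _)) // size_map.
Qed.

Lemma hc_avoid n V F D s t : HC n -> sub n V -> nf V F + size D <= n - 3 ->
  uniq D -> {subset D <= gd F V} -> s \in gd F V -> t \in gd F V ->
  s \notin D -> t \notin D -> s != t ->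
  exists2 p, walk (adj F) s p t & perm_eq (D ++ p) (gd F V).
Proof.
move=> hc sV hn uD DV hs ht sD tD st.
have [||||p h1 h2] := hc V (map (fun x => (x, x)) D ++ F) s t sV.
- by have := nf_cat D F V; lia.
- by rewrite gd_cat mem_filter sD hs.
- by rewrite gd_cat mem_filter tD ht.
- by [].
exists p.
  by apply: sub_walk h1 => x y _ _; rewrite adj_cat => /and3P[].
move: h2; rewrite gd_cat => h2.
apply: perm_trans (perm_cat_filter uD (gd_uniq F sV) DV).
by rewrite perm_cat2l.
Qed.

Section Split.
Variables (n : nat) (V V1 V2 : seq T) (mu : T -> T).
Hypothesis sp : bisection n V V1 V2 mu.

Lemma links_size F : 2 ^ n <= size (filter (link F mu) (gd F V1)) + nf V F.
Proof.
have h1 := size_gd F (split_sub1 sp); have h2 := nf_link sp F.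
have := count_predC (link F mu) (gd F V1); rewrite size_filter; lia.
Qed.

Lemma pick_link F Y : size Y + nf V F < 2 ^ n ->
  exists2 x, [&& x \in V1, x \in gd F V1 & link F mu x] & x \notin Y.
Proof.
move=> h; have := links_size F => h2.
have [||x] := @pick_avoid _ (filter (link F mu) (gd F V1)) Y; try lia.
  exact/filter_uniq/gd_uniq/(split_sub1 sp).
by rewrite mem_filter => /andP[h3 h4] xY; exists x; rewrite ?h3 ?h4 //; move: h4; rewrite mem_gd => /andP[_ ->].
Qed.

Lemma conn2 F D u v : HC n -> nf V2 F + size D <= n - 3 ->
  uniq D -> {subset D <= gd F V2} -> u \in V1 -> v \in V1 ->
  link F mu u -> link F mu v -> mu u \notin D -> mu v \notin D -> u != v ->
  exists2 q, walk (adj F) (mu u) q (mu v) & perm_eq (D ++ q) (gd F V2).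
Proof.
move=> hc hn uD DV hu hv lu lv uD' vD' uv.
apply: (hc_avoid hc (split_sub2 sp) hn uD DV) => //.
- exact: (link_gd2 sp hu lu).
- exact: (link_gd2 sp hv lv).
- by rewrite (split_mu_inj sp).
Qed.

Lemma join2 F D s p1 a b p2 t : HC n -> nf V2 F + size D <= n - 3 ->
  uniq D -> {subset D <= gd F V2} -> a \in V1 -> b \in V1 ->
  link F mu a -> link F mu b -> mu a \notin D -> mu b \notin D -> a != b ->
  walk (adj F) s p1 a -> walk (adj F) b p2 t ->
  exists2 p, walk (adj F) s p t & perm_eq (D ++ p) (p1 ++ p2 ++ gd F V2).
Proof.
move=> hc hn uD DV hu hv lu lv uD' vD' uv h1 h2.
have [q h3 h4] := conn2 hc hn uD DV hu hv lu lv uD' vD' uv.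
exists (p1 ++ q ++ p2); last by perm_count.
apply: walk_cat h1 lu _; apply: walk_cat h3 _ h2.
by rewrite adj_sym.
Qed.

Lemma nonlink_sub F p : uniq p -> {subset p <= gd F V1} ->
  count (predC (link F mu)) p + nf V1 F <= nf V F.
Proof.
move=> up hp; have := nf_link sp F; rewrite addnC => h.
apply: leq_trans h; rewrite leq_add2r -!size_filter; apply: uniq_leq_size.
  exact: filter_uniq.
by move=> x; rewrite mem_filter => /andP[h1 /hp h2]; rewrite mem_filter h1.
Qed.

Lemma count_blocked F D p : uniq p -> {subset p <= gd F V1} ->
  count (fun x => ~~ link F mu x || (mu x \in D)) p <= nf V F - nf V1 F + size D.
Proof.
move=> up hp; have h1 := nonlink_sub up hp.
have pV x : x \in p -> x \in V1 by move=> /hp; rewrite mem_gd => /andP[].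
have h2 : count (fun x => mu x \in D) p <= size D.
  rewrite -size_filter -(size_map mu); apply: uniq_leq_size.
    rewrite map_inj_in_uniq ?filter_uniq // => x y; rewrite !mem_filter.
    by move=> /andP[_ /pV hx] /andP[_ /pV hy] /eqP; rewrite (split_mu_inj sp) // => /eqP.
  by move=> _ /mapP[x + ->]; rewrite mem_filter => /andP[].
rewrite -[X in X <= _]/(count (predU (predC (link F mu)) (fun x => mu x \in D)) p).
have := count_predUI (predC (link F mu)) (fun x => mu x \in D) p; arith.
Qed.

(** The path is opened between two consecutive vertices whose cross edges survive and whose mates
    are not in [D]. At most [nf V F - nf V1 F + size D] vertices of [p] are blocked by
    [count_blocked], so the size hypothesis is the one of [adj_avoid]. *)
Lemma insert F D s p t : HC n -> nf V2 F + size D <= n - 3 ->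
  uniq D -> {subset D <= gd F V2} ->
  walk (adj F) s p t -> uniq p -> {subset p <= gd F V1} ->
  2 * (nf V F - nf V1 F + size D) + 2 <= size p ->
  exists2 p', walk (adj F) s p' t & perm_eq (D ++ p') (p ++ gd F V2).
Proof.
move=> hc hn uD DV hw up hp hs.
have pV x : x \in p -> x \in V1 by move=> /hp; rewrite mem_gd => /andP[].
pose a x := ~~ link F mu x || (mu x \in D).
have ha := count_blocked D up hp.
have [|p1 [u [v [p2 [ep hu hv]]]]] := @adj_avoid _ a p; first by move: ha hs; rewrite /a; arith.
have up1 : u \in p by rewrite ep mem_cat mem_head orbT.
have vp1 : v \in p by rewrite ep mem_cat !inE eqxx !orbT.
have uv : u != v.
  by move: up; rewrite ep cat_uniq cons_uniq inE negb_or => /and3P[_ _ /andP[/andP[]]].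
move: hu hv; rewrite /a !negb_or !negbK => /andP[lu uD'] /andP[lv vD'].
have [q h3 h4] := conn2 hc hn uD DV (pV _ up1) (pV _ vp1) lu lv uD' vD' uv.
exists (rcons p1 u ++ q ++ v :: p2); last by rewrite ep; perm_count.
rewrite ep in hw; apply: (walk_insert hw lu h3).
by rewrite adj_sym.
Qed.

Lemma exit2 F D s p a t : HC n -> nf V2 F + size D <= n - 3 ->
  uniq D -> {subset D <= gd F V2} -> a \in V1 -> link F mu a -> mu a \notin D ->
  t \in gd F V2 -> t \notin D -> mu a != t -> walk (adj F) s p a ->
  exists2 p', walk (adj F) s p' t & perm_eq (D ++ p') (p ++ gd F V2).
Proof.
move=> hc hn uD DV ha la aD ht tD at' h1.
have [q h3 h4] := hc_avoid hc (split_sub2 sp) hn uD DV (link_gd2 sp ha la) ht aD tD at'.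
by exists (p ++ q); [apply: walk_cat h1 la h3 | perm_count].
Qed.

Lemma sub2_gd F a b c d : [/\ a \in V1, b \in V1, c \in V1 & d \in V1] ->
  [/\ link F mu a, link F mu b, link F mu c & link F mu d] ->
  {subset [:: mu a; mu b; mu c; mu d] <= gd F V2}.
Proof.
by move=> [a1 b1 c1 d1] [la lb lc ld] x; rewrite !inE => /or4P[] /eqP->; apply: (link_gd2 sp).
Qed.

Lemma uniq_mu (s : seq T) : {subset s <= V1} -> uniq (map mu s) = uniq s.
Proof.
move=> h; apply: map_inj_in_uniq => x y /h hx /h hy /eqP.
by rewrite (split_mu_inj sp) // => /eqP.
Qed.

Lemma join3 F s p1 a b p2 c d p3 t : D2 n -> nf V2 F <= n - 5 ->
  [/\ a \in V1, b \in V1, c \in V1 & d \in V1] ->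
  [/\ link F mu a, link F mu b, link F mu c & link F mu d] ->
  uniq [:: a; b; c; d] ->
  walk (adj F) s p1 a -> walk (adj F) b p2 c -> walk (adj F) d p3 t ->
  exists2 p, walk (adj F) s p t & perm_eq p (p1 ++ p2 ++ p3 ++ gd F V2).
Proof.
move=> d2 hn hV hl hu h1 h2 h3.
have [||q1 [q2 [g1 g2 g3]]] := d2 V2 F (mu a) (mu b) (mu c) (mu d) (split_sub2 sp) hn.
- rewrite (@uniq_mu [:: a; b; c; d]) // => x.
  by case: hV => a1 b1 c1 d1; rewrite !inE => /or4P[] /eqP->.
- exact: sub2_gd hV hl.
case: hl => la lb lc ld.
exists (p1 ++ q1 ++ p2 ++ q2 ++ p3); last by perm_count.
apply: walk_cat h1 la _; apply: walk_cat g1 (_ : adj F (mu b) b) _; first by rewrite adj_sym.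
apply: walk_cat h2 lc _; apply: walk_cat g2 _ h3; by rewrite adj_sym.
Qed.

End Split.
End Conn.

(** * Repairing one fault and cutting a path or cycle when it is put back *)

Section Walks2.
Variable T : eqType.
Implicit Types (r : rel T) (p q z : seq T) (s t a b w : T).

Lemma walk_loop r s p : walk r s p s -> uniq p -> p = [:: s].
Proof.
case: p => // x [|y p] /and3P[/eqP-> _ /eqP hl]; rewrite //= -[X in X \in _]hl /=.
by rewrite mem_last.
Qed.

Lemma walk_first_bad r r' s p t : walk r' s p t -> walk r s p t \/
  exists p1 a b p2, [/\ p = p1 ++ p2, walk r s p1 a, r' a b, ~~ r a b & walk r' b p2 t].
Proof.
elim: p s => // x p IH s.
case: p IH => [|y p] IH; first by left.
move=> /and3P[/eqP <- /andP[rxy hp] hl].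
have hy : walk r' y (y :: p) t by apply/and3P; split.
have [rx|nrx] := boolP (r x y).
  have [h|[p1 [a [b [p2 [-> h1 h2 h3 h4]]]]]] := IH y hy.
    by left; apply: walk_cons h.
  right; exists (x :: p1), a, b, p2; split => //.
  by apply: walk_cons h1.
right; exists [:: x], x, y, (y :: p); split => //; exact: walk1.
Qed.

Lemma filter_neq_id w p : w \notin p -> filter (predC1 w) p = p.
Proof. by move=> h; apply/all_filterP/allP => x hx /=; apply: contraNneq h => <-. Qed.

End Walks2.

Section Cut.
Variable G : sgraph.
Local Notation T := (vertex G).
Implicit Types (F : seq (T * T)) (V X Y D p q z : seq T) (x y s t u v w : T) (mu : T -> T).

(* un-faults [w] and the edge [uw]; [u = w] stands for a vertex fault *)
Definition rmf u w F := [seq f <- F | f \notin [:: (w, w); (u, w); (w, u)]].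

Lemma good_rmf u w F x : good (rmf u w F) x = good F x || (x == w).
Proof.
rewrite /good mem_filter !inE !xpair_eqE negb_and negbK orbC andbb; congr orb.
by rewrite [(x == u) && _]andbC; case: (x == w).
Qed.

Lemma sub_adj_rmf u w F x y : adj F x y -> adj (rmf u w F) x y.
Proof.
by case/and5P=> h1 h2 h3 h4 h5; rewrite /adj h1 !good_rmf h2 h3 !mem_filter (negPf h4) (negPf h5) !andbF.
Qed.

Lemma adj_rmf u w F x y : adj (rmf u w F) x y -> good F x -> good F y ->
  [\/ adj F x y, good F w /\ (x = u /\ y = w) | good F w /\ (x = w /\ y = u)].
Proof.
move=> h gx gy; have xy := adj_neq h.
case/and5P: h => h1 _ _ h4 h5.
have E a b : a != b -> (a, b) \notin rmf u w F ->
  [\/ (a, b) \notin F, a = u /\ b = w | a = w /\ b = u].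
  move=> ab; rewrite mem_filter negb_and negbK => /orP[|]; last by constructor 1.
  rewrite !inE !xpair_eqE => /or3P[] /andP[/eqP ha /eqP hb]; subst; first by rewrite eqxx in ab.
    by constructor 2.
  by constructor 3.
have yx : y != x by rewrite eq_sym.
have [h6|[ex ey]|[ex ey]] := E x y xy h4; [|subst; by constructor 2|subst; by constructor 3].
have [h7|[ey ex]|[ey ex]] := E y x yx h5; [|subst; by constructor 3|subst; by constructor 2].
by constructor 1; rewrite /adj h1 gx gy h6 h7.
Qed.

Lemma nf_rmf u w F V : u \in V -> w \in V ->
  [|| (w, w) \in F, (u, w) \in F | (w, u) \in F] -> nf V (rmf u w F) < nf V F.
Proof.
move=> hu hw h; set L := [:: (w, w); (u, w); (w, u)].
have -> : nf V F = nf V (rmf u w F) + nf V [seq f <- F | f \in L].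
  rewrite /nf /rmf -count_cat; apply/permP; rewrite perm_sym perm_catC.
  exact/permEl/perm_filterC.
rewrite -addn1 leq_add2l -has_count; apply/hasP.
by case/or3P: h => h; [exists (w, w)|exists (u, w)|exists (w, u)];
  rewrite ?mem_filter ?h ?inE ?eqxx ?orbT // /inside /= ?hu ?hw.
Qed.

Lemma nf_rmf_le u w F V : nf V (rmf u w F) <= nf V F.
Proof. by rewrite /nf count_filter; apply: sub_count => f /andP[]. Qed.

(** Where a walk can be cut when the fault is put back: at the neighbours of w if w is a faulty
    vertex, at the ends of uw otherwise. *)
Definition tch F u w x := if good F w then (x == u) || (x == w) else edge x w.

Lemma gd_rmf_good u w F V : good F w -> gd (rmf u w F) V = gd F V.
Proof. by move=> gw; apply: eq_filter => x; rewrite good_rmf; case: eqP => [->|]; rewrite ?gw ?orbF. Qed.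

Lemma gd_rmf_bad u w F V : ~~ good F w ->
  gd F V = filter (predC1 w) (gd (rmf u w F) V).
Proof.
move=> gw; rewrite /gd -filter_predI; apply: eq_filter => x /=; rewrite good_rmf.
by case: eqP => [->|]; rewrite ?(negPf gw) ?orbF ?andbF.
Qed.

Lemma rmf_walk u w F s p t : walk (adj (rmf u w F)) s p t -> ~~ good F w -> w \notin p ->
  walk (adj F) s p t.
Proof.
move=> h gw wp; apply: sub_walk h => x y hx hy h.
have [] := adj_good h; rewrite !good_rmf.
have /negPf-> : x != w by apply: contraNneq wp => <-.
have /negPf-> : y != w by apply: contraNneq wp => <-.
rewrite !orbF => gx gy.
by have [|[g _]|[g _]] := adj_rmf h gx gy => //; rewrite g in gw.
Qed.

Lemma rmf_walk_good u w F s p t : walk (adj (rmf u w F)) s p t -> good F w ->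
  walk (adj F) s p t \/
  exists p1 a b p2, [/\ p = p1 ++ p2, walk (adj F) s p1 a,
    (a = u /\ b = w) \/ (a = w /\ b = u) & walk (adj (rmf u w F)) b p2 t].
Proof.
move=> h gw; have [|[p1 [a [b [p2 [-> h1 h2 h3 h4]]]]]] := walk_first_bad (adj F) h; first by left.
right; exists p1, a, b, p2; split => //.
have gE x : good (rmf u w F) x = good F x.
  by rewrite good_rmf; case: eqP => [->|_]; rewrite ?gw ?orbF.
have [ga gb] := adj_good h2; rewrite !gE in ga gb.
by have [k|[_ k]|[_ k]] := adj_rmf h2 ga gb; [rewrite k in h3|left|right].
Qed.

(** A walk that does not contain one end of the edge uw cannot use this edge; after its first use on
    a simple walk, one end lies behind. *)
Lemma rmf_walk_tail u w F s p t a : walk (adj (rmf u w F)) s p t -> good F w ->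
  (a = u \/ a = w) -> a \notin p -> walk (adj F) s p t.
Proof.
move=> h gw au ap; have [//|[p1 [c [d [p2 [ep h1 h2 h3]]]]]] := rmf_walk_good h gw.
have cp : c \in p by rewrite ep mem_cat (walk_mem2 h1).
have dp : d \in p by rewrite ep mem_cat (walk_mem1 h3) orbT.
by case/negP: ap; case: au => ->; case: h2 => -[ec ed]; subst c d.
Qed.

(** [z] holds the vertices missed by [p]. It may shrink to [z'], because a repaired vertex w that
    [p] missed is no longer to be visited. *)
Lemma cut_path n V F u w s p t z : sub n V -> walk (adj (rmf u w F)) s p t ->
  perm_eq (z ++ p) (gd (rmf u w F) V) -> good F s -> good F t ->
  exists z', [/\ {subset z' <= z}, size z' <= size z &
   (walk (adj F) s p t /\ perm_eq (z' ++ p) (gd F V)) \/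
   exists p1 a b p2, [/\ walk (adj F) s p1 a, walk (adj F) b p2 t,
     tch F u w a /\ tch F u w b & perm_eq (z' ++ p1 ++ p2) (gd F V)]].
Proof.
move=> sV hp pz gs gt.
have uzp : uniq (z ++ p) by rewrite (perm_uniq pz) (gd_uniq _ sV).
have up : uniq p by move: uzp; rewrite cat_uniq => /and3P[].
have [gw|bw] := boolP (good F w).
  exists z; split => //; rewrite (gd_rmf_good _ _ gw) in pz.
  have [h|[p1 [a [b [p2 [ep h1 h2 h3]]]]]] := rmf_walk_good hp gw; first by left.
  right; exists p1, a, b, p2; split; rewrite -?ep //.
    apply: (rmf_walk_tail h3 gw (a := a)); first by case: h2 => -[]; auto.
    move: up; rewrite ep cat_uniq => /and3P[_ /hasPn h _].
    by apply/negP => /h; rewrite (walk_mem2 h1).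
  by rewrite /tch gw; case: h2 => -[-> ->]; rewrite !eqxx ?orbT.
exists (filter (predC1 w) z); split; first by move=> x; rewrite mem_filter => /andP[].
  by rewrite size_filter count_size.
have {}pz : perm_eq (filter (predC1 w) z ++ filter (predC1 w) p) (gd F V).
  by rewrite (gd_rmf_bad u V bw) -filter_cat; apply: perm_filter.
have [wp|wp] := boolP (w \in p); last first.
  by left; rewrite (filter_neq_id wp) in pz; split => //; apply: (rmf_walk hp).
right.
have ws : w != s by apply: contraNneq bw => ->.
have wt : w != t by apply: contraNneq bw => ->.
have [A [a [B [ep h1 h2 h3]]]] := walk_before hp wp ws.
have Bn : B != [::].
  by apply: contra_neq wt => B0; move: h3; rewrite B0 => /and3P[_ _ /eqP].
have [//|c [b [h4 h5 h6]]] := walk_catP (p := [:: w]) h3 _ Bn.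
have cw : c = w by move: h4 => /= /andP[_ /eqP].
move: up; rewrite ep cat_uniq cons_uniq => /and3P[_ /hasPn hd /andP[wB _]]; subst c.
rewrite ep in pz.
have wA : w \notin A by apply/negP => h; have := hd w (mem_head _ _); rewrite /= h.
exists A, a, b, B; split.
- exact: rmf_walk h1 bw wA.
- exact: rmf_walk h6 bw wB.
- by rewrite /tch (negPf bw) (adj_e h2) edge_sym (adj_e h5).
- by move: pz; rewrite filter_cat (filter_neq_id wA) /= eqxx /= (filter_neq_id wB).
Qed.

(** A cycle that loses one vertex or edge remains a single path. The size hypothesis excludes a list
    of two vertices, for which [cycle] uses the same edge twice. *)
Lemma cut_cycle n V F u w p z : sub n V -> cycle (adj (rmf u w F)) p ->
  perm_eq (z ++ p) (gd (rmf u w F) V) -> 2 < size p ->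
  exists z', [/\ {subset z' <= z}, size z' <= size z &
   (cycle (adj F) p /\ perm_eq (z' ++ p) (gd F V)) \/
   exists q x y, [/\ walk (adj F) x q y, tch F u w x, tch F u w y &
     perm_eq (z' ++ q) (gd F V)]].
Proof.
move=> sV hc pz p2.
have uzp : uniq (z ++ p) by rewrite (perm_uniq pz) (gd_uniq _ sV).
have up : uniq p by move: uzp; rewrite cat_uniq => /and3P[].
have pn : p != [::] by case: (p) p2.
have [x [y [hp hyx]]] := cycle_walk hc pn.
have [gw|bw] := boolP (good F w).
  exists z; split => //; rewrite (gd_rmf_good _ _ gw) in pz.
  have gE v : good (rmf u w F) v = good F v.
    by rewrite good_rmf; case: eqP => [->|_]; rewrite ?gw ?orbF.
  have [gy gx] := adj_good hyx; rewrite !gE in gx gy.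
  have [h|[p1 [a [b [p3 [ep h1 h2 h3]]]]]] := rmf_walk_good hp gw.
    have [ha|[_ [ey ex]]|[_ [ey ex]]] := adj_rmf hyx gy gx; first 1 last.
    - by right; exists p, x, y; rewrite /tch gw -ex -ey !eqxx orbT.
    - by right; exists p, x, y; rewrite /tch gw -ex -ey !eqxx orbT.
    by left; split => //; apply: walk_cycle h ha.
  have ap1 := walk_mem2 h1.
  have /hasPn hd : ~~ has (mem p1) p3 by move: up; rewrite ep cat_uniq => /and3P[].
  have ap3 : a \notin p3 by apply/negP => /hd /=; rewrite ap1.
  have h4 : walk (adj F) b p3 y.
    by apply: (rmf_walk_tail h3 gw (a := a)) => //; case: h2 => -[]; auto.
  (* The broken edge is ab inside the list, so the cycle is read starting from b and ending at a. *)
  have h5 : adj F y x -> exists q x0 y0, [/\ walk (adj F) x0 q y0,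
     tch F u w x0, tch F u w y0 & perm_eq (z ++ q) (gd F V)].
    move=> ha; exists (p3 ++ p1), b, a; split; first exact: walk_cat h4 ha h1.
    - by rewrite /tch gw; case: h2 => -[ea eb]; rewrite ?ea ?eb eqxx ?orbT.
    - by rewrite /tch gw; case: h2 => -[ea eb]; rewrite ?ea ?eb eqxx ?orbT.
    by move: pz; rewrite ep => pz; perm_count.
  have h6 : a <> y by move=> ay; move: ap3; rewrite ay (walk_mem2 h3).
  have h7 : a = x -> b = y -> False.
    move=> ax yb; subst a b.
    have up1 : uniq p1 by move: up; rewrite ep cat_uniq => /and3P[].
    have up3 : uniq p3 by move: up; rewrite ep cat_uniq => /and3P[].
    by move: p2; rewrite ep (walk_loop h1 up1) (walk_loop h4 up3).
  by right; have [ha|[_ [ey ex]]|[_ [ey ex]]] := adj_rmf hyx gy gx; [exact: h5| |];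
    case: h2 => -[ea eb]; (case: h6; congruence) || (case: h7; congruence).
exists (filter (predC1 w) z); split; first by move=> v; rewrite mem_filter => /andP[].
  by rewrite size_filter count_size.
have {}pz : perm_eq (filter (predC1 w) z ++ filter (predC1 w) p) (gd F V).
  by rewrite (gd_rmf_bad u V bw) -filter_cat; apply: perm_filter.
have gE v : v != w -> good (rmf u w F) v = good F v.
  by rewrite good_rmf => /negPf->; rewrite orbF.
have [wp|wp] := boolP (w \in p); last first.
  left; rewrite (filter_neq_id wp) in pz; split => //.
  apply: (walk_cycle (rmf_walk hp bw wp)).
  have xw : x != w by apply: contraNneq wp => <-; apply: walk_mem1 hp.
  have yw : y != w by apply: contraNneq wp => <-; apply: walk_mem2 hp.
  have [gy gx] := adj_good hyx; rewrite !gE // in gx gy.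
  by have [|[g _]|[g _]] := adj_rmf hyx gy gx => //; rewrite g in bw.
right; case/splitPr: wp p2 hc up pz {hp pn uzp} => A B p2 hc up pz.
have {}hc : cycle (adj (rmf u w F)) (w :: (B ++ A)) by rewrite -cat_cons cycle_swap.
have {}up : uniq (w :: (B ++ A)) by rewrite -cat_cons uniq_catC.
have {}pz : perm_eq (filter (predC1 w) z ++ filter (predC1 w) (w :: (B ++ A))) (gd F V).
  apply: perm_trans pz; rewrite perm_cat2l; apply: perm_filter.
  by rewrite -cat_cons perm_catC.
have {p2} : B ++ A != [::] by rewrite -size_eq0; move: p2; rewrite !size_cat /=; lia.
move: (B ++ A) hc up pz => [|c q] //= hc /andP[wq _] pz _.
move: hc; rewrite rcons_path => /and3P[wc hq hl].
exists (c :: q), c, (last c q); split.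
- apply: (rmf_walk (u := u)) bw _ => //; first by rewrite /= hq !eqxx.
- by rewrite /tch (negPf bw) edge_sym (adj_e wc).
- by rewrite /tch (negPf bw) (adj_e hl).
have wc' : w \notin c :: q by [].
by move: pz; rewrite eqxx -/(filter (predC1 w) (c :: q)) (filter_neq_id wc').
Qed.
End Cut.

(** The cycle is run through from s in both directions. Having two different last vertices allows
    avoiding one bad last vertex. *)
Lemma cycle_from (T : eqType) (r : rel T) p s : symmetric r -> cycle r p -> uniq p ->
  s \in p -> 2 < size p -> exists p1 y1 p2 y2,
  [/\ walk r s p1 y1 /\ perm_eq p1 p, walk r s p2 y2 /\ perm_eq p2 p & y1 != y2].
Proof.
move=> rS hc up /splitPr sp; case: sp hc up => A B; rewrite cycle_swap => hc up sz.
have {}up : uniq (s :: B ++ A) by rewrite -cat_cons uniq_catC.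
have ps : perm_eq (s :: B ++ A) (A ++ s :: B) by rewrite -cat_cons perm_catC.
rewrite cat_cons in hc; have {sz} : 1 < size (B ++ A).
  by move: sz; rewrite !size_cat /=; lia.
move: (B ++ A) hc up ps => [|b q] //= /andP[sb]; rewrite rcons_path => /andP[hq ls] up ps sz.
exists (s :: b :: q), (last b q), (s :: rev (b :: q)), b; split.
- by rewrite /= !eqxx sb hq.
- split; last by perm_count.
  apply: walk_cons (_ : walk r (last b q) _ _); first by rewrite rS.
  by apply: walk_rev rS _; rewrite /= hq !eqxx.
have nq : last b q \in q by case: (q) sz => //= c q' _; rewrite mem_last.
by apply: contraTneq nq => ->; case/and3P: up.
Qed.

(** * One dimension up: hamiltonian paths and cycles *)

Section Steps.
Variable G : sgraph.
Local Notation T := (vertex G).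
Implicit Types (F : seq (T * T)) (V X Y D p q z : seq T) (x y s t u v w : T) (mu : T -> T).

Lemma exists_fault V F : 0 < nf V F -> exists u w,
  [/\ (u, w) \in F, u \in V, w \in V & nf V (rmf u w F) < nf V F].
Proof.
rewrite -has_count => /hasP[[u w] h /andP[/= hu hw]].
by exists u, w; split => //; apply: nf_rmf; rewrite ?h ?orbT.
Qed.

Definition linked2 F V a b c d := exists p q,
  [/\ walk (adj F) a p b, walk (adj F) c q d & perm_eq (p ++ q) (gd F V)].

Lemma linked2_swap F V a b c d : linked2 F V a b c d -> linked2 F V c d a b.
Proof. by move=> [p [q [h1 h2 h3]]]; exists q, p; split => //; perm_count. Qed.

Lemma linked2_rev F V a b c d : linked2 F V a b c d -> linked2 F V b a c d.
Proof.
move=> [p [q [h1 h2 h3]]]; exists (rev p), q; split => //; last by perm_count.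
exact: walk_rev (@adj_sym _ _) h1.
Qed.

Section Split.
Variables (n : nat) (V V1 V2 : seq T) (mu : T -> T).
Hypothesis sp : bisection n V V1 V2 mu.

Lemma gd1V F x : x \in gd F V1 -> x \in V1. Proof. by rewrite mem_gd => /andP[]. Qed.
Lemma gd2V F x : x \in gd F V2 -> x \in V2. Proof. by rewrite mem_gd => /andP[]. Qed.

Lemma all_link F x : nf V F <= nf V1 F -> x \in gd F V1 -> link F mu x.
Proof.
move=> h hx; have hsub : {subset [:: x] <= gd F V1} by move=> y; rewrite inE => /eqP->.
by have := nonlink_sub sp (isT : uniq [:: x]) hsub; rewrite /= addn0; case: (link F mu x) => //=; arith.
Qed.

Lemma gd_size1 F p z : perm_eq (z ++ p) (gd F V1) ->
  [/\ uniq p, {subset p <= gd F V1} & 2 ^ n <= size p + size z + nf V1 F].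
Proof.
move=> h; have u : uniq (z ++ p) by rewrite (perm_uniq h) (gd_uniq _ (split_sub1 sp)).
split; first by move: u; rewrite cat_uniq => /and3P[].
  by move=> x hx; rewrite -(perm_mem h) mem_cat hx orbT.
by have := size_gd F (split_sub1 sp); rewrite -(perm_size h) size_cat; arith.
Qed.

(** Here and below, [z] collects the vertices of [V1] already given up, and [D] those of [V2]
    reserved for another use; both stay unvisited. *)
Lemma insert1 F D s p t z : HC G n -> nf V2 F + size D <= n - 3 ->
  uniq D -> {subset D <= gd F V2} -> walk (adj F) s p t ->
  perm_eq (z ++ p) (gd F V1) ->
  2 * nf V F + 2 * size D + size z + 2 <= 2 ^ n ->
  exists2 p', walk (adj F) s p' t & perm_eq (D ++ z ++ p') (gd F V).
Proof.
move=> hc hn uD DV hw pz sz; have [up hp hs] := gd_size1 pz.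
have h := nf_split sp F; have [|p' h1 h2] := insert sp hc hn uD DV hw up hp; first arith.
by exists p' => //; have := split_gd sp F => h3; perm_count.
Qed.

Lemma join1 F D s p1 a b p2 t z : HC G n -> nf V2 F + size D <= n - 3 ->
  uniq D -> {subset D <= gd F V2} ->
  walk (adj F) s p1 a -> walk (adj F) b p2 t -> link F mu a -> link F mu b ->
  mu a \notin D -> mu b \notin D -> perm_eq (z ++ p1 ++ p2) (gd F V1) ->
  exists2 p, walk (adj F) s p t & perm_eq (D ++ z ++ p) (gd F V).
Proof.
move=> hc hn uD DV h1 h2 la lb aD bD pz; have [up hp _] := gd_size1 pz.
have ha := gd1V (hp a _); have hb := gd1V (hp b _).
rewrite !mem_cat (walk_mem2 h1) (walk_mem1 h2) orbT in ha hb.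
have ab : a != b.
  apply: contraTneq up => ab; rewrite cat_uniq !negb_and negbK; apply/orP; right.
  by apply/orP; left; apply/hasP; exists a; [rewrite ab (walk_mem1 h2)|exact: walk_mem2 h1].
have [p h3 h4] := join2 sp hc hn uD DV (ha isT) (hb isT) la lb aD bD ab h1 h2.
by exists p => //; have := split_gd sp F => h6; perm_count.
Qed.

Lemma exit1 F D s p a t z : HC G n -> nf V2 F + size D <= n - 3 ->
  uniq D -> {subset D <= gd F V2} -> link F mu a -> mu a \notin D ->
  t \in gd F V2 -> t \notin D -> mu a != t -> walk (adj F) s p a ->
  perm_eq (z ++ p) (gd F V1) ->
  exists2 p', walk (adj F) s p' t & perm_eq (D ++ z ++ p') (gd F V).
Proof.
move=> hc hn uD DV la aD ht tD at' hw pz; have [_ hp _] := gd_size1 pz.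
have [p' h1 h2] := exit2 sp hc hn uD DV (gd1V (hp _ (walk_mem2 hw))) la aD ht tD at' hw.
by exists p' => //; have := split_gd sp F => h6; perm_count.
Qed.

Section NoAvoid.
Variables (F : seq (T * T)).
Hypotheses (hc : HC G n) (hn : nf V2 F <= n - 3).
Let hn0 : nf V2 F + size (Nil T) <= n - 3. Proof. by rewrite addn0. Qed.
Let nilP X : {subset Nil T <= X}. Proof. by []. Qed.

Lemma insert0 s p t z : walk (adj F) s p t -> perm_eq (z ++ p) (gd F V1) ->
  2 * nf V F + size z + 2 <= 2 ^ n ->
  exists2 p', walk (adj F) s p' t & perm_eq (z ++ p') (gd F V).
Proof.
move=> hw pz sz; apply: (insert1 (D := [::]) hc hn0 isT (@nilP _) hw pz).
by rewrite muln0 addn0.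
Qed.

Lemma join0 s p1 a b p2 t z :
  walk (adj F) s p1 a -> walk (adj F) b p2 t -> link F mu a -> link F mu b ->
  perm_eq (z ++ p1 ++ p2) (gd F V1) ->
  exists2 p, walk (adj F) s p t & perm_eq (z ++ p) (gd F V).
Proof. by move=> h1 h2 la lb; apply: (join1 hc hn0 isT (@nilP _) h1 h2 la lb). Qed.

Lemma exit0 s p a t z : link F mu a -> t \in gd F V2 -> mu a != t ->
  walk (adj F) s p a -> perm_eq (z ++ p) (gd F V1) ->
  exists2 p', walk (adj F) s p' t & perm_eq (z ++ p') (gd F V).
Proof. by move=> la ht at'; apply: (exit1 hc hn0 isT (@nilP _) la _ ht). Qed.

Lemma close0 x q y z : link F mu x -> link F mu y ->
  walk (adj F) x q y -> perm_eq (z ++ q) (gd F V1) -> 1 < size q ->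
  exists2 p, cycle (adj F) p & perm_eq (z ++ p) (gd F V).
Proof.
move=> lx ly hw pz sz; have [uq hq _] := gd_size1 pz.
have xy : y != x by apply: contraTneq sz => yx; subst y; rewrite (walk_loop hw uq).
have hx := gd1V (hq _ (walk_mem1 hw)); have hy := gd1V (hq _ (walk_mem2 hw)).
have [q2 h1 h2] := conn2 sp hc hn0 isT (@nilP _) hy hx ly lx isT isT xy.
exists (q ++ q2); last by have := split_gd sp F => h3; perm_count.
apply: walk_cycle (walk_cat hw ly h1) _; by rewrite adj_sym.
Qed.

Lemma cycle0 p z : cycle (adj F) p -> perm_eq (z ++ p) (gd F V1) ->
  2 * nf V F + size z + 2 <= 2 ^ n ->
  exists2 p', cycle (adj F) p' & perm_eq (z ++ p') (gd F V).
Proof.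
move=> hp pz sz; have [_ _ hs] := gd_size1 pz; have h := nf_split sp F.
have [|x [y [hw hyx]]] := cycle_walk hp; first by rewrite -size_eq0; arith.
have [p' h1 h2] := insert0 hw pz sz.
by exists p' => //; apply: walk_cycle h1 hyx.
Qed.

End NoAvoid.

Lemma hh_half F : 3 <= n -> HC G n -> HH G n -> nf V F <= n - 1 -> nf V2 F <= n - 3 ->
  exists2 p, cycle (adj F) p & perm_eq p (gd F V).
Proof.
move=> n3 hc hh hF hF2.
have pw := pow_ge_double n3.
have ins p : cycle (adj F) p -> perm_eq p (gd F V1) ->
    exists2 p, cycle (adj F) p & perm_eq p (gd F V).
  by move=> hp pp; apply: (cycle0 (z := [::]) hc hF2 hp pp) => /=; arith.
have h12 := nf_split sp F.
have [h1|h1] := leqP (nf V1 F) (n - 2).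
  by have [p hp pp] := hh V1 F (split_sub1 sp) h1; apply: ins hp pp.
(* All n - 1 faults lie in [V1], one more than [hh] allows. One is repaired for a moment; since no
   fault is left elsewhere, every cross edge at a healthy vertex of [V1] survives. *)
have [|u [w [fuw hu hw hlt]]] := @exists_fault V1 F; first arith.
have [|p hp pp] := hh V1 (rmf u w F) (split_sub1 sp); first arith.
have [_ _ sz] := @gd_size1 (rmf u w F) p [::] pp; rewrite /= in sz.
have [|z [_ zs [[h2 h3]|[q [x [y [h2 h3 h4 h5]]]]]]] :=
  @cut_cycle _ n V1 F u w p [::] (split_sub1 sp) hp pp.
- arith.
- by apply: ins h2 _; case: (z) zs h3.
case: z zs h5 => // _ h5; have [_ hq sz'] := @gd_size1 F q [::] h5; rewrite /= in sz'.
have al v : v \in q -> link F mu v by move=> /hq hv; apply: all_link => //; arith.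
apply: (close0 (z := [::]) hc hF2 (al _ (walk_mem1 h2)) (al _ (walk_mem2 h2)) h2 h5).
arith.
Qed.

Lemma hc_11 F s t : 3 <= n -> HC G n -> nf V F <= n - 2 -> nf V2 F <= n - 3 ->
  s \in gd F V1 -> t \in gd F V1 -> s != t ->
  exists2 p, walk (adj F) s p t & perm_eq p (gd F V).
Proof.
move=> n3 hc hF hF2 hs ht st.
have pw := pow_ge_double n3.
have h12 := nf_split sp F.
have ins p : walk (adj F) s p t -> perm_eq p (gd F V1) ->
    exists2 p, walk (adj F) s p t & perm_eq p (gd F V).
  by move=> hp pp; apply: (insert0 (z := [::]) hc hF2 hp pp) => /=; arith.
have [h1|h1] := leqP (nf V1 F) (n - 3).
  by have [p hp pp] := hc V1 F s t (split_sub1 sp) h1 hs ht st; apply: ins hp pp.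
have [|u [w [fuw hu hw hlt]]] := @exists_fault V1 F; first arith.
have gs : good F s by move: hs; rewrite mem_gd => /andP[].
have gt : good F t by move: ht; rewrite mem_gd => /andP[].
have [||||p hp pp] := hc V1 (rmf u w F) s t (split_sub1 sp) => //; first arith.
- by rewrite mem_gd good_rmf gs (gd1V hs).
- by rewrite mem_gd good_rmf gt (gd1V ht).
have [z [_ zs [[h2 h3]|[p1 [a [b [p2 [h2 h3 _ h5]]]]]]]] :=
  @cut_path _ n V1 F u w s p t [::] (split_sub1 sp) hp pp gs gt.
  by apply: ins h2 _; case: (z) zs h3.
case: z zs h5 => // _ h5; have [_ hp12 _] := @gd_size1 F (p1 ++ p2) [::] h5.
have al v : v \in p1 ++ p2 -> link F mu v by move=> /hp12 hv; apply: all_link => //; arith.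
apply: (join0 (z := [::]) hc hF2 h2 h3 _ _ h5); apply: al.
  by rewrite mem_cat (walk_mem2 h2).
by rewrite mem_cat (walk_mem1 h3) orbT.
Qed.

Lemma hc_12 F s t : 3 <= n -> HC G n -> HH G n -> nf V F <= n - 2 -> nf V2 F <= n - 3 ->
  s \in gd F V1 -> t \in gd F V2 ->
  exists2 p, walk (adj F) s p t & perm_eq p (gd F V).
Proof.
move=> n3 hc hh hF hF2 hs ht.
have pw := pow_ge_double n3.
have h12 := nf_split sp F.
have out p a : walk (adj F) s p a -> perm_eq p (gd F V1) -> link F mu a -> mu a != t ->
    exists2 p, walk (adj F) s p t & perm_eq p (gd F V).
  by move=> hp pp la at'; apply: (exit0 (z := [::]) hc hF2 la ht at' hp pp).
have [h1|h1] := leqP (nf V1 F) (n - 3).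
  have [|x /and3P[xV hx lx]] := @pick_link _ _ _ _ _ _ sp F [:: s; mu t]; first by rewrite /=; arith.
  rewrite !inE negb_or => /andP[xs xt].
  have [|p hp pp] := hc V1 F s x (split_sub1 sp) h1 hs hx; first by rewrite eq_sym.
  by apply: (out p x) => //; rewrite (split_mu_eq sp) // (gd2V ht).
(* All n - 2 faults are in [V1], too many for [hc] but not for [hh]. The cycle is opened at s in
   both directions, and the two last vertices are not both matched with t. *)
have [p hp pp] : exists2 p, cycle (adj F) p & perm_eq p (gd F V1).
  by apply: hh; [exact: split_sub1 sp|arith].
have [up sub sz] := @gd_size1 F p [::] pp; rewrite /= in sz.
have sp' : s \in p by rewrite (perm_mem pp).
have [|p1 [y1 [p2 [y2 [[h2 h3] [h4 h5] y12]]]]] := cycle_from (@adj_sym _ F) hp up sp'; first arith.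
have hy1 : y1 \in gd F V1 by rewrite -(perm_mem pp) -(perm_mem h3) (walk_mem2 h2).
have hy2 : y2 \in gd F V1 by rewrite -(perm_mem pp) -(perm_mem h5) (walk_mem2 h4).
have l1 : link F mu y1 by apply: all_link => //; arith.
have l2 : link F mu y2 by apply: all_link => //; arith.
have [e1|n1] := eqVneq (mu y1) t; last by apply: (out p1 y1) => //; apply: perm_trans pp.
apply: (out p2 y2) => //; first by apply: perm_trans pp.
by rewrite -e1 (split_mu_inj sp) ?(gd1V hy1) ?(gd1V hy2) // eq_sym.
Qed.

End Split.
End Steps.

Section Steps.
Variable G : sgraph.
Local Notation T := (vertex G).
Implicit Types (F : seq (T * T)) (V X Y D p q z : seq T) (x y s t u v w : T) (mu : T -> T).

(* the only case of the induction step for [HC] that needs disjoint paths *)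
Definition HC22 n := forall V V1 V2 mu F s t, bisection n V V1 V2 mu ->
  nf V F <= n - 2 -> n - 2 <= nf V1 F -> s \in gd F V2 -> t \in gd F V2 -> s != t ->
  exists2 p, walk (adj F) s p t & perm_eq p (gd F V).

Lemma mem_gd_split n V V1 V2 mu F x : @bisection G n V V1 V2 mu ->
  (x \in gd F V) = (x \in gd F V1) || (x \in gd F V2).
Proof. by move=> sp; rewrite (perm_mem (split_gd sp F)) mem_cat. Qed.

Lemma path_rev F V s t : (exists2 p, walk (adj F) s p t & perm_eq p (gd F V)) ->
  exists2 p, walk (adj F) t p s & perm_eq p (gd F V).
Proof.
by move=> [p h1 h2]; exists (rev p); [apply: walk_rev h1; apply: adj_sym|perm_count].
Qed.

Lemma hc_step n : 3 <= n -> HC G n -> HH G n -> HC22 n -> HC G n.+1.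
Proof.
move=> n3 hc hh h22 V F s t sV hF hs ht st.
have [V1 [V2 [mu sp]]] := sub_split n3 sV.
have spS := split_sym sp; have h12 := nf_split sp F.
have {}hF : nf V F <= n - 2 by arith.
move: hs ht; rewrite !(mem_gd_split _ _ sp) => /orP[hs|hs] /orP[ht|ht].
- have [h2|h2] := leqP (nf V2 F) (n - 3); first exact: (hc_11 sp).
  by apply: (h22 V V2 V1 mu) => //; arith.
- have [h2|h2] := leqP (nf V2 F) (n - 3); first exact: (hc_12 sp).
  by apply: path_rev; apply: (hc_12 spS) => //; arith.
- have [h2|h2] := leqP (nf V1 F) (n - 3); first exact: (hc_12 spS).
  by apply: path_rev; apply: (hc_12 sp) => //; arith.
- have [h2|h2] := leqP (nf V1 F) (n - 3); first exact: (hc_11 spS).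
  by apply: (h22 V V1 V2 mu) => //; arith.
Qed.

(** From n = 4 on, at most one half can hold more than n - 3 of the n - 1 faults. For n = 3 each
    half may hold one, which [hh4] settles by computation. *)
Lemma hh_step n : 4 <= n -> HC G n -> HH G n -> HH G n.+1.
Proof.
move=> n4 hc hh V F sV hF; have n3 : 3 <= n by arith.
have [V1 [V2 [mu sp]]] := sub_split n3 sV.
have spS := split_sym sp; have h12 := nf_split sp F.
have {}hF : nf V F <= n - 1 by arith.
have [h2|h2] := leqP (nf V2 F) (n - 3); first exact: (hh_half sp).
by apply: (hh_half spS) => //; arith.
Qed.

(** [V1] holds all faults, so it has a hamiltonian cycle. This is opened at neighbours u, v whose
    mates differ from s and t, and two disjoint paths spanning [V2] join s to [mu v] and [mu u] to
    t. *)
Lemma hc22_step n : 4 <= n -> HH G n -> D2 G n -> HC22 n.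
Proof.
move=> n4 hh d2 V V1 V2 mu F s t sp hF h1 hs ht st.
have h12 := nf_split sp F.
have [p hp pp] : exists2 p, cycle (adj F) p & perm_eq p (gd F V1).
  by apply: hh; [exact: split_sub1 sp|arith].
have [up sub sz] := @gd_size1 _ _ _ _ _ _ sp F p [::] pp; rewrite /= in sz.
have pw' : n + 12 <= 2 ^ n.
  have [|?] := leqP 5 n; first by move/pow_ge; arith.
  by have -> : n = 4 by arith.
have [|p1 [u [v [p2 [ep hu hv]]]]] := @adj_avoid _ (fun x => ~~ link F mu x || (mu x \in [:: s; t])) p.
  by have := count_blocked sp [:: s; t] up sub; rewrite /=; arith.
move: hu hv => /norP[/negPn lu hu] /norP[/negPn lv hv].
have up1 : u \in p by rewrite ep mem_cat mem_head orbT.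
have vp1 : v \in p by rewrite ep mem_cat !inE eqxx !orbT.
have uv : v != u.
  by move: up; rewrite ep cat_uniq cons_uniq inE negb_or eq_sym => /and3P[_ _ /andP[/andP[]]].
have hw : exists2 q, walk (adj F) v q u & perm_eq q p.
  move: hp; rewrite ep -cat_rcons cycle_swap cat_cons => hp.
  exists (v :: p2 ++ rcons p1 u); last by perm_count.
  move: hp; rewrite /= rcons_path => /andP[h _].
  by rewrite eqxx h last_cat last_rcons eqxx.
have [q hq pq] := hw.
have gu := sub _ up1; have gv := sub _ vp1.
have [|||a [b [ha hb hab]]] := d2 V2 F s (mu v) (mu u) t (split_sub2 sp).
- arith.
- move: hu hv; rewrite ?inE ?negb_or => /andP[us ut] /andP[vs vt].
  rewrite /= !inE !negb_or st ut eq_sym vs eq_sym us (split_mu_inj sp) ?uv ?vt //.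
    exact: gd1V gv.
  exact: gd1V gu.
- move=> x; rewrite !inE => /or4P[] /eqP-> //.
    exact: (link_gd2 sp (gd1V gv) lv).
  exact: (link_gd2 sp (gd1V gu) lu).
exists (a ++ q ++ b); last by have := split_gd sp F => h; perm_count.
apply: walk_cat ha (_ : adj F (mu v) v) _; first by rewrite adj_sym.
exact: walk_cat hq lu hb.
Qed.

(** * One dimension up: spanning pairs of disjoint paths *)

Section D2step.
Variables (n : nat) (V V1 V2 : seq T) (mu : T -> T) (F : seq (T * T)).
Hypotheses (n4 : 4 <= n) (sp : bisection n V V1 V2 mu) (hF : nf V F <= n - 4).
Hypotheses (hc : HC G n) (d2 : D2 G n).
Let h12 := nf_split sp F.
Let pw : 6 * n + 2 <= 2 ^ n \/ n = 4.
Proof. by have [|?] := leqP 5 n; [move/pow_ge; left | right; arith]. Qed.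
Let hn2 : nf V2 F <= n - 3. Proof. by arith. Qed.

(** The digits in the names tell in which half a, b, c and d lie. *)
Lemma d2_1122 a b c d : a \in gd F V1 -> b \in gd F V1 -> c \in gd F V2 -> d \in gd F V2 ->
  a != b -> c != d -> linked2 F V a b c d.
Proof.
move=> ha hb hcc hd ab cd.
have [|p h1 h2] := hc (split_sub1 sp) _ ha hb ab; first arith.
have [|q h3 h4] := hc (split_sub2 sp) _ hcc hd cd; first arith.
by exists p, q; split => //; have := split_gd sp F => h; perm_count.
Qed.

(** If [d2] applies in [V1], then [V2] is inserted into the longer of the two paths. Otherwise all
    faults are in [V1], and both paths are carved out of one hamiltonian path of [V1] from a to
    b. *)
Lemma d2_1111 a b c d : uniq [:: a; b; c; d] -> {subset [:: a; b; c; d] <= gd F V1} ->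
  linked2 F V a b c d.
Proof.
move=> hu hs.
have hsp := split_gd sp F.
have [h1|h1] := leqP (nf V1 F) (n - 5).
  have [p [q [h2 h3 h4]]] := d2 (split_sub1 sp) h1 hu hs.
  have ins p0 q0 x y : walk (adj F) x p0 y -> perm_eq (q0 ++ p0) (gd F V1) -> size q0 <= size p0 ->
     exists2 p', walk (adj F) x p' y & perm_eq (q0 ++ p') (gd F V).
    move=> hw pp sz; have [up sub s1] := gd_size1 sp pp.
    have [||p' g1 g2] := @insert _ _ _ _ _ _ sp F [::] x p0 y hc _ isT (@sub_nil _ _) hw up sub.
    - by rewrite addn0.
    - rewrite /= addn0; case: pw => [|n4']; [arith|].
      by move: s1 h12 hF; rewrite n4' /=; arith.
    by exists p' => //; perm_count.
  have [sz|sz] := leqP (size q) (size p).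
    have [|p' g1 g2] := ins p q a b h2 _ sz; first by perm_count.
    by exists p', q; split => //; perm_count.
  have [|p' g1 g2] := ins q p c d h3 h4; first exact: ltnW.
  by exists p, p'.
have [ha hb hcc hd] : [/\ a \in gd F V1, b \in gd F V1, c \in gd F V1 & d \in gd F V1].
  by split; apply: hs; rewrite !inE eqxx ?orbT.
have hl x : x \in gd F V1 -> link F mu x by move=> hx; apply: (all_link sp) => //; arith.
move: hu; rewrite /= !inE !negb_or => /and4P[/and3P[ab ac ad] /andP[bc bd] cd _].
have [|p hp pp] := hc (split_sub1 sp) _ ha hb ab; first arith.
(* The stretch of [p] from c' to d' becomes the second path; the two outer pieces are rejoined
   through [V2]. *)
have main c' d' : c' \in p -> c' != a -> d' \in p -> d' != b -> c' != d' ->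
   (exists A a' B, [/\ p = A ++ c' :: B, walk (adj F) a A a', adj F a' c' & walk (adj F) c' (c' :: B) b] /\ d' \in c' :: B) ->
   linked2 F V a b c' d'.
  move=> c1 c2 d1 d2' cd' [A [a' [B [[ep w1 w2 w3] dB]]]].
  have [A2 [b' [B2 [eB w4 w5 w6]]]] := walk_after w3 dB d2'.
  rewrite ep eB in pp.
  have a'A := walk_mem2 w1; have b'B := walk_mem1 w6.
  have ga : a' \in gd F V1 by rewrite -(perm_mem pp) mem_cat a'A.
  have gb : b' \in gd F V1 by rewrite -(perm_mem pp) !mem_cat b'B !orbT.
  have [|p' w7 w8] := join0 (z := rcons A2 d') sp hc hn2 w1 w6 (hl _ ga) (hl _ gb).
    by perm_count.
  by exists p', (rcons A2 d'); split => //; perm_count.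
have cp : c \in p by rewrite (perm_mem pp).
have dp : d \in p by rewrite (perm_mem pp).
have ca : c != a by rewrite eq_sym.
have da : d != a by rewrite eq_sym.
have cb : c != b by rewrite eq_sym.
have db : d != b by rewrite eq_sym.
have [A [a' [B [ep w1 w2 w3]]]] := walk_before hp cp ca.
have [dB|dB] := boolP (d \in c :: B).
  by apply: (main c d cp ca dp db cd); exists A, a', B; split.
have dA : d \in A by move: dp dB; rewrite ep mem_cat; case: (d \in A) => //= ->.
apply: linked2_swap; apply: linked2_rev; apply: linked2_swap.
have [A2 [a2 [B2 [eA w4 w5 w6]]]] := walk_before w1 dA da.
apply: (main d c dp da cp cb); first by rewrite eq_sym.
exists A2, a2, (B2 ++ c :: B); split; last by rewrite -cat_cons mem_cat mem_head orbT.
split => //; first by rewrite ep eA -catA.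
exact: walk_cat w6 w2 w3.
Qed.

(** In a light [V1] the second path ends at an auxiliary x and leaves to d. In a heavy one the first
    path spans [V1] without c, and c crosses over at once; if its mate is d, then c, d is the whole
    second path and the rest of [V2] goes into the first. *)
Lemma d2_1112 a b c d : uniq [:: a; b; c] -> {subset [:: a; b; c] <= gd F V1} ->
  d \in gd F V2 -> linked2 F V a b c d.
Proof.
move=> hu hs hd; have hsp := split_gd sp F.
have [ha hb hcc] : [/\ a \in gd F V1, b \in gd F V1 & c \in gd F V1].
  by split; apply: hs; rewrite !inE eqxx ?orbT.
have [h1|h1] := leqP (nf V1 F) (n - 5).
  have [|x /and3P[xV hx lx]] := @pick_link _ _ _ _ _ _ sp F [:: a; b; c; mu d].
    by rewrite /=; case: pw => [|n4']; [arith|move: hF; rewrite n4'; arith].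
  rewrite !inE !negb_or => /and4P[xa xb xc xd].
  have [||p [q [h2 h3 h4]]] := d2 (a := a) (b := b) (c := c) (d := x) (split_sub1 sp) h1.
  - move: hu; rewrite /= !inE !negb_or !andbT => /andP[/andP[-> ->] ->].
    by rewrite eq_sym xa eq_sym xb eq_sym xc.
  - by move=> y; rewrite !inE => /or4P[] /eqP->.
  have xd' : mu x != d by rewrite (split_mu_eq sp) // (gd2V hd).
  have [|q' g1 g2] := @exit2 _ _ _ _ _ _ sp F [::] c q x d hc _ isT (@sub_nil _ _) xV lx isT hd isT xd' h3.
    by rewrite addn0.
  by exists p, q'; split => //; perm_count.
have hl x : x \in gd F V1 -> link F mu x by move=> hx; apply: (all_link sp) => //; arith.
move: hu; rewrite /= !inE !negb_or => /andP[/andP[ab ac] /andP[bc _]].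
have cV : {subset [:: c] <= gd F V1} by move=> x; rewrite inE => /eqP->.
have [||||p hp pp] := @hc_avoid _ n V1 F [:: c] a b hc (split_sub1 sp) _ isT cV ha hb; rewrite ?inE //=.
  by rewrite /=; arith.
have lc := hl _ hcc; have cd := link_gd2 sp (gd1V hcc) lc.
have [e1|n1] := eqVneq (mu c) d; last first.
  have [q h3 h4] := hc (split_sub2 sp) hn2 cd hd n1.
  by exists p, (c :: q); split => //; [apply: walk_cons h3|perm_count].
have dV : {subset [:: d] <= gd F V2} by move=> x; rewrite inE => /eqP->.
have [||p' g1 g2] := @insert1 _ _ _ _ _ _ sp F [:: d] a p b [:: c] hc _ isT dV hp pp.
- by rewrite /=; arith.
- by rewrite /=; case: pw => [|n4']; [arith|move: h1 h12 hF; rewrite n4' /=; arith].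
exists p', [:: c; d]; split => //; last by perm_count.
by rewrite /= -e1 !eqxx !andbT; exact: lc.
Qed.

(** In a light [V1] two pairs of disjoint paths meet at two cross edges. In a heavy one a
    hamiltonian path from a to c is opened at a place where both parts can cross over. *)
Lemma d2_1212 a b c d : a \in gd F V1 -> c \in gd F V1 -> b \in gd F V2 -> d \in gd F V2 ->
  a != c -> b != d -> nf V2 F <= n - 5 -> linked2 F V a b c d.
Proof.
move=> ha hcc hb hd ac bd h2; have hsp := split_gd sp F.
have [h1|h1] := leqP (nf V1 F) (n - 5).
  have [|x /and3P[xV hx lx]] := @pick_link _ _ _ _ _ _ sp F [:: a; c; mu b; mu d].
    by rewrite /=; case: pw => [|n4']; [arith|move: hF; rewrite n4'; arith].
  rewrite !inE !negb_or => /and4P[xa xc xb xd].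
  have [|y /and3P[yV hy ly]] := @pick_link _ _ _ _ _ _ sp F [:: a; c; mu b; mu d; x].
    by rewrite /=; case: pw => [|n4']; [arith|move: hF; rewrite n4'; arith].
  rewrite !inE !negb_or => /and5P[ya yc yb yd yx].
  have [||p [q [h3 h4 h5]]] := d2 (a := a) (b := x) (c := c) (d := y) (split_sub1 sp) h1.
  - by rewrite /= !inE !negb_or eq_sym xa ac eq_sym ya xc eq_sym yx eq_sym yc.
  - by move=> z; rewrite !inE => /or4P[] /eqP->.
  have bV := gd2V hb; have dV := gd2V hd.
  have [||p' [q' [h6 h7 h8]]] := d2 (a := mu x) (b := b) (c := mu y) (d := d) (split_sub2 sp) h2.
  - have f1 : mu x != b by rewrite (split_mu_eq sp).
    have f2 : mu x != mu y by rewrite (split_mu_inj sp) // eq_sym.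
    have f3 : mu x != d by rewrite (split_mu_eq sp).
    have f4 : b != mu y by rewrite eq_sym (split_mu_eq sp).
    have f5 : mu y != d by rewrite (split_mu_eq sp).
    by rewrite /= !inE !negb_or f1 f2 f3 f4 f5 bd.
  - move=> z; rewrite !inE => /or4P[] /eqP-> //.
      exact: (link_gd2 sp).
    exact: (link_gd2 sp).
  exists (p ++ p'), (q ++ q'); split; last by perm_count.
    exact: walk_cat h3 lx h6.
  exact: walk_cat h4 ly h7.
have hl x : x \in gd F V1 -> link F mu x by move=> hx; apply: (all_link sp) => //; arith.
have [|p hp pp] := hc (split_sub1 sp) _ ha hcc ac; first arith.
have [up sub sz] := @gd_size1 _ _ _ _ _ _ sp F p [::] pp; rewrite /= in sz.
have [|p1 [u [v [p2 [ep hu hv]]]]] := @adj_avoid _ (fun x => ~~ link F mu x || (mu x \in [:: b; d])) p.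
  by have := count_blocked sp [:: b; d] up sub; rewrite /=; case: pw => [|n4']; [arith|move: h1 h12 hF; rewrite n4' /=; arith].
move: hu hv => /norP[/negPn lu hu] /norP[/negPn lv hv].
have up1 : u \in p by rewrite ep mem_cat mem_head orbT.
have vp1 : v \in p by rewrite ep mem_cat !inE eqxx !orbT.
have uv : u != v.
  by move: up; rewrite ep cat_uniq cons_uniq inE negb_or => /and3P[_ _ /andP[/andP[]]].
have gu := sub _ up1; have gv := sub _ vp1.
have [||q1 [q2 [h3 h4 h5]]] := d2 (a := mu u) (b := b) (c := mu v) (d := d) (split_sub2 sp) h2.
- move: hu hv; rewrite ?inE ?negb_or => /andP[ub ud] /andP[vb vd].
  have f2 : mu u != mu v by rewrite (split_mu_inj sp) ?(gd1V gu) ?(gd1V gv).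
  have f4 : b != mu v by rewrite eq_sym.
  by rewrite /= !inE !negb_or ub ud vd bd f2 f4.
- move=> x; rewrite !inE => /or4P[] /eqP-> //.
    exact: (link_gd2 sp (gd1V gu) lu).
  exact: (link_gd2 sp (gd1V gv) lv).
have wu : walk (adj F) a (rcons p1 u) u /\ walk (adj F) v (v :: p2) c.
  move: hp; rewrite ep -cat_rcons => hp.
  have [||a' [b' [k1 k2 k3]]] := walk_catP hp; rewrite -?size_eq0 ?size_rcons //.
  have ea := walk_rcons_end k1; have eb := walk_cons_start k3.
  by subst a' b'; split.
have [wu1 wv] := wu.
exists (rcons p1 u ++ q1), (rev (v :: p2) ++ q2); split; last by rewrite ep in pp; perm_count.
  exact: walk_cat wu1 lu h3.
by apply: walk_cat (walk_rev (@adj_sym _ _) wv) lv h4.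
Qed.

End D2step.

(** Exchanging the halves, the two pairs, or the ends of a pair reduces every position of the four
    ends to these four. *)
Lemma linked2_cases n V V1 V2 mu F : bisection n V V1 V2 mu ->
  (forall W1 W2, bisection n V W1 W2 mu ->
    [/\ forall a b c d, uniq [:: a; b; c; d] -> {subset [:: a; b; c; d] <= gd F W1} ->
          linked2 F V a b c d,
        forall a b c d, uniq [:: a; b; c] -> {subset [:: a; b; c] <= gd F W1} ->
          d \in gd F W2 -> linked2 F V a b c d,
        forall a b c d, a \in gd F W1 -> b \in gd F W1 -> c \in gd F W2 ->
          d \in gd F W2 -> a != b -> c != d -> linked2 F V a b c d &
        forall a b c d, a \in gd F W1 -> c \in gd F W1 -> b \in gd F W2 ->
          d \in gd F W2 -> a != c -> b != d -> linked2 F V a b c d]) ->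
  forall a b c d, uniq [:: a; b; c; d] -> {subset [:: a; b; c; d] <= gd F V} ->
  linked2 F V a b c d.
Proof.
move=> sp cases a b c d.
rewrite /= !inE !negb_or => /and4P[/and3P[ab ac ad] /andP[bc bd] cd _] hs.
have [ha hb hcc hd] : [/\ a \in gd F V, b \in gd F V, c \in gd F V & d \in gd F V].
  by split; apply: hs; rewrite !inE eqxx ?orbT.
have spS := split_sym sp.
have sub4 (W : seq T) a0 b0 c0 d0 : a0 \in W -> b0 \in W -> c0 \in W -> d0 \in W -> {subset [:: a0; b0; c0; d0] <= W}.
  by move=> ? ? ? ? x; rewrite !inE => /or4P[] /eqP->.
have sub3 (W : seq T) a0 b0 c0 : a0 \in W -> b0 \in W -> c0 \in W -> {subset [:: a0; b0; c0] <= W}.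
  by move=> ? ? ? x; rewrite !inE => /or3P[] /eqP->.
have ba : b != a by rewrite eq_sym.
have key W1 W2 (sp' : bisection n V W1 W2 mu) a0 b0 c0 d0 :
  [/\ a0 != b0, a0 != c0, a0 != d0 & [/\ b0 != c0, b0 != d0 & c0 != d0]] ->
  a0 \in gd F W1 -> b0 \in gd F W1 -> c0 \in gd F V -> d0 \in gd F V -> linked2 F V a0 b0 c0 d0.
  move=> [ab' ac' ad' [bc' bd' cd']] a1 b1; rewrite !(mem_gd_split _ _ sp') => /orP[]c1 /orP[]d1.
  - have [h _ _ _] := cases _ _ sp'; apply: h; [by rewrite /= !inE !negb_or ab' ac' ad' bc' bd' cd'|exact: sub4].
  - have [_ h _ _] := cases _ _ sp'; apply: h => //; [by rewrite /= !inE !negb_or ab' ac' bc'|exact: sub3].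
  - apply: linked2_swap; apply: linked2_rev; apply: linked2_swap.
    have [_ h _ _] := cases _ _ sp'; apply: h => //; [by rewrite /= !inE !negb_or ab' ad' bd'|exact: sub3].
  - have [_ _ h _] := cases _ _ sp'; exact: h.
have key2 W1 W2 (sp' : bisection n V W1 W2 mu) a0 b0 c0 d0 :
  a0 != c0 -> b0 != d0 -> a0 \in gd F W1 -> c0 \in gd F W1 -> b0 \in gd F W2 -> d0 \in gd F W2 ->
  linked2 F V a0 b0 c0 d0.
  by move=> ac' bd' a1 c1 b1 d1; have [_ _ _ h] := cases _ _ sp'; apply: h.
have key3 W1 W2 (sp' : bisection n V W1 W2 mu) a0 b0 c0 d0 :
  [/\ a0 != b0, a0 != c0, a0 != d0 & [/\ b0 != c0, b0 != d0 & c0 != d0]] ->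
  a0 \in gd F W1 -> b0 \in gd F W2 -> c0 \in gd F V -> d0 \in gd F V -> linked2 F V a0 b0 c0 d0.
  move=> [ab' ac' ad' [bc' bd' cd']] a1 b1 cV dV; have := cV; have := dV.
  have spS' := split_sym sp'; rewrite !(mem_gd_split _ _ sp') => /orP[]d1 /orP[]c1.
  - apply: linked2_swap; apply: (key _ _ sp') => //; last by rewrite (mem_gd_split _ _ sp') b1 orbT.
      by rewrite [c0 == a0]eq_sym [c0 == b0]eq_sym [d0 == a0]eq_sym [d0 == b0]eq_sym; split.
    by rewrite (mem_gd_split _ _ sp') a1.
  - apply: linked2_swap; apply: linked2_rev; apply: linked2_swap; exact: (key2 _ _ sp').
  - exact: (key2 _ _ sp').
  - apply: linked2_swap; apply: (key _ _ spS') => //; last by rewrite (mem_gd_split _ _ sp') b1 orbT.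
      by rewrite [c0 == a0]eq_sym [c0 == b0]eq_sym [d0 == a0]eq_sym [d0 == b0]eq_sym; split.
    by rewrite (mem_gd_split _ _ sp') a1.
have := ha; have := hb; rewrite !(mem_gd_split _ _ sp) => /orP[]b1 /orP[]a1.
- exact: (key _ _ sp).
- apply: linked2_rev; apply: (key3 _ _ sp) => //.
- exact: (key3 _ _ sp).
- exact: (key _ _ spS).
Qed.

Lemma d2_step n : 4 <= n -> HC G n -> D2 G n -> D2 G n.+1.
Proof.
move=> n4 hc d2 V F a b c d sV hF; have n3 : 3 <= n by arith.
have [V1 [V2 [mu sp]]] := sub_split n3 sV.
have {}hF : nf V F <= n - 4 by arith.
apply: (linked2_cases sp) => W1 W2 sp'; split.
- exact: (d2_1111 n4 sp' hF hc d2).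
- exact: (d2_1112 n4 sp' hF hc d2).
- exact: (d2_1122 n4 sp' hF hc).
move=> {}a {}b {}c {}d a1 c1 b1 d1 ac bd; have spS' := split_sym sp'.
have [h|h] := leqP (nf W2 F) (n - 5); first exact: (d2_1212 n4 sp' hF hc d2).
apply: linked2_rev; apply: linked2_swap; apply: linked2_rev; apply: linked2_swap.
by apply: (d2_1212 n4 spS' hF hc d2) => //; have := nf_split sp' F; arith.
Qed.

End Steps.

(** * Computations on the 8-vertex network *)

(* [vm_compute] evaluates both arguments of [||] and [&&], hence variants of [has] and [all] by [if]. *)
Fixpoint hasb T (a : pred T) (s : seq T) : bool :=
  if s is x :: s' then if a x then true else hasb a s' else false.
Fixpoint allb T (a : pred T) (s : seq T) : bool :=
  if s is x :: s' then if a x then allb a s' else false else true.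
Lemma hasbE T (a : pred T) s : hasb a s = has a s. Proof. by elim: s => //= x s ->. Qed.
Lemma allbE T (a : pred T) s : allb a s = all a s. Proof. by elim: s => //= x s ->. Qed.

(* a fault of the 3-dimensional network; (8, 8) stands for no fault *)
Definition adjn (f : nat * nat) : rel nat := fun i j =>
  if ltqn i j then
    if [|| (i, i) == f, (j, j) == f, (i, j) == f | (j, i) == f] then false else true
  else false.
Definition gdn (f : nat * nat) := [seq i <- iota 0 8 | (i, i) != f].

(** Depth-first enumeration of the simple paths from x with at most n further vertices; the second
    component lists the vertices not visited, so it is empty exactly for spanning paths. *)
Fixpoint ext (r : rel nat) n x rest : seq (seq nat * seq nat) :=
  ([:: x], rest) :: if n is n'.+1 then
    flatten [seq [seq (x :: pr.1, pr.2) | pr <- ext r n' y (rem y rest)] |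
             y <- [seq y <- rest | r x y]]
  else [::].

Lemma ext_sound r n x rest pr : pr \in ext r n x rest ->
  walk r x pr.1 (last x pr.1) /\ perm_eq (pr.1 ++ pr.2) (x :: rest).
Proof.
elim: n x rest pr => [|n IH] x rest pr /=.
  by rewrite inE => /eqP->; split=> //; apply: walk1.
rewrite inE => /orP[/eqP->|]; first by split=> //; apply: walk1.
case/flattenP=> l /mapP[y]; rewrite mem_filter => /andP[rxy yr] -> /mapP[pr' h ->] /=.
have [h1 h2] := IH _ _ _ h; split.
  case: (pr'.1) h1 => // a l' h1; apply: (walk_cons rxy).
  by case/and3P: (h1) => /eqP ay h3 _; rewrite /walk /= ay h3 !eqxx.
rewrite perm_cons; apply: perm_trans h2 _.
by rewrite perm_sym perm_to_rem.
Qed.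

Definition hpaths f := flatten [seq [seq pr.1 | pr <-
  [seq pr <- ext (adjn f) 8 x (rem x (gdn f)) | nilp pr.2]] | x <- gdn f].
Definition hends f := [seq (head 8 p, last 8 p) | p <- hpaths f].

(* ends of the spanning pairs of disjoint paths that start at [s] and [t] *)
Definition covers f s t := if s \notin gdn f then [::] else flatten [seq
   [seq (last s pr.1, last t qr.1) | qr <-
      [seq qr <- ext (adjn f) 8 t (rem t pr.2) | nilp qr.2]] | pr <-
   [seq pr <- ext (adjn f) 8 s (rem s (gdn f)) | t \in pr.2]].

Definition mat (l : seq (nat * nat)) :=
  [seq [seq (i, j) \in l | j <- iota 0 8] | i <- iota 0 8].
Definition mget (m : seq (seq bool)) i j := nth false (nth [::] m i) j.

(* every injection of {0..7} into itself that extends [pre] has a prefix satisfying [ok] *)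
Fixpoint search (ok : seq nat -> bool) k pre : bool :=
  if ok pre then true else
  if k is k'.+1 then allb (fun v => if v \in pre then true else search ok k' (rcons pre v)) (iota 0 8)
  else false.

(* [pre] lists the mates of 0, ..., k; a path of one half from [x] to [k] and a path of the other half
   between their mates close up *)
Definition hits (A B : seq (seq bool)) pre : bool :=
  let k := (size pre).-1 in let v := last 8 pre in
  hasb (fun x => let w := nth 8 pre x in
    if (if mget A x k then mget B w v else false) then true else
    if mget A k x then mget B v w else false) (iota 0 k).

Definition covs f := [seq [seq mat (covers f s t) | t <- iota 0 8] | s <- iota 0 8].
Definition cget (c : seq (seq (seq (seq bool)))) s t := nth [::] (nth [::] c s) t.

(* up to an automorphism, one end of a fault is the vertex 0 *)
Definition faults0 := [:: (8, 8); (0, 0); (0, 1); (0, 3); (0, 4)].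

(** The ends of two disjoint paths that span a half, neither of them a single vertex, since each is
    to be entered and left by different cross edges. *)
Definition quads f := flatten [seq flatten [seq
   [seq (s, xy.1, (t, xy.2)) | xy <- [seq xy <- undup (covers f s t) | (xy.1 != s) && (xy.2 != t)]]
   | t <- gdn f] | s <- gdn f].

(* a cycle that crosses between the two halves four times *)
Definition cross4 (Q : seq (nat * nat * (nat * nat))) (c : seq (seq (seq (seq bool)))) pre :=
  if size pre == 8 then
    hasb (fun q => let: (s, x, (t, y)) := q in
      let g := nth 8 pre in mget (cget c (g x) (g y)) (g t) (g s)) Q
  else false.

Definition hh_ok A B Q c pre := if hits A B pre then true else cross4 Q c pre.

(** Each half has its own numbering that puts its fault at 0, so the matching is an arbitrary
    bijection, and the search runs over all of them. Four crossings are tried only when each half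
    has lost a vertex. *)
Definition chkHH :=
  let E := [seq (f, mat (hends f)) | f <- faults0] in
  let M := mat (hends (0, 0)) in
  let Q := quads (0, 0) in let c := covs (0, 0) in
  allb (fun a => allb (fun b =>
    if (a.1 == (0, 0)) && (b.1 == (0, 0)) then search (hh_ok M M Q c) 8 [::]
    else search (hits a.2 b.2) 8 [::]) E) E.
Lemma chkHH_holds : chkHH. Proof. by vm_compute. Qed.

(** The path from a to b stays inside one half. The pieces that start at c and d have free ends, to
    be joined through the other half. *)
Definition three a b c d :=
  hasb (fun pr => if (last a pr.1 == b) && (c \in pr.2) && (d \in pr.2) then
    hasb (fun qr => if d \in qr.2 then
       hasb (fun lr => nilp lr.2) (ext (adjn (8, 8)) 8 d (rem d qr.2)) else false)
       (ext (adjn (8, 8)) 8 c (rem c pr.2)) else false)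
   (ext (adjn (8, 8)) 8 a (rem a (iota 0 8))).

Definition chk1111 :=
  let I := iota 0 8 in
  allb (fun b => allb (fun c => allb (fun d =>
    if uniq [:: 0; b; c; d] then if three 0 b c d then true else three c d 0 b else true) I) I) I.
Lemma chk1111_holds : chk1111. Proof. by vm_compute. Qed.

(** Two different free ends of the path that starts at c are required, since the mate of one of them
    may be the prescribed end d. *)
Definition chk1112 :=
  let I := iota 0 8 in
  allb (fun c => if c == 0 then true else let L := undup (covers (8, 8) 0 c) in
   allb (fun b => if (b == 0) || (b == c) then true else
     1 < size [seq xy <- L | xy.1 == b]) I) I.
Lemma chk1112_holds : chk1112. Proof. by vm_compute. Qed.

Definition covs0 := [seq mat (covers (8, 8) 0 t) | t <- iota 0 8].

(** A hamiltonian path of the faulty half has to fit between the free ends of two disjoint paths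
    that start at 0 and t in the other half. *)
Definition chk22 := let c := covs0 in
  allb (fun f => let A := mat (hends f) in
    allb (fun t => if t == 0 then true else search (hits A (nth [::] c t)) 8 [::])
      (iota 0 8)) faults0.
Definition chk1212 := let c := covs0 in
  allb (fun s => if s == 0 then true else let A := nth [::] c s in
    allb (fun t => if t == 0 then true else search (hits A (nth [::] c t)) 8 [::])
      (iota 0 8)) (iota 0 8).
Lemma chk22_holds : chk22. Proof. by vm_compute. Qed.
Lemma chk1212_holds : chk1212. Proof. by vm_compute. Qed.

(* the automorphism number [i] maps 0 to [i] *)
Definition auts := [:: [:: 0; 1; 2; 3; 4; 5; 6; 7]; [:: 1; 0; 3; 2; 5; 4; 7; 6];
  [:: 2; 3; 0; 1; 7; 6; 5; 4]; [:: 3; 2; 1; 0; 6; 7; 4; 5];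
  [:: 4; 5; 1; 0; 7; 6; 3; 2]; [:: 5; 4; 0; 1; 6; 7; 2; 3];
  [:: 6; 7; 2; 3; 5; 4; 0; 1]; [:: 7; 6; 3; 2; 4; 5; 1; 0]].

Definition chkA := all (fun i => let a := nth [::] auts i in
  [&& nth 0 a 0 == i, perm_eq a (iota 0 8) &
    all (fun j => all (fun k => ltqn (nth 0 a j) (nth 0 a k) == ltqn j k) (iota 0 8)) (iota 0 8)])
  (iota 0 8).
Lemma chkA_holds : chkA. Proof. by vm_compute. Qed.

Lemma ltqn_lt i j : ltqn i j -> (i < 8) && (j < 8).
Proof.
move=> h; have : all (fun ij => (ij.1 < 8) && (ij.2 < 8)) ltq3_edges by [].
by case/orP: h => h /allP /(_ _ h) //= /andP[-> ->].
Qed.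

Definition chkHC3 := all (fun j => (j == 0) || ((0, j) \in hends (8, 8))) (iota 0 8).
Lemma chkHC3_holds : chkHC3. Proof. by vm_compute. Qed.
Definition chkHH3 := all (fun f => has (fun p => cycle (adjn f) p) (hpaths f)) faults0.
Lemma chkHH3_holds : chkHH3. Proof. by vm_compute. Qed.

Lemma searchS ok k pre : search ok k.+1 pre = if ok pre then true else
  allb (fun v => if v \in pre then true else search ok k (rcons pre v)) (iota 0 8).
Proof. by []. Qed.

(** The values of [phi] single out one branch of the search tree; a successful search has met a
    prefix with [ok] on it. *)
Lemma search_sound ok (phi : nat -> nat) : (forall i, i < 8 -> phi i < 8) ->
  {in gtn 8 &, injective phi} -> forall k m, m + k = 8 ->
  search ok k (map phi (iota 0 m)) -> exists2 m', m' <= 8 & ok (map phi (iota 0 m')).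
Proof.
move=> p8 pI; elim=> [|k IH] m mk.
  by rewrite /=; case: ifP => // h _; exists m => //; lia.
rewrite searchS; case: ifP => h; first by move=> _; exists m => //; lia.
rewrite allbE => /allP /(_ (phi m)).
have m8 : m < 8 by lia.
rewrite mem_iota (p8 _ m8) => /(_ isT).
case: ifP => [|_].
  case/mapP=> i; rewrite mem_iota add0n => /andP[_ im] /pI.
  rewrite !unfold_in /= => /(_ m8 (ltn_trans im m8)) e; move: im; rewrite e ltnn //.
rewrite -map_rcons -cats1 -[[:: m]]/(iota m 1) -{2}[m]add0n -iotaD addn1.
by apply: IH; lia.
Qed.

Lemma mget_mat l x y : x < 8 -> y < 8 -> mget (mat l) x y -> (x, y) \in l.
Proof. by move=> hx hy; rewrite /mget /mat !(nth_map 0) ?size_iota // !nth_iota. Qed.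

Lemma hits_sound A B (phi : nat -> nat) m : m <= 8 -> hits A B (map phi (iota 0 m)) ->
  exists x y, [/\ x < 8, y < 8, x != y, mget A x y & mget B (phi x) (phi y)].
Proof.
case: m => // m m8; rewrite /hits hasbE size_map size_iota [m.+1.-1]/= => /hasP[x].
rewrite mem_iota add0n => /andP[_ xm].
have -> : last 8 [seq phi i | i <- iota 0 m.+1] = phi m.
  by rewrite -nth_last size_map size_iota (nth_map 0) ?size_iota // nth_iota.
have -> : nth 8 [seq phi i | i <- iota 0 m.+1] x = phi x.
  by rewrite (nth_map 0) ?size_iota ?nth_iota //; lia.
have xm' : x != m by rewrite neq_ltn xm.
have mx : m != x by rewrite eq_sym.
have x8 : x < 8 by lia.
case: ifP => [|_].
  by case: ifP => // h1 h2 _; exists x, m.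
by case: ifP => // h1 h2; exists m, x.
Qed.

(** * Transfer from the computations to networks of dimension 3 *)

Section Base.
Variable G : sgraph.
Local Notation T := (vertex G).
Implicit Types (F : seq (T * T)) (V X Y D p q z : seq T) (x y s t u v w : T) (mu : T -> T).
Implicit Types (h k : nat -> T) (f : nat * nat).

Definition numbering V h := [/\ uniq (map h (iota 0 8)), perm_eq V (map h (iota 0 8)) &
  forall i j, i < 8 -> j < 8 -> edge (h i) (h j) = ltqn i j].

Lemma num_inj V h i j : numbering V h -> i < 8 -> j < 8 -> h i = h j -> i = j.
Proof.
move=> [u _ _] hi hj e; apply/eqP; rewrite -(nth_uniq (h 0) _ _ u) ?size_map ?size_iota //.
by rewrite !(nth_map 0) ?size_iota // !nth_iota // e.
Qed.

Lemma num_mem V h x : numbering V h -> x \in V -> exists2 i, i < 8 & x = h i.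
Proof.
move=> [_ p _]; rewrite (perm_mem p) => /mapP[i]; rewrite mem_iota => /andP[_ hi] ->.
by exists i.
Qed.

Lemma num_in V h i : numbering V h -> i < 8 -> h i \in V.
Proof. by move=> [_ p _] hi; rewrite (perm_mem p) map_f // mem_iota. Qed.

(** The network is vertex-transitive: a numbering is composed with the automorphism of [auts] that
    moves 0 to the place of x. *)
Lemma num_at V x : sub 3 V -> x \in V -> exists2 h, numbering V h & h 0 = x.
Proof.
move=> sV xV; have [h hn] : exists h, numbering V h.
  move: {-2}3 (erefl 3) sV => n n3 sV; case: sV n3 => [h u he _|n' V' *]; last by arith.
  by exists h.
have [i hi ex] := num_mem hn xV; subst x.
have i8 : i \in iota 0 8 by rewrite mem_iota.
have := allP chkA_holds i i8; cbv beta zeta => /and3P[/eqP a0 pa /allP aA].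
have ai j : j < 8 -> nth 0 (nth [::] auts i) j < 8.
  move=> hj; have := perm_mem pa (nth 0 (nth [::] auts i) j).
  by rewrite mem_nth ?(perm_size pa) ?size_iota // mem_iota add0n => /esym.
exists (fun j => h (nth 0 (nth [::] auts i) j)); last by rewrite a0.
have ph : perm_eq (map h (iota 0 8)) [seq h (nth 0 (nth [::] auts i) j) | j <- iota 0 8].
  have ea : map (nth 0 (nth [::] auts i)) (iota 0 8) = nth [::] auts i.
    by rewrite -[RHS](mkseq_nth 0) /mkseq (perm_size pa) size_iota.
  by rewrite (map_comp h (nth 0 _)) ea perm_sym; apply: perm_map.
case: hn => u p he; split; first by rewrite -(perm_uniq ph).
  exact: perm_trans p ph.
move=> j k hj hk; rewrite he ?ai //.
by apply/eqP; apply: (allP (aA j _)); rewrite mem_iota.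
Qed.

(** For adjacency one implication is enough, as paths are only carried from the model to the
    network; the healthy vertices have to agree exactly, because spanning is carried over too. *)
Definition fits F V h f := (forall i j, i < 8 -> j < 8 -> adjn f i j -> adj F (h i) (h j)) /\
  perm_eq (gd F V) (map h (gdn f)).

Lemma adjnE f i j : adjn f i j =
  ltqn i j && ~~ [|| (i, i) == f, (j, j) == f, (i, j) == f | (j, i) == f].
Proof. by rewrite /adjn; case: ltqn => //; case: ifP. Qed.

Lemma fits_gd F V h f : numbering V h ->
  (forall i, i < 8 -> good F (h i) = ((i, i) != f)) -> perm_eq (gd F V) (map h (gdn f)).
Proof.
move=> [_ p _] hg; apply: perm_trans (perm_filter _ p) _.
rewrite filter_map (eq_in_filter (a2 := fun i => (i, i) != f)) // => i.
by rewrite mem_iota => /andP[_ /hg].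
Qed.

Lemma fits_none F V h : numbering V h -> nf V F = 0 -> fits F V h (8, 8).
Proof.
move=> hn f0.
have nF x y : x \in V -> y \in V -> (x, y) \notin F.
  move=> hx hy; apply/negP => h1; suff : 0 < nf V F by rewrite f0.
  by rewrite -has_count; apply/hasP; exists (x, y); rewrite ?h1 // /inside /= hx hy.
have inV := num_in hn; case: (hn) => _ _ he.
split => [i j hi hj|]; last first.
  apply: fits_gd hn _ => i hi; rewrite /good nF ?inV // xpair_eqE.
  by move: hi; rewrite ltn_neqAle andbC; case: eqP => // ->.
by rewrite adjnE => /andP[h1 _]; rewrite /adj he // h1 /good !nF ?inV.
Qed.

Lemma fits_one F V : sub 3 V -> nf V F = 1 -> exists h f,
  [/\ numbering V h, f \in faults0 & fits F V h f].
Proof.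
move=> sV f1.
have /hasP[[x y] xyF /andP[/= xV yV]] : has (inside V) F by rewrite has_count -/(nf V F) f1.
have only g : g \in F -> inside V g -> g = (x, y).
  move=> gF gV; apply/eqP; apply: contraT => ne.
  have : size [:: g; (x, y)] <= size (filter (inside V) F).
    apply: uniq_leq_size; first by rewrite /= inE ne.
    by move=> z; rewrite !inE mem_filter => /orP[] /eqP->; rewrite ?gV ?gF // xyF /inside /= xV yV.
  by rewrite size_filter -/(nf V F) f1.
have [h hn h0] := num_at sV xV; have [j j8 ey] := num_mem hn yV.
have inV := num_in hn; have inj i i' := @num_inj V h i i' hn; case: (hn) => _ _ he.
(* A pair that is neither a vertex nor an edge does no harm, so it is represented by the empty fault
   (8, 8). *)
pose f := if (0 == j) || ltqn 0 j then (0, j) else (8, 8).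
exists h, f; split => //.
  have : all (fun j => (if (0 == j) || ltqn 0 j then (0, j) else (8, 8)) \in faults0) (iota 0 8) by [].
  by move/allP; apply; rewrite mem_iota.
have inF i i' : i < 8 -> i' < 8 -> (h i, h i') \in F -> i = 0 /\ i' = j.
  move=> hi hi' /only; rewrite /inside /= !inV // => /(_ isT) [].
  by rewrite -h0 ey => /inj-> // /inj->.
have n8 i : i < 8 -> ((i, i) == (8, 8)) = false.
  by move=> hi; rewrite xpair_eqE andbb; apply/negbTE; rewrite neq_ltn hi.
split; last first.
  apply: fits_gd hn _ => i hi; rewrite /good; congr negb; apply/idP/idP.
    by move/(inF _ _ hi hi) => [e1 e2]; rewrite /f -e2 e1.
  rewrite /f; case: ifP => _; last by rewrite n8.
  by rewrite xpair_eqE => /andP[/eqP e1 /eqP e2]; rewrite e2 -{1}e2 e1 -ey h0.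
move=> i i' hi hi'; rewrite adjnE !negb_or => /andP[li /and4P[g1 g2 g3 g4]].
have gd0 l : l < 8 -> (l, l) != f -> good F (h l).
  move=> hl; rewrite /good; apply: contraNN => /(inF _ _ hl hl) [e1 e2].
  by rewrite /f -e2 e1.
have ed a b : a < 8 -> b < 8 -> ltqn a b -> (a, b) != f -> (h a, h b) \notin F.
  move=> ha hb lab nf; apply: contraNN nf => /(inF _ _ ha hb) [e1 e2].
  by rewrite /f -e2 -e1 lab orbT.
have ls : ltqn i' i by rewrite /ltqn orbC.
by rewrite /adj he // li !gd0 ?ed.
Qed.

Section Fits.
Variables (V : seq T) (h : nat -> T) (F : seq (T * T)) (f : nat * nat).
Hypotheses (hn : numbering V h) (hf : fits F V h f).

Lemma walk_num (i : nat) (p : seq nat) (j : nat) : i < 8 -> walk (adjn f) i p j ->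
  walk (adj F) (h i) (map h p) (h j).
Proof.
case: p => // a p hi /and3P[/eqP-> hp /eqP<-] /=; rewrite eqxx /=.
elim: p i hi hp => [|b p IH] i hi /=; first by rewrite eqxx.
move=> /andP[ib hp]; have /andP[_ b8] : (i < 8) && (b < 8).
  by move: ib; rewrite adjnE => /andP[/ltqn_lt].
by rewrite (hf.1 _ _ hi b8 ib) IH.
Qed.

Lemma gdn_lt i : i \in gdn f -> i < 8.
Proof. by rewrite mem_filter mem_iota => /and3P[]. Qed.

Lemma hpaths_sound (p : seq nat) : p \in hpaths f -> exists x y : nat,
  [/\ x < 8, walk (adjn f) x p y, head 8 p = x, last 8 p = y & perm_eq p (gdn f)].
Proof.
case/flattenP=> l /mapP[x xg ->] /mapP[pr]; rewrite mem_filter => /andP[/nilP n0 /ext_sound[h1 h2]] ->.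
rewrite n0 cats0 in h2; exists x, (last x pr.1); split => //.
- exact: gdn_lt.
- by case: (pr.1) h1 => //= a l' /and3P[/eqP].
- by case: (pr.1) h1.
- by apply: perm_trans h2 _; rewrite perm_sym perm_to_rem.
Qed.

Lemma hends_path (x y : nat) : (x, y) \in hends f ->
  exists2 p, walk (adj F) (h x) p (h y) & perm_eq p (gd F V).
Proof.
case/mapP=> p /hpaths_sound[x' [y' [x8 hw hx hy pp]]] [-> ->].
rewrite hx hy; exists (map h p); first exact: walk_num.
by rewrite perm_sym; apply: perm_trans hf.2 _; rewrite perm_sym; apply: perm_map.
Qed.

Lemma covers_path (s t x y : nat) : (x, y) \in covers f s t -> exists p q,
  [/\ walk (adj F) (h s) p (h x), walk (adj F) (h t) q (h y), perm_eq (p ++ q) (gd F V) &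
     [/\ s < 8, t < 8, x < 8 & y < 8]].
Proof.
rewrite /covers; case: ifP => // /negbFE sg.
case/flattenP=> l /mapP[pr]; rewrite mem_filter => /andP[tp /ext_sound[h1 h2]] ->.
case/mapP=> qr; rewrite mem_filter => /andP[/nilP n0 /ext_sound[h3 h4]] [-> ->].
rewrite n0 cats0 in h4.
have pg : perm_eq (pr.1 ++ qr.1) (gdn f).
  have g1 := perm_to_rem sg; have g2 := perm_to_rem tp.
  by perm_count.
have lt8 i : i \in pr.1 ++ qr.1 -> i < 8 by rewrite (perm_mem pg); apply: gdn_lt.
have s8 : s < 8 by apply: lt8; rewrite mem_cat (walk_mem1 h1).
have t8 : t < 8 by apply: lt8; rewrite mem_cat (walk_mem1 h3) orbT.
exists (map h pr.1), (map h qr.1); split => //.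
- exact: walk_num s8 h1.
- exact: walk_num t8 h3.
- rewrite perm_sym; apply: perm_trans hf.2 _; rewrite -map_cat perm_sym; exact: perm_map.
split => //; apply: lt8; rewrite mem_cat; first by rewrite (walk_mem2 h1).
by rewrite (walk_mem2 h3) orbT.
Qed.

End Fits.
End Base.

(** * The properties in dimensions 3 and 4 *)

Section Base4.
Variable G : sgraph.
Local Notation T := (vertex G).
Implicit Types (F : seq (T * T)) (V X Y D p q z : seq T) (x y s t u v w : T) (mu : T -> T).
Implicit Types (h k : nat -> T) (f : nat * nat) (phi : nat -> nat).

Lemma hc3 : HC G 3.
Proof.
move=> V F s t sV hF; rewrite !mem_gd => /andP[gs sV'] /andP[gt tV] st.
have [h hn h0] := num_at sV sV'.
have hf : fits F V h (8, 8) by apply: fits_none hn _; arith.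
have [j j8 tj] := num_mem hn tV; subst s t.
have j0 : j != 0 by apply: contraNneq st => ->.
have := allP chkHC3_holds j; rewrite mem_iota j8 (negPf j0) => /(_ isT).
exact: hends_path hf _ _.
Qed.

Lemma fits_le1 V F : sub 3 V -> nf V F <= 1 -> exists h f,
  [/\ numbering V h, f \in faults0 & fits F V h f].
Proof.
move=> sV; case e : (nf V F) => [|[|]] // _; last exact: fits_one.
have [x xV] : exists x, x \in V.
  by have := sub_size sV; case: (V) => // x s _; exists x; rewrite mem_head.
by have [h hn _] := num_at sV xV; exists h, (8, 8); split => //; apply: fits_none.
Qed.

Lemma hh3 : HH G 3.
Proof.
move=> V F sV hF; have [h [f [hn ff hf]]] := fits_le1 sV hF.
have /hasP[p /hpaths_sound[x [y [x8 hw _ _ pp]]] hc] := allP chkHH3_holds f ff.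
have [x' [y' [hw' hyx]]] := cycle_walk hc (walk_nil hw).
have x'8 : x' < 8 by apply: (@gdn_lt f); rewrite -(perm_mem pp) (walk_mem1 hw').
have y'8 : y' < 8 by apply: (@gdn_lt f); rewrite -(perm_mem pp) (walk_mem2 hw').
exists (map h p).
  by apply: walk_cycle (walk_num hf x'8 hw') _; apply: hf.1.
by rewrite perm_sym; apply: perm_trans hf.2 _; rewrite perm_sym; apply: perm_map.
Qed.

(** If the faults inside the halves exhaust the count, no cross edge is faulty itself, so it
    survives whenever both its ends are healthy. *)
Lemma link_cross n V V1 V2 mu F x : @bisection G n V V1 V2 mu ->
  nf V F <= nf V1 F + nf V2 F -> x \in gd F V1 -> mu x \in gd F V2 -> link F mu x.
Proof.
move=> sp hF; rewrite !mem_gd => /andP[gx xV] /andP[gm mV].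
have cross a b : (a \in V1) && (b \in V2) || (a \in V2) && (b \in V1) -> (a, b) \notin F.
  move=> ab; apply/negP => abF.
  have dj y : y \in V1 -> (y \in V2) = false.
    by move=> h1; apply/negP => h2; apply: (split_disj sp h1 h2).
  suff : nf V1 F + nf V2 F + 1 <= nf V F by lia.
  have h1 : 1 <= count (pred1 (a, b)) F by rewrite -has_count has_pred1.
  apply: leq_trans (leq_add (leqnn _) h1) _.
  rewrite /nf -count_predUI (@eq_count _ (predI _ _) pred0) ?count_pred0 ?addn0; last first.
    move=> g /=; apply/negP => /andP[/andP[k1 _] /andP[k2 _]].
    by rewrite dj in k2.
  rewrite -count_predUI (@eq_count _ (predI _ _) pred0) ?count_pred0 ?addn0; last first.
    move=> g /=; apply/negP => /andP[k /eqP eg]; subst g; move: k ab; rewrite /inside /=.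
    move: (dj a) (dj b); case: (a \in V1); case: (b \in V1); case: (a \in V2); case: (b \in V2) => //= h2 h3;
    by [have := h2 isT|have := h3 isT].
  apply: sub_count => g /= /orP[/orP[]|/eqP ->]; rewrite /inside !(split_mem sp) /=.
  - by move=> /andP[-> ->].
  - by move=> /andP[-> ->]; rewrite !orbT.
  by case/orP: ab => /andP[-> ->]; rewrite ?orbT.
by rewrite /link /adj (split_e_mu sp) // gx gm !cross ?xV ?mV ?orbT.
Qed.

Lemma mate_num V V1 V2 mu h k : @bisection G 3 V V1 V2 mu ->
  numbering V1 h -> numbering V2 k -> exists phi,
  [/\ forall i, i < 8 -> phi i < 8, {in gtn 8 &, injective phi} &
      forall i, i < 8 -> mu (h i) = k (phi i)].
Proof.
move=> sp hn kn; pose phi i := index (mu (h i)) (map k (iota 0 8)).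
have pm i : i < 8 -> mu (h i) \in map k (iota 0 8).
  by move=> i8; case: (kn) => _ p _; rewrite -(perm_mem p) (split_mu1 sp) // (num_in hn).
have p8 i : i < 8 -> phi i < 8.
  by move=> i8; rewrite -[8](size_iota 0) -(size_map k) index_mem pm.
have pE i : i < 8 -> mu (h i) = k (phi i).
  move=> i8; rewrite -[LHS](nth_index (h 0) (pm _ i8)) (nth_map 0) ?size_iota ?p8 //.
  by rewrite nth_iota // p8.
exists phi; split => // i j; rewrite !unfold_in /= => i8 j8 e.
have : mu (h i) == mu (h j) by rewrite !pE // e.
by rewrite (split_mu_inj sp) ?(num_in hn) // => /eqP /(num_inj hn i8 j8).
Qed.

Lemma search_hits A B phi : (forall i, i < 8 -> phi i < 8) ->
  {in gtn 8 &, injective phi} -> search (hits A B) 8 [::] ->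
  exists x y : nat, [/\ x < 8, y < 8, x != y, mget A x y & mget B (phi x) (phi y)].
Proof.
by move=> p8 pI /(@search_sound _ _ p8 pI 8 0 erefl)[m m8 h]; apply: hits_sound m8 h.
Qed.

Lemma hc22_3 : HC22 G 3.
Proof.
move=> V V1 V2 mu F s t sp hF h1 hs ht st.
have h12 := nf_split sp F.
have al x : x \in gd F V1 -> link F mu x by move=> hx; apply: (all_link sp) => //; arith.
have [|h [f [hn ff hf]]] := @fits_one _ F V1 (split_sub1 sp); first arith.
have sV2 := gd2V hs; have tV2 := gd2V ht.
have [k kn k0] := num_at (split_sub2 sp) sV2.
have kf : fits F V2 k (8, 8) by apply: fits_none kn _; arith.
have [j j8 tj] := num_mem kn tV2; subst s t.
have j0 : j != 0 by apply: contraNneq st => ->.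
have [phi [p8 pI pE]] := mate_num sp hn kn.
have := chk22_holds; rewrite /chk22 allbE => /allP /(_ _ ff); rewrite allbE => /allP /(_ j).
rewrite mem_iota j8 (negPf j0) => /(_ isT).
rewrite (nth_map 0) ?size_iota // nth_iota // add0n.
case/(search_hits p8 pI) => x [y [x8 y8 xy]] /(mget_mat x8 y8) hxy.
move=> /(mget_mat (p8 _ x8) (p8 _ y8)) hc.
have [p hp pp] := hends_path hf hxy.
have [q1 [q2 [hq1 hq2 pq _]]] := covers_path kf hc.
have gx : h x \in gd F V1 by rewrite -(perm_mem pp) (walk_mem1 hp).
have gy : h y \in gd F V1 by rewrite -(perm_mem pp) (walk_mem2 hp).
exists (q1 ++ p ++ rev q2); last by have := split_gd sp F => hsp; perm_count.
rewrite -!pE // in hq1 hq2.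
apply: walk_cat hq1 (_ : adj F _ (h x)) _; first by rewrite adj_sym; apply: al.
by apply: walk_cat hp (al _ gy) _; apply: walk_rev (@adj_sym _ _) _.
Qed.

Lemma hc4 : HC G 4.
Proof. by apply: hc_step => //; [exact: hc3|exact: hh3|exact: hc22_3]. Qed.

Lemma quads_path V h F f (a b c d : nat) : fits F V h f ->
  (a, b, (c, d)) \in quads f -> exists p q,
  [/\ walk (adj F) (h a) p (h b), walk (adj F) (h c) q (h d), perm_eq (p ++ q) (gd F V) &
     [/\ a < 8, b < 8, c < 8 & d < 8]].
Proof.
move=> hf /flattenP[l /mapP[s sg ->]] /flattenP[l' /mapP[t tg ->]] /mapP[[x y]].
rewrite mem_filter mem_undup => /andP[_ h1] [-> -> -> ->] /=.
have [p [q [hp hq pq [s8 t8 x8 y8]]]] := covers_path hf h1.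
by exists p, q.
Qed.

Lemma cget_covs f (a b c d : nat) : a < 8 -> b < 8 -> c < 8 -> d < 8 ->
  mget (cget (covs f) a b) c d -> (c, d) \in covers f a b.
Proof.
move=> a8 b8 c8 d8; rewrite /cget /covs (nth_map 0) ?size_iota // nth_iota // add0n.
rewrite (nth_map 0) ?size_iota // nth_iota // add0n; exact: mget_mat.
Qed.

Lemma hh4 : HH G 4.
Proof.
move=> V F sV hF; have [V1 [V2 [mu sp]]] := sub_split (isT : 3 <= 3) sV.
have spS := split_sym sp; have h12 := nf_split sp F.
have hc := hc3; have hh := hh3.
have [f2|f2] := leqP (nf V2 F) 0; first by apply: (hh_half sp) => //; arith.
have [f1|f1] := leqP (nf V1 F) 0; first by apply: (hh_half spS) => //; arith.
(* Now each half holds exactly one fault, and none is left for the cross edges. *)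
have al x : x \in gd F V1 -> mu x \in gd F V2 -> link F mu x.
  by apply: (link_cross sp); arith.
have [|h [f [hn ff hf]]] := @fits_one _ F V1 (split_sub1 sp); first arith.
have [|k [g [kn gg kf]]] := @fits_one _ F V2 (split_sub2 sp); first arith.
have [phi [p8 pI pE]] := mate_num sp hn kn.
have hsp := split_gd sp F.
have simple : (exists x y : nat, [/\ x < 8, y < 8, x != y, mget (mat (hends f)) x y &
      mget (mat (hends g)) (phi x) (phi y)]) ->
    exists2 p, cycle (adj F) p & perm_eq p (gd F V).
  case=> x [y [x8 y8 xy]] /(mget_mat x8 y8) /(hends_path hf)[p hp pp].
  move=> /(mget_mat (p8 _ x8) (p8 _ y8)) /(hends_path kf)[q hq pq].
  rewrite -!pE // in hq.
  have lx : link F mu (h x).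
    by apply: al; rewrite -?(perm_mem pp) -?(perm_mem pq) ?(walk_mem1 hp) ?(walk_mem1 hq).
  have ly : link F mu (h y).
    by apply: al; rewrite -?(perm_mem pp) -?(perm_mem pq) ?(walk_mem2 hp) ?(walk_mem2 hq).
  exists (p ++ rev q); last by perm_count.
  apply: walk_cycle (_ : walk _ (h x) _ (mu (h x))) _; last by rewrite adj_sym.
  by apply: walk_cat hp ly _; apply: walk_rev (@adj_sym _ _) _.
have := chkHH_holds; rewrite /chkHH allbE => /allP /(_ _ (map_f _ ff)).
rewrite allbE => /allP /(_ _ (map_f _ gg)); cbv beta iota zeta delta [fst snd].
case: ifP => [/andP[/eqP ef /eqP eg]|_]; last by move/(search_hits p8 pI).
subst f g => /(@search_sound _ _ p8 pI 8 0 erefl)[m m8]; rewrite /hh_ok.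
case: ifP => [hit _|_]; first by apply: simple; apply: hits_sound hit.
rewrite /cross4 size_map size_iota; case: eqP => // em; subst m.
rewrite hasbE => /hasP[[[a b] [c d]] hq hcv].
have gE i : i < 8 -> nth 8 (map phi (iota 0 8)) i = phi i.
  by move=> i8; rewrite (nth_map 0) ?size_iota // nth_iota.
have [p [q [hp hq' pq [a8 b8 c8 d8]]]] := quads_path hf hq.
move: hcv; cbv beta iota zeta; rewrite !gE // => /(cget_covs (p8 _ b8) (p8 _ d8) (p8 _ c8) (p8 _ a8)) hcv.
have [q1 [q2 [hq1 hq2 pq12 _]]] := covers_path kf hcv.
rewrite -!pE // in hq1 hq2.
have l1 i : h i \in p ++ q -> mu (h i) \in q1 ++ q2 -> link F mu (h i).
  by move=> i1 i2; apply: al; rewrite -?(perm_mem pq) -?(perm_mem pq12).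
have la : link F mu (h a) by apply: l1; rewrite mem_cat ?(walk_mem1 hp) ?(walk_mem2 hq2) ?orbT.
have lb : link F mu (h b) by apply: l1; rewrite mem_cat ?(walk_mem2 hp) ?(walk_mem1 hq1) ?orbT.
have lc : link F mu (h c) by apply: l1; rewrite mem_cat ?(walk_mem1 hq') ?(walk_mem2 hq1) ?orbT.
have ld : link F mu (h d) by apply: l1; rewrite mem_cat ?(walk_mem2 hq') ?(walk_mem1 hq2) ?orbT.
exists (p ++ q1 ++ q ++ q2); last by perm_count.
apply: walk_cycle (_ : walk _ (h a) _ (mu (h a))) _; last by rewrite adj_sym.
apply: walk_cat hp lb _; apply: walk_cat hq1 (_ : adj F _ (h c)) _; first by rewrite adj_sym.
exact: walk_cat hq' ld hq2.
Qed.

Lemma three_path V h F (a b c d : nat) : fits F V h (8, 8) -> a < 8 ->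
  three a b c d -> exists p q l (x y : nat),
  [/\ walk (adj F) (h a) p (h b), walk (adj F) (h c) q (h x), walk (adj F) (h d) l (h y) &
      perm_eq (p ++ q ++ l) (gd F V)].
Proof.
move=> hf a8; have ag : a \in gdn (8, 8).
  by rewrite mem_filter mem_iota a8 andbT xpair_eqE andbb neq_ltn a8.
rewrite /three hasbE => /hasP[pr /ext_sound[h1 h2]].
case: ifP => // /andP[/andP[/eqP eb cp] dp]; rewrite hasbE => /hasP[qr /ext_sound[h3 h4]].
case: ifP => // dq; rewrite hasbE => /hasP[lr /ext_sound[h5 h6] /nilP n0].
rewrite n0 cats0 in h6.
have pg : perm_eq (pr.1 ++ qr.1 ++ lr.1) (gdn (8, 8)).
  have g1 : perm_eq (gdn (8, 8)) (a :: rem a (iota 0 8)) by exact: perm_to_rem ag.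
  have g2 := perm_to_rem cp; have g3 := perm_to_rem dq.
  by perm_count.
have lt8 i : i \in pr.1 ++ qr.1 ++ lr.1 -> i < 8 by rewrite (perm_mem pg); apply: gdn_lt.
exists (map h pr.1), (map h qr.1), (map h lr.1), (last c qr.1), (last d lr.1); split.
- by rewrite eb in h1; exact: (walk_num hf a8 h1).
- by apply: (walk_num hf _ h3); apply: lt8; rewrite !mem_cat (walk_mem1 h3) orbT.
- by apply: (walk_num hf _ h5); apply: lt8; rewrite !mem_cat (walk_mem1 h5) !orbT.
by rewrite perm_sym; apply: perm_trans hf.2 _; rewrite -!map_cat perm_sym; exact: perm_map.
Qed.

(** There are no faults, so every cross edge is available; two positions of the ends are searched
    directly, the others reduce to tables or to [hc3] in each half. *)
Lemma d2_4 : D2 G 4.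
Proof.
move=> V F a b c d sV hF; have [V1 [V2 [mu sp]]] := sub_split (isT : 3 <= 3) sV.
apply: (linked2_cases sp) => {V1 V2 sp} V1 V2 sp {a b c d}.
have h12 := nf_split sp F; have hsp := split_gd sp F.
have f1 : nf V1 F = 0 by arith. have f2 : nf V2 F = 0 by arith.
have al x : x \in gd F V1 -> link F mu x by move=> hx; apply: (all_link sp) => //; arith.
have hc := hc3.
have hn2 : nf V2 F <= 3 - 3 by rewrite f2.
have hn1 : nf V1 F <= 3 - 3 by rewrite f1.
split=> a b c d.
- move=> ud sd.
  have [ha hb hcc hd] : [/\ a \in gd F V1, b \in gd F V1, c \in gd F V1 & d \in gd F V1].
    by split; apply: sd; rewrite !inE eqxx ?orbT.
  have [h hn h0] := num_at (split_sub1 sp) (gd1V ha); have hf := fits_none hn f1.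
  have [i i8 bi] := num_mem hn (gd1V hb); have [j j8 cj] := num_mem hn (gd1V hcc).
  have [l l8 dl] := num_mem hn (gd1V hd); subst a b c d.
  have ui : uniq [:: 0; i; j; l] by apply: (@map_uniq _ _ h).
  have := chk1111_holds; rewrite /chk1111 allbE => /allP /(_ i); rewrite mem_iota i8 => /(_ isT).
  rewrite allbE => /allP /(_ j); rewrite mem_iota j8 => /(_ isT).
  rewrite allbE => /allP /(_ l); rewrite mem_iota l8 ui => /(_ isT).
  case: ifP => [h1 _|_ h1].
    have [p [q [r [x [y [w1 w2 w3 pw]]]]]] := three_path hf (isT : 0 < 8) h1.
    have lx : link F mu (h x) by apply: al; rewrite -(perm_mem pw) !mem_cat (walk_mem2 w2) orbT.
    have ly : link F mu (h y) by apply: al; rewrite -(perm_mem pw) !mem_cat (walk_mem2 w3) !orbT.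
    have [|p' w4 w5] := join0 (z := p) sp hc hn2 w2 (walk_rev (@adj_sym _ _) w3) lx ly.
      by perm_count.
    by exists p, p'.
  apply: linked2_swap.
  have [p [q [r [x [y [w1 w2 w3 pw]]]]]] := three_path hf j8 h1.
  have lx : link F mu (h x) by apply: al; rewrite -(perm_mem pw) !mem_cat (walk_mem2 w2) orbT.
  have ly : link F mu (h y) by apply: al; rewrite -(perm_mem pw) !mem_cat (walk_mem2 w3) !orbT.
  have [|p' w4 w5] := join0 (z := p) sp hc hn2 w2 (walk_rev (@adj_sym _ _) w3) lx ly.
    by perm_count.
  by exists p, p'.
- move=> ud sd hd.
  have [ha hb hcc] : [/\ a \in gd F V1, b \in gd F V1 & c \in gd F V1].
    by split; apply: sd; rewrite !inE eqxx ?orbT.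
  have [h hn h0] := num_at (split_sub1 sp) (gd1V ha); have hf := fits_none hn f1.
  have [i i8 bi] := num_mem hn (gd1V hb); have [j j8 cj] := num_mem hn (gd1V hcc).
  subst a b c.
  have : uniq [:: 0; i; j] by apply: (@map_uniq _ _ h).
  rewrite /= !inE negb_or andbT => /andP[/andP[i0 j0] ij].
  have := chk1112_holds; rewrite /chk1112 allbE => /allP /(_ j); rewrite mem_iota j8 => /(_ isT).
  rewrite eq_sym (negPf j0); cbv zeta; rewrite allbE => /allP /(_ i); rewrite mem_iota i8 => /(_ isT).
  rewrite eq_sym (negPf i0) (negPf ij) /=.
  set L := [seq xy <- _ | _]; have uL : uniq L by apply: filter_uniq; apply: undup_uniq.
  have mL xy : xy \in L -> xy.1 = i /\ xy \in covers (8, 8) 0 j.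
    by rewrite mem_filter mem_undup => /andP[/eqP].
  case: L uL mL => [|[x1 w1] [|[x2 w2] L]] //= /andP[+ _] mL _.
  have [e1 m1] := mL _ (mem_head _ _); have [|e2 m2] := mL (x2, w2); first by rewrite !inE eqxx orbT.
  rewrite /= in e1 e2; subst x1 x2; rewrite inE negb_or xpair_eqE eqxx /= => /andP[w12 _].
  have go (w : nat) : (i, w) \in covers (8, 8) 0 j -> mu (h w) != d -> linked2 F V (h 0) (h i) (h j) d.
    move=> /(covers_path hf)[p [q [k1 k2 k3 _]]] wd.
    have lw : link F mu (h w) by apply: al; rewrite -(perm_mem k3) mem_cat (walk_mem2 k2) orbT.
    have [p' k4 k5] := exit0 (z := p) sp hc hn2 lw hd wd k2 k3.
    by exists p, p'.
  (* At most one of the two possible free ends is matched with d. *)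
  have [ed|nd] := eqVneq (mu (h w1)) d; last exact: (go w1).
  apply: (go w2) => //; rewrite -ed.
  have [_ [_ [_ _ _ [_ _ _ w18]]]] := covers_path hf m1.
  have [_ [_ [_ _ _ [_ _ _ w28]]]] := covers_path hf m2.
  rewrite (split_mu_inj sp) ?(num_in hn) //; apply: contra_neq w12 => /(num_inj hn w28 w18) //.
- move=> ha hb hcc hd ab cd.
  have [p h1 h2] := hc _ _ _ _ (split_sub1 sp) hn1 ha hb ab.
  have [q h3 h4] := hc _ _ _ _ (split_sub2 sp) hn2 hcc hd cd.
  by exists p, q; split => //; perm_count.
move=> ha hcc hb hd ac bd.
have [h hn h0] := num_at (split_sub1 sp) (gd1V ha).
have [k kn k0] := num_at (split_sub2 sp) (gd2V hb).
have hf := fits_none hn f1; have kf := fits_none kn f2.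
have [i i8 ci] := num_mem hn (gd1V hcc); have [j j8 dj] := num_mem kn (gd2V hd).
subst a b c d.
have i0 : i != 0 by apply: contraNneq ac => ->.
have j0 : j != 0 by apply: contraNneq bd => ->.
have [phi [p8 pI pE]] := mate_num sp hn kn.
have := chk1212_holds; rewrite /chk1212 allbE => /allP /(_ i).
rewrite mem_iota i8 (negPf i0) => /(_ isT); cbv zeta; rewrite allbE => /allP /(_ j).
rewrite mem_iota j8 (negPf j0) => /(_ isT).
rewrite !(nth_map 0) ?size_iota // !nth_iota // !add0n.
case/(search_hits p8 pI) => x [y [x8 y8 xy]] /(mget_mat x8 y8) hxy.
move=> /(mget_mat (p8 _ x8) (p8 _ y8)) hxy'.
have [p1 [p2 [w1 w2 w12 _]]] := covers_path hf hxy.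
have [q1 [q2 [w3 w4 w34 _]]] := covers_path kf hxy'.
rewrite -!pE // in w3 w4.
have lx : link F mu (h x) by apply: al; rewrite -(perm_mem w12) mem_cat (walk_mem2 w1).
have ly : link F mu (h y) by apply: al; rewrite -(perm_mem w12) mem_cat (walk_mem2 w2) orbT.
exists (p1 ++ rev q1), (p2 ++ rev q2); split; last by perm_count.
  by apply: walk_cat w1 lx _; apply: walk_rev (@adj_sym _ _) _.
by apply: walk_cat w2 ly _; apply: walk_rev (@adj_sym _ _) _.
Qed.

End Base4.

Lemma hc_hh_d2 (G : sgraph) n : 4 <= n -> [/\ HC G n, HH G n & D2 G n].
Proof.
elim: n => // n IH; rewrite leq_eqVlt => /orP[/eqP n4|n4].
  by rewrite -n4; split; [exact: hc4|exact: hh4|exact: d2_4].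
have [hc hh d2] := IH n4; split; last exact: d2_step.
  by apply: hc_step; rewrite 1?ltnW //; apply: hc22_step.
exact: hh_step.
Qed.

Lemma hc_all (G : sgraph) n : 4 <= n -> HC G n. Proof. by case/(@hc_hh_d2 G). Qed.
Lemma d2_all (G : sgraph) n : 4 <= n -> D2 G n. Proof. by case/(@hc_hh_d2 G). Qed.

(** * Putting back two faults: cutting a path into segments *)

Lemma sorted_walk (T : eqType) (r : rel T) x l : l != [::] -> sorted r l ->
  walk r (head x l) l (last x l).
Proof. by case: l => //= y l _ h; rewrite !eqxx h. Qed.

Lemma walk_sorted (T : eqType) (r : rel T) s l t : walk r s l t ->
  [/\ sorted r l, forall x, head x l = s & forall x, last x l = t].
Proof. by case: l => //= y l /and3P[/eqP-> h /eqP]. Qed.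

Section Segments.
Variable G : sgraph.
Local Notation T := (vertex G).
Implicit Types (F : seq (T * T)) (V X Y D p q z l : seq T) (x y s t u v w : T) (mu : T -> T).

Definition hit F u w l := if good F w then (u \in l) && (w \in l) else w \in l.

Lemma rmf_sorted u w F l : sorted (adj (rmf u w F)) l -> ~~ hit F u w l ->
  all (good (rmf u w F)) l -> sorted (adj F) l.
Proof.
move=> hl nh gl; apply: (sub_in_sorted (P := mem l)) hl; last exact/allP.
move=> x y xl yl h; move: nh; rewrite /hit => nh.
have [gx gy] : good F x /\ good F y.
  have := allP gl x xl; have := allP gl y yl; rewrite !good_rmf.
  have [gw|bw] := boolP (good F w).
    by case: (eqVneq x w) => [->|_]; case: (eqVneq y w) => [->|_]; rewrite ?gw ?orbF.
  move: nh; rewrite (negPf bw) => wl.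
  have /negPf-> : x != w by apply: contraNneq wl => <-.
  have /negPf-> : y != w by apply: contraNneq wl => <-.
  by rewrite !orbF.
have [//|[gw [ex ey]]|[gw [ex ey]]] := adj_rmf h gx gy; move: nh; rewrite gw -ex -ey.
  by rewrite (xl : x \in l) (yl : y \in l).
by rewrite (xl : x \in l) (yl : y \in l).
Qed.

Lemma rmf_good_id u w F l : all (good (rmf u w F)) l -> ~~ hit F u w l ->
  filter (good F) l = l.
Proof.
move=> gl nh; apply/all_filterP/allP => x xl; have := allP gl x xl; rewrite good_rmf.
case: eqP => [xw|_]; rewrite ?orbF // orbT => _; subst w.
by apply: contraNT nh => gx; rewrite /hit (negPf gx).
Qed.

Lemma cut_sorted u w F l : sorted (adj (rmf u w F)) l -> uniq l ->
  all (good (rmf u w F)) l -> exists l1 l2,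
  [/\ sorted (adj F) l1, sorted (adj F) l2 & l1 ++ l2 = filter (good F) l].
Proof.
move=> hl ul gl; have [h|h] := boolP (hit F u w l); last first.
  by exists l, [::]; rewrite cats0 (rmf_good_id gl h) (rmf_sorted hl h gl).
have [gw|bw] := boolP (good F w).
  have fl : filter (good F) l = l.
    apply/all_filterP/allP => x xl; have := allP gl x xl; rewrite good_rmf.
    by case: eqP => [->|_]; rewrite ?orbF // gw.
  have ln : l != [::] by move: h; rewrite /hit gw; case: (l).
  have [k|[p1 [a [b [p2 [ep h1 h2 h3]]]]]] := rmf_walk_good (sorted_walk w ln hl) gw.
    by exists l, [::]; rewrite cats0 fl; have [-> _ _] := walk_sorted k.
  have ap1 := walk_mem2 h1.
  have /hasPn hd : ~~ has (mem p1) p2 by move: ul; rewrite ep cat_uniq => /and3P[].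
  have ap2 : a \notin p2 by apply/negP => /hd /=; rewrite ap1.
  have h4 : walk (adj F) b p2 (last w l).
    by apply: (rmf_walk_tail h3 gw (a := a)) => //; case: h2 => -[]; auto.
  by exists p1, p2; rewrite fl ep; have [-> _ _] := walk_sorted h1; have [-> _ _] := walk_sorted h4.
have wl : w \in l by move: h; rewrite /hit (negPf bw).
case/splitPr: wl hl ul gl h => A B hl ul gl _.
have [uA wAB uB] : [/\ w \notin A, w \notin B & True].
  move: ul; rewrite cat_uniq /= negb_or => /and4P[_ /andP[-> _] -> _]; by [].
have hn X : w \notin X -> ~~ hit F u w X by rewrite /hit (negPf bw).
move: gl; rewrite all_cat /= => /and3P[gA _ gB].
have [sA sB] := cat_sorted2 hl.
exists A, B; split.
- exact: rmf_sorted sA (hn _ uA) gA.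
- exact: rmf_sorted (path_sorted sB) (hn _ wAB) gB.
by rewrite filter_cat /= (negPf bw) (rmf_good_id gA (hn _ uA)) (rmf_good_id gB (hn _ wAB)).
Qed.

(** The segments are disjoint, so a fault hits at most one of them and adds at most one segment. *)
Lemma cut_segments u w F (L : seq (seq T)) : all (sorted (adj (rmf u w F))) L ->
  uniq (flatten L) -> all (good (rmf u w F)) (flatten L) -> exists L',
  [/\ all (sorted (adj F)) L', flatten L' = filter (good F) (flatten L) &
      size L' <= (size L).+1].
Proof.
elim: L => [|l L IH] /=; first by exists [::].
move=> /andP[hl hL]; rewrite cat_uniq all_cat => /and3P[ul hd uL] /andP[gl gL].
have [h|h] := boolP (hit F u w l); last first.
  have [L' [h1 h2 h3]] := IH hL uL gL; exists (l :: L') => /=.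
  by rewrite h1 (rmf_sorted hl h gl) filter_cat (rmf_good_id gl h) h2.
have [l1 [l2 [h1 h2 h3]]] := cut_sorted hl ul gl.
have wl : w \in l by move: h; rewrite /hit; case: ifP => // _ /andP[].
have wL : w \notin flatten L by apply: contraNN hd => wL; apply/hasP; exists w.
have hn X : w \notin X -> ~~ hit F u w X.
  by rewrite /hit => wX; case: ifP => _; rewrite (negPf wX) ?andbF.
exists [:: l1, l2 & L]; split=> //=.
  rewrite h1 h2 /=; apply/allP => l' l'L.
  have w' : w \notin l' by apply: contraNN wL => w'; apply/flattenP; exists l'.
  apply: rmf_sorted (allP hL _ l'L) (hn _ w') _; apply/allP => x xl'.
  by apply: (allP gL); apply/flattenP; exists l'.
by rewrite catA h3 filter_cat (rmf_good_id gL (hn _ wL)).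
Qed.

Lemma flatten_nonempty (L : seq (seq T)) :
  flatten [seq l <- L | l != [::]] = flatten L.
Proof. by elim: L => // -[|x l] L IH //=; rewrite IH. Qed.

(** Cutting may leave empty segments, which are dropped. Since s and t are healthy, the first
    remaining segment still starts at s and the last one still ends at t. *)
Lemma cut_path2 n V F u1 w1 u2 w2 s p t z (F2 := rmf u2 w2 (rmf u1 w1 F)) : sub n V ->
  walk (adj F2) s p t -> perm_eq (z ++ p) (gd F2 V) -> good F s -> good F t ->
  exists z', size z' <= size z /\
  [\/ exists2 p1, walk (adj F) s p1 t & perm_eq (z' ++ p1) (gd F V),
      exists p1 a b p2, [/\ walk (adj F) s p1 a, walk (adj F) b p2 t &
        perm_eq (z' ++ p1 ++ p2) (gd F V)] |
      exists p1 a b p2 c d p3, [/\ walk (adj F) s p1 a, walk (adj F) b p2 c,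
        walk (adj F) d p3 t & perm_eq (z' ++ p1 ++ p2 ++ p3) (gd F V)]].
Proof.
move=> sV hp pz gs gt.
have uzp : uniq (z ++ p) by rewrite (perm_uniq pz) (gd_uniq _ sV).
have up : uniq p by move: uzp; rewrite cat_uniq => /and3P[].
have [so hs ht] := walk_sorted hp.
have g2 : all (good F2) p.
  by apply/allP => x xp; have := perm_mem pz x; rewrite mem_cat xp orbT mem_gd => /esym/andP[].
have [L1 [h1 h2 h3]] : exists L1, [/\ all (sorted (adj (rmf u1 w1 F))) L1,
    flatten L1 = filter (good (rmf u1 w1 F)) p & size L1 <= 2].
  by have := @cut_segments u2 w2 (rmf u1 w1 F) [:: p]; rewrite /= cats0 so up => /(_ isT isT g2).
have [||L2 [k1 k2 k3]] := @cut_segments u1 w1 F L1 h1; rewrite ?h2 ?filter_uniq ?filter_all //.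
pose L := [seq l <- L2 | l != [::]].
have fl : flatten L = filter (good F) p.
  rewrite flatten_nonempty k2 h2 -filter_predI; apply: eq_filter => x /=.
  by rewrite good_rmf; case: (good F x).
have sL : size L <= 3 by rewrite size_filter (leq_trans (count_size _ _)) // (leq_trans k3).
exists (filter (good F) z); split; first by rewrite size_filter count_size.
have pL : perm_eq (filter (good F) z ++ flatten L) (gd F V).
  rewrite fl -filter_cat; apply: perm_trans (perm_filter _ pz) _.
  rewrite /gd -filter_predI (eq_filter (a2 := good F)) // => x /=.
  by rewrite !good_rmf; case: (good F x).
have sp : all (fun l => (l != [::]) && sorted (adj F) l) L.
  apply/allP => l; rewrite mem_filter => /andP[-> hl]; exact: (allP k1).
have hd : head s (flatten L) = s.
  by rewrite fl; case: (p) hp => //= x p' /and3P[/eqP-> _ _]; rewrite gs.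
have ls : last t (flatten L) = t.
  rewrite fl; case/lastP: (p) hp => // p' x hx; have xt := walk_rcons_end hx.
  by rewrite filter_rcons -xt gt last_rcons.
have Ln : L != [::].
  have : s \in flatten L by rewrite fl mem_filter gs (walk_mem1 hp).
  by case: (L).
have sw x l : sorted (adj F) (x :: l) -> walk (adj F) x (x :: l) (last x l).
  by move=> /= h; rewrite !eqxx h.
move: (L) sL pL sp hd ls Ln => [|l1 [|l2 [|l3 [|]]]] //= _; rewrite ?cats0 => pL.
- case: l1 pL => [|x1 l1] //= pL; rewrite andbT => /sw h1' h4 h5 _; subst x1 t.
  by constructor 1; exists (s :: l1).
- case: l1 pL => [|x1 l1] //=; case: l2 => [|x2 l2]; rewrite ?andbF //= => pL.
  move=> /and3P[/sw h1' /sw h2' _] h4 h5 _; rewrite last_cat /= in h5; subst x1 t.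
  by constructor 2; exists (s :: l1), (last s l1), x2, (x2 :: l2).
case: l1 pL => [|x1 l1] //=; case: l2 => [|x2 l2]; rewrite ?andbF //=.
case: l3 => [|x3 l3]; rewrite ?andbF //= => pL.
move=> /and4P[/sw h1' /sw h2' /sw h3' _] h4 h5 _; rewrite !last_cat /= last_cat /= in h5; subst x1 t.
by constructor 3; exists (s :: l1), (last s l1), x2, (x2 :: l2), (last x2 l2), x3, (x3 :: l3).
Qed.

End Segments.

(** * Rejoining three segments, and putting a missed vertex back *)

Section Rescue.
Variable G : sgraph.
Local Notation T := (vertex G).
Implicit Types (F : seq (T * T)) (V X Y D p q z l : seq T) (x y s t u v w : T) (mu : T -> T).

Definition CC n := forall V F, @sub G n V -> nf V F <= 2 * n - 9 ->
  exists p z, [/\ size z <= 1, cycle (adj F) p & perm_eq (z ++ p) (gd F V)].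

Section Half.
Variables (n : nat) (V V1 V2 : seq T) (mu : T -> T) (F : seq (T * T)).
Hypotheses (n5 : 5 <= n) (sp : bisection n V V1 V2 mu) (hn5 : nf V2 F <= n - 5).
Let hc : HC G n. Proof. by apply: hc_all; arith. Qed.
Let d2 : D2 G n. Proof. by apply: d2_all; arith. Qed.
Let hn3 : nf V2 F <= n - 3. Proof. by arith. Qed.

(** [D2] in [V2] joins [mu a] to [mu b] and [mu c] to [mu d]. This needs b and c distinct: a middle
    segment of one vertex has only one cross edge. *)
Lemma join_three s p1 a b p2 c d p3 t z :
  walk (adj F) s p1 a -> walk (adj F) b p2 c -> walk (adj F) d p3 t -> b != c ->
  [/\ link F mu a, link F mu b, link F mu c & link F mu d] ->
  perm_eq (z ++ p1 ++ p2 ++ p3) (gd F V1) ->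
  exists2 p, walk (adj F) s p t & perm_eq (z ++ p) (gd F V).
Proof.
move=> h1 h2 h3 bc hl pz; have [up hp _] := gd_size1 sp pz.
have ha := walk_mem2 h1; have hb := walk_mem1 h2; have hcc := walk_mem2 h2.
have hd := walk_mem1 h3.
have uq : uniq [:: a; b; c; d].
  move: up; rewrite !cat_uniq has_cat negb_or => /and3P[_ /andP[/hasPn d12 /hasPn d13] /and3P[_ /hasPn d23 _]].
  have ab : b != a by apply: contraTneq hb => ->; apply/negP => /d12 /=; rewrite ha.
  have ac : c != a by apply: contraTneq hcc => ->; apply/negP => /d12 /=; rewrite ha.
  have ad : d != a by apply: contraTneq hd => ->; apply/negP => /d13 /=; rewrite ha.
  have bd : d != b by apply: contraTneq hd => ->; apply/negP => /d23 /=; rewrite hb.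
  have cd : d != c by apply: contraTneq hd => ->; apply/negP => /d23 /=; rewrite hcc.
  by rewrite /= !inE !negb_or bc ![a == _]eq_sym ![_ == d]eq_sym ab ac ad bd cd.
have inV x : x \in p1 ++ p2 ++ p3 -> x \in V1 by move=> /hp /gd1V.
have [|p w1 w2] := join3 sp d2 hn5 _ hl uq h1 h2 h3.
  by split; apply: inV; rewrite !mem_cat ?ha ?hb ?hcc ?hd ?orbT.
by exists p => //; have hsp := split_gd sp F; perm_count.
Qed.

(* The vertex [y], which no segment contains, is inserted just before its neighbour [w]: the
   path leaves [V1] at the predecessor of [w] and comes back at [y]. *)
Lemma rescue s p1 a b p2 t y w z :
  walk (adj F) s p1 a -> walk (adj F) b p2 t -> w \in p1 -> w != s -> adj F y w ->
  {in p1, forall x, link F mu x} -> link F mu y -> link F mu b ->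
  perm_eq (z ++ y :: p1 ++ p2) (gd F V1) ->
  exists2 p, walk (adj F) s p t & perm_eq (z ++ p) (gd F V).
Proof.
move=> h1 h2 wp ws yw lp ly lb pz.
have [A [a' [B [ep w1 w2 w3]]]] := walk_before h1 wp ws.
have aA := walk_mem2 w1; have aB := walk_mem2 w3.
have pz' : perm_eq (z ++ A ++ (y :: w :: B) ++ p2) (gd F V1).
  by rewrite ep in pz; perm_count.
apply: (join_three w1 (walk_cons yw w3) h2 _ _ pz').
  have [up _ _] := gd_size1 sp (z := z) (p := y :: p1 ++ p2) pz.
  move: up; rewrite cons_uniq mem_cat negb_or ep => /andP[/andP[yp _] _].
  by apply: contraNneq yp => ->; rewrite mem_cat aB orbT.
by split => //; apply: lp; rewrite ep mem_cat ?aA ?aB ?orbT.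
Qed.

Lemma rescue_last s p1 a b p2 t y w z :
  walk (adj F) s p1 a -> walk (adj F) b p2 t -> w \in p2 -> w != t -> adj F y w ->
  {in p2, forall x, link F mu x} -> link F mu y -> link F mu a ->
  perm_eq (z ++ y :: p1 ++ p2) (gd F V1) ->
  exists2 p, walk (adj F) s p t & perm_eq (z ++ p) (gd F V).
Proof.
move=> h1 h2 wp wt yw lp ly la pz.
have rS := @adj_sym _ F.
have [|||p g1 g2] := rescue (z := z) (walk_rev rS h2) (walk_rev rS h1) _ wt yw _ ly la.
- by rewrite mem_rev.
- by move=> x; rewrite mem_rev; apply: lp.
- by perm_count.
by exists (rev p); [exact: walk_rev rS g1|perm_count].
Qed.

(* [D] collects vertices that are dealt with elsewhere *)
Lemma join_segments D s p1 a b p2 c d p3 t z :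
  walk (adj F) s p1 a -> walk (adj F) b p2 c -> walk (adj F) d p3 t ->
  {in z ++ p1 ++ p2 ++ p3, forall x, link F mu x} ->
  perm_eq (D ++ z ++ p1 ++ p2 ++ p3) (gd F V1) -> size z <= 1 ->
  (forall y, p2 = [:: b] -> z = [:: y] ->
     exists w, [/\ w \in gd F V1, w \notin D, w != s, w != t & adj F y w || adj F b w]) ->
  exists p z', [/\ size z' <= 1, walk (adj F) s p t & perm_eq (D ++ z' ++ p) (gd F V)].
Proof.
move=> h1 h2 h3 hl pz sz resc.
have la : link F mu a by apply: hl; rewrite !mem_cat (walk_mem2 h1) !orbT.
have lb : link F mu b by apply: hl; rewrite !mem_cat (walk_mem1 h2) !orbT.
have lc : link F mu c by apply: hl; rewrite !mem_cat (walk_mem2 h2) !orbT.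
have ld : link F mu d by apply: hl; rewrite !mem_cat (walk_mem1 h3) !orbT.
have [bc|bc] := eqVneq b c; last first.
  have [||p w1 w2] := join_three (z := D ++ z) h1 h2 h3 bc; rewrite -?catA //.
  by exists p, z; rewrite catA.
have [up _ _] := gd_size1 sp pz.
have p2b : p2 = [:: b].
  apply: (walk_loop (r := adj F)); first by rewrite {2}bc.
  by move: up; rewrite !cat_uniq => /and5P[_ _ _ _]; case/and3P.
(* The middle segment is the vertex b alone. If nothing else is missed, b is given up; otherwise one
   of b and the missed y, renamed [y1], is put back next to its neighbour w, and the other one,
   [y2], is given up. *)
case: z sz hl pz resc up => [|y [|]] //= _ hl pz resc up.
  rewrite p2b in pz; have [|p w1 w2] := join0 (z := D ++ [:: b]) sp hc hn3 h1 h3 la ld.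
    by perm_count.
  by exists p, [:: b]; split => //; perm_count.
have [w [wV wD ws wt yw]] := resc y p2b erefl.
have {yw} [y1 [y2 [yy yw]]] : exists y1 y2, perm_eq [:: y1; y2] [:: b; y] /\ adj F y1 w.
  by case/orP: yw => [yw|yw]; [exists y, b|exists b, y]; split => //; perm_count.
have ly x : x \in [:: b; y] -> link F mu x.
  by rewrite !inE => /orP[]/eqP->; apply: hl; rewrite !inE !mem_cat ?p2b ?inE ?eqxx ?orbT.
have l1 : link F mu y1 by apply: ly; rewrite -(perm_mem yy) mem_head.
have l2 : link F mu y2 by apply: ly; rewrite -(perm_mem yy) !inE eqxx orbT.
have pz1 : perm_eq ((D ++ [:: y2]) ++ y1 :: p1 ++ p3) (gd F V1).
  by rewrite p2b in pz; perm_count.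
have pz2 : perm_eq (D ++ p1 ++ [:: y1; y2] ++ p3) (gd F V1) by perm_count.
have fin p : walk (adj F) s p t -> perm_eq ((D ++ [:: y2]) ++ p) (gd F V) ->
  exists p z', [/\ size z' <= 1, walk (adj F) s p t & perm_eq (D ++ z' ++ p) (gd F V)].
  by move=> w1 w2; exists p, [:: y2]; split => //; perm_count.
have w1 : w != y1 by rewrite eq_sym (adj_neq yw).
have := perm_mem pz1 w; rewrite wV !(mem_cat, inE) (negPf wD) (negPf w1) /=.
move=> /or3P[/eqP ew|w2|w2].
(* Here b and y are adjacent and form a middle segment with two ends, so nothing is missed. *)
- subst w.
  have [|||p k1 k2] := join_three (z := D) h1 (_ : walk (adj F) y1 [:: y1; y2] y2) h3 (adj_neq yw) => //.
    by rewrite /= !eqxx yw.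
  by exists p, [::].
- have [||p k1 k2] := rescue (z := D ++ [:: y2]) h1 h3 w2 ws yw _ l1 ld => //.
    by move=> x xp; apply: hl; rewrite inE !mem_cat xp !orbT.
  exact: fin k1 k2.
have [||p k1 k2] := rescue_last (z := D ++ [:: y2]) h1 h3 w2 wt yw _ l1 la => //.
  by move=> x xp; apply: hl; rewrite inE !mem_cat xp !orbT.
exact: fin k1 k2.
Qed.

End Half.
End Rescue.

(** * Near-hamiltonian cycles with at most 2n - 9 faults *)

Section CycleStep.
Variable G : sgraph.
Local Notation T := (vertex G).
Implicit Types (F : seq (T * T)) (V X Y D p q z l : seq T) (x y s t u v w : T) (mu : T -> T).

Section Half.
Variables (n : nat) (V V1 V2 : seq T) (mu : T -> T).
Hypotheses (n7 : 7 <= n) (sp : bisection n V V1 V2 mu).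
Let hc : HC G n. Proof. by apply: hc_all; arith. Qed.
Let d2 : D2 G n. Proof. by apply: d2_all; arith. Qed.
Let pw : 6 * n + 2 <= 2 ^ n. Proof. by apply: pow_ge; arith. Qed.

Lemma nonlink_unique F x y : nf V F <= nf V1 F + 1 -> x \in gd F V1 -> y \in gd F V1 ->
  ~~ link F mu x -> ~~ link F mu y -> x = y.
Proof.
move=> hF hx hy lx ly; apply/eqP; apply: contraT => xy.
have hs : {subset [:: x; y] <= gd F V1} by move=> v; rewrite !inE => /orP[]/eqP->.
have us : uniq [:: x; y] by rewrite /= inE xy.
by have := nonlink_sub sp us hs; rewrite /= lx ly; arith.
Qed.

Lemma walk_ends_neq F x q y : uniq q -> walk (adj F) x q y -> 1 < size q -> x != y.
Proof.
move=> uq hw sz; apply: contraTneq sz => xy; subst y.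
by rewrite (walk_loop hw uq).
Qed.

Section Fixed.
Variable F : seq (T * T).
Hypothesis hn5 : nf V2 F <= n - 5.
Let hn3 : nf V2 F <= n - 3. Proof. by arith. Qed.

(** Two disjoint paths spanning [V2] close the two pieces to one cycle; pieces of at least two
    vertices make the four mates distinct. *)
Lemma close_two p1 x1 y1 p2 x2 y2 z : walk (adj F) x1 p1 y1 -> walk (adj F) x2 p2 y2 ->
  1 < size p1 -> 1 < size p2 ->
  [/\ link F mu x1, link F mu y1, link F mu x2 & link F mu y2] ->
  perm_eq (z ++ p1 ++ p2) (gd F V1) ->
  exists2 p, cycle (adj F) p & perm_eq (z ++ p) (gd F V).
Proof.
move=> h1 h2 s1 s2 [lx1 ly1 lx2 ly2] pz; have [up hp _] := gd_size1 sp pz.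
have a1 := walk_mem1 h1; have a2 := walk_mem2 h1.
have b1 := walk_mem1 h2; have b2 := walk_mem2 h2.
have inV x : x \in p1 ++ p2 -> x \in V1 by move=> /hp /gd1V.
have [u1 u2 dj] : [/\ uniq p1, uniq p2 & forall x, x \in p2 -> x \notin p1].
  by move: up; rewrite cat_uniq => /and3P[u1 /hasPn dj u2]; split.
have n1 := walk_ends_neq u1 h1 s1; have n2 := walk_ends_neq u2 h2 s2.
have nab a b : a \in p1 -> b \in p2 -> a != b.
  by move=> ap /dj; apply: contraNneq => <-.
have [V_y1 V_x2 V_y2 V_x1] : [/\ y1 \in V1, x2 \in V1, y2 \in V1 & x1 \in V1].
  by split; apply: inV; rewrite mem_cat ?a1 ?a2 ?b1 ?b2 ?orbT.
have [||q1 [q2 [g1 g2 g3]]] := d2 (a := mu y1) (b := mu x2) (c := mu y2) (d := mu x1) (split_sub2 sp) hn5.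
- rewrite (uniq_mu sp (s := [:: y1; x2; y2; x1])); last first.
    by move=> v; rewrite !inE => /or4P[]/eqP->.
  have f1 : y1 != x1 by rewrite eq_sym.
  have f2 : x2 != x1 by rewrite eq_sym nab.
  have f3 : y2 != x1 by rewrite eq_sym nab.
  by rewrite /= !inE !negb_or f1 f2 f3 n2 !nab.
- exact: (@sub2_gd _ _ _ _ _ _ sp F y1 x2 y2 x1).
exists (p1 ++ q1 ++ p2 ++ q2); last by have hsp := split_gd sp F; perm_count.
apply: (walk_cycle (x := x1) (y := mu x1)); last by rewrite adj_sym.
apply: walk_cat h1 ly1 _; apply: walk_cat g1 (_ : adj F (mu x2) x2) _; first by rewrite adj_sym.
exact: walk_cat h2 ly2 g2.
Qed.

(** The walk is split just before w and v is put in front of w. The part before w needs two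
    vertices; if it is shorter, the walk is reversed, and [3 < size q] gives enough vertices on the
    other side. *)
Lemma rescue_cycle x q y v w z : walk (adj F) x q y -> w \in q -> adj F v w -> 3 < size q ->
  {in q, forall x, link F mu x} -> link F mu v -> perm_eq (z ++ v :: q) (gd F V1) ->
  exists2 p, cycle (adj F) p & perm_eq (z ++ p) (gd F V).
Proof.
move=> hw wq vw sz lq lv pz.
have half q' x' y' : walk (adj F) x' q' y' -> perm_eq q' q -> w \in q' ->
    (exists A B, q' = A ++ w :: B /\ 1 < size A) ->
    exists2 p, cycle (adj F) p & perm_eq (z ++ p) (gd F V).
  move=> hw' pq wq' [A [B [eq' sA]]]; rewrite eq' in hw' pq.
  have An : A != [::] by case: (A) sA.
  have [//|a [b [k1 k2 k3]]] := walk_catP hw' An; have eb := walk_cons_start k3; subst b.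
  have lA u : u \in A ++ w :: B -> link F mu u by rewrite (perm_mem pq); apply: lq.
  apply: (close_two (z := z) k1 (walk_cons vw k3) sA isT).
    split=> //; apply: lA; rewrite mem_cat ?(walk_mem1 k1) ?(walk_mem2 k1) ?(walk_mem2 k3) ?orbT //.
  by perm_count.
case/splitPr: wq (hw) half sz => A B hw' half sz.
have [sA|sA] := leqP 2 (size A).
  by apply: (half (A ++ w :: B) x y) => //; [rewrite mem_cat mem_head orbT|exists A, B].
apply: (half (rev (A ++ w :: B)) y x); first exact: walk_rev (@adj_sym _ F) hw'.
- by perm_count.
- by rewrite mem_rev mem_cat mem_head orbT.
exists (rev B), (rev A); split; first by rewrite rev_cat rev_cons cat_rcons.
by move: sz; rewrite size_rev size_cat /=; arith.
Qed.

Definition near_cycle := exists p z, [/\ size z <= 1, cycle (adj F) p & perm_eq (z ++ p) (gd F V)].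

Lemma near_cycleI z : size z <= 1 -> (exists2 p, cycle (adj F) p & perm_eq (z ++ p) (gd F V)) ->
  near_cycle.
Proof. by move=> sz [p' h1 h2]; exists p', z. Qed.

Hypothesis hF : nf V F <= 2 * n - 7.

Lemma finish_cycle p z : cycle (adj F) p -> size z <= 1 -> perm_eq (z ++ p) (gd F V1) ->
  near_cycle.
Proof.
move=> hp sz pz; apply: (near_cycleI sz).
by apply: (cycle0 sp hc hn3 hp pz); arith.
Qed.

Lemma finish_walk x q y z : walk (adj F) x q y -> size z <= 1 -> perm_eq (z ++ q) (gd F V1) ->
  link F mu x -> link F mu y -> near_cycle.
Proof.
move=> hq sz pz lx ly; apply: (near_cycleI sz).
have [_ _ h] := gd_size1 sp pz; have := nf_split sp F => h12.
by apply: (close0 sp hc hn3 lx ly hq pz); arith.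
Qed.

Hypothesis al : forall x, x \in gd F V1 -> link F mu x.

(** This serves the case in which two faults were repaired: the first one put back has opened the
    cycle to [q], the second one splits [q] into at most two segments. *)
Lemma finish_walk2 u w x q y z : walk (adj (rmf u w F)) x q y -> size z <= 1 ->
  perm_eq (z ++ q) (gd (rmf u w F) V1) -> near_cycle.
Proof.
move=> hq sz pz; have h12 := nf_split sp F.
have [so _ _] := walk_sorted hq; have [uq _ hs] := gd_size1 sp pz.
have gq : all (good (rmf u w F)) q.
  by apply/allP => v vq; have := perm_mem pz v; rewrite mem_cat vq orbT mem_gd => /esym/andP[].
have [L' [h1 h2 h3]] : exists L, [/\ all (sorted (adj F)) L, flatten L = filter (good F) q & size L <= 2].
  by have := @cut_segments _ u w F [:: q]; rewrite /= cats0 so uq => /(_ isT isT gq).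
pose L := [seq l <- L' | l != [::]].
have sL : size L <= 2 by rewrite size_filter (leq_trans (count_size _ _)).
pose z' := filter (good F) z.
have sz' : size z' <= 1 by rewrite size_filter (leq_trans (count_size _ _)).
have pL : perm_eq (z' ++ flatten L) (gd F V1).
  rewrite flatten_nonempty h2 -filter_cat; apply: perm_trans (perm_filter _ pz) _.
  rewrite /gd -filter_predI (eq_filter (a2 := good F)) // => v /=.
  by rewrite good_rmf; case: (good F v).
have sLs : all (fun l => (l != [::]) && sorted (adj F) l) L.
  by apply/allP => l; rewrite mem_filter => /andP[-> hl]; exact: (allP h1).
have al' v : v \in z' ++ flatten L -> link F mu v by rewrite (perm_mem pL); apply: al.
have [_ _ h4] := gd_size1 sp pL.
have pwl : 2 ^ n <= size (flatten L) + 1 + nf V1 F by arith.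
(* For a segment of one vertex c: if nothing else is missed, c is given up. Otherwise v and c
   together lose at most 2n - 7 + 3 of their 2n neighbours, so one of them still has a neighbour and
   is put back there. *)
have single p1 x1 y1 c z0 : walk (adj F) x1 p1 y1 -> size z0 <= 1 ->
    perm_eq (z0 ++ c :: p1) (gd F V1) -> 3 < size p1 -> near_cycle.
  move=> k1 sz0 k2 k3.
  have al0 v : v \in z0 ++ c :: p1 -> link F mu v by rewrite (perm_mem k2); apply: al.
  have lx1 : link F mu x1 by apply: al0; rewrite mem_cat inE (walk_mem1 k1) !orbT.
  have ly1 : link F mu y1 by apply: al0; rewrite mem_cat inE (walk_mem2 k1) !orbT.
  case: z0 sz0 k2 al0 => [|v [|]] //= _ k2 al0.
    by apply: (finish_walk k1 (z := [:: c])).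
  have gv : v \in gd F V1 by rewrite -(perm_mem k2) mem_head.
  have gc : c \in gd F V1 by rewrite -(perm_mem k2) !inE eqxx orbT.
  have [uz _ _] := gd_size1 sp (z := [::]) (p := v :: c :: p1) k2.
  have vc : v != c by move: uz; rewrite /= inE negb_or => /andP[/andP[]].
  have b2 := bnb2 (split_sub1 sp) gv gc vc.
  have nv := nb_size F (split_sub1 sp) (gd1V gv).
  have nc := nb_size F (split_sub1 sp) (gd1V gc).
  have [v1 [v2 [vv [w' hw']]]] : exists v1 v2, perm_eq [:: v1; v2] [:: v; c] /\ exists w', w' \in gnb F V1 v1.
    have [k|k] := leqP 1 (size (gnb F V1 v)).
      exists v, c; split; first exact: perm_refl.
      by case: (gnb F V1 v) k => // a l _; exists a; rewrite mem_head.
    exists c, v; split; first by perm_count.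
    have : 0 < size (gnb F V1 c) by arith.
    by case: (gnb F V1 c) => // a l _; exists a; rewrite mem_head.
  move: hw'; rewrite mem_gnb => /andP[vw' w'V].
  have pz1 : perm_eq (v1 :: v2 :: p1) (gd F V1) by perm_count.
  have lv1 : link F mu v1 by apply: al; rewrite -(perm_mem pz1) mem_head.
  have lv2 : link F mu v2 by apply: al; rewrite -(perm_mem pz1) !inE eqxx orbT.
  have gw' : w' \in gd F V1 by rewrite mem_gd w'V (adj_good vw').2.
  have := perm_mem pz1 w'; rewrite gw' !inE eq_sym (negPf (adj_neq vw')) /= => /orP[/eqP e1|w1].
    subst w'; apply: (near_cycleI (z := [::])) => //.
    apply: (close_two (z := [::]) k1 (_ : walk (adj F) v1 [:: v1; v2] v2)) => //.
    - by rewrite /= !eqxx vw'.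
    - by arith.
    - by perm_count.
  apply: (near_cycleI (z := [:: v2])) => //.
  apply: (rescue_cycle k1 w1 vw') => //.
    by move=> a ap; apply: al; rewrite -(perm_mem pz1) !inE ap !orbT.
  by perm_count.
have sw a l : sorted (adj F) (a :: l) -> walk (adj F) a (a :: l) (last a l).
  by move=> /= h; rewrite !eqxx h.
move: (L) sL sLs pL al' pwl => [|l1 [|l2 []]] //= _; rewrite ?cats0.
- by move=> _ _ _; arith.
- case: l1 => //= a l1; rewrite andbT => /sw k1 k2 al' k3.
  apply: (finish_walk k1 sz' k2); apply: al'.
    by rewrite mem_cat mem_head orbT.
  by rewrite mem_cat (walk_mem2 k1) orbT.
case: l1 => //= a l1; case: l2 => [|b l2]; rewrite ?andbF //= andbT => /andP[/sw k1 /sw k2] k3 al' k4.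
have la : link F mu a by apply: al'; rewrite mem_cat mem_head orbT.
have lb : link F mu b by apply: al'; rewrite -cat_cons !mem_cat mem_head !orbT.
have la' : link F mu (last a l1) by apply: al'; rewrite -cat_cons !mem_cat (walk_mem2 k1) !orbT.
have lb' : link F mu (last b l2) by apply: al'; rewrite -cat_cons !mem_cat (walk_mem2 k2) !orbT.
case: l1 k1 k3 la' k4 {al'} => [|a' l1] k1 k3 la' k4.
  apply: (single (b :: l2) b (last b l2) a z') => //.
  by move: k4; rewrite /=; arith.
case: l2 k2 k3 lb' k4 => [|b' l2] k2 k3 lb' k4.
  apply: (single [:: a, a' & l1] a _ b z' k1) => //; first by perm_count.
  by move: k4; rewrite /= size_cat /=; arith.
by apply: (near_cycleI sz'); apply: (close_two k1 k2).
Qed.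

End Fixed.

End Half.
End CycleStep.

Section CycleStep2.
Variable G : sgraph.
Local Notation T := (vertex G).
Implicit Types (F : seq (T * T)) (V X Y D p q z l : seq T) (x y s t u v w : T) (mu : T -> T).

(** If every fault touches b, a neighbour lost by v is either b itself or a common neighbour of v
    and b. *)
Lemma bnb_all_touch n V F b v : @sub G n V -> b \in V -> v \in gd F V -> v != b ->
  (forall u w, (u, w) \in F -> u \in V -> w \in V -> tch F u w b) -> size (bnb F V v) <= 3.
Proof.
move=> sV bV; rewrite mem_gd => /andP[gv vV] vb ht.
have h := sub_common sV vV bV vb.
have : size (bnb F V v) <= size (b :: filter (fun w => edge v w && edge b w) V).
  apply: uniq_leq_size; first by apply: filter_uniq; apply: sub_uniq sV.
  move=> w; rewrite mem_bnb // inE mem_filter => /and3P[wV vw].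
  have wv : w != v by apply: contraTneq vw => ->; rewrite edge_irr.
  have [gw|bw] := boolP (good F w).
    have bv : b != v by rewrite eq_sym.
    move=> /= /orP[k|k].
      by have := ht _ _ k vV wV; rewrite /tch gw (negPf bv) /= eq_sym => ->.
    by have := ht _ _ k wV vV; rewrite /tch gv (negPf bv) orbF eq_sym => ->.
  move=> _; rewrite /good negbK in bw.
  by have := ht _ _ bw wV wV; rewrite /tch /good bw /= => ->; rewrite vw wV orbT.
by rewrite /= size_filter; move: h; arith.
Qed.

Section Half.
Variables (n : nat) (V V1 V2 : seq T) (mu : T -> T) (F : seq (T * T)).
Hypotheses (n7 : 7 <= n) (sp : bisection n V V1 V2 mu).

(* a fault of [V1] away from the vertices whose cross edge is lost *)
Definition far_fault := has (fun f => inside V1 f &&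
  all (fun x => link F mu x || ~~ tch F f.1 f.2 x) (gd F V1)) F.

Lemma far_faultP : far_fault -> exists u w, [/\ (u, w) \in F, u \in V1, w \in V1 &
  forall x, x \in gd F V1 -> tch F u w x -> link F mu x].
Proof.
move=> /hasP[[u w] uwF /andP[/andP[/= uV wV] /allP h]]; exists u, w; split => // x /h.
by case: (link F mu x) => //= /negPf->.
Qed.

Lemma far_faultPn b : ~~ far_fault -> nf V F <= nf V1 F + 1 -> b \in gd F V1 -> ~~ link F mu b ->
  forall u w, (u, w) \in F -> u \in V1 -> w \in V1 -> tch F u w b.
Proof.
move=> /hasPn h hF hb lb u w uwF uV wV; have := h _ uwF; rewrite /inside /= uV wV /=.
case/allPn=> x xg; rewrite negb_or negbK => /andP[lx tx].
by rewrite (nonlink_unique n7 sp hF hb xg lb lx).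
Qed.

Hypothesis (cc : CC G n).
Let hc : HC G n. Proof. by apply: hc_all; arith. Qed.
Let pw : 6 * n + 2 <= 2 ^ n. Proof. by apply: pow_ge; arith. Qed.

(** Only 2n - 8 or 2n - 7 faults in [V1] need work. With a fault outside [V1] there are 2n - 8
    inside, and one is repaired, preferably a far one, so that the cycle opens at vertices with
    cross edges. With none outside, all cross edges survive and one or two faults are repaired. *)
Lemma cc_half : nf V F <= 2 * n - 7 -> nf V2 F <= nf V1 F ->
  exists p z, [/\ size z <= 1, cycle (adj F) p & perm_eq (z ++ p) (gd F V)].
Proof.
move=> hF h21; have h12 := nf_split sp F.
have hn3 : nf V2 F <= n - 3 by arith.
have [h1|h1] := leqP (nf V1 F) (2 * n - 9).
  have [p [z [sz hp pz]]] := cc (split_sub1 sp) h1.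
  have [|p' k1 k2] := cycle0 sp hc hn3 hp pz; first by arith.
  by exists p', z.
have hn5 : nf V2 F <= n - 5 by arith.
have sz_gd F0 p z : perm_eq (z ++ p) (gd F0 V1) -> size z <= 1 -> nf V1 F0 <= 2 * n - 7 -> 4 < size p.
  by move=> k1 k2 k3; have [_ _] := gd_size1 sp k1; arith.
have [h2|h2] := leqP (nf V F) (nf V1 F); last first.
  have one : nf V F <= nf V1 F + 1 by arith.
  have [/far_faultP[u [w [fuw uV wV far]]]|nfar] := boolP far_fault.
    have [|p [z [sz hp pz]]] := @cc V1 (rmf u w F) (split_sub1 sp).
      have := @nf_rmf _ u w F V1 uV wV; rewrite fuw orbT => /(_ isT); arith.
    have sp4 := sz_gd _ _ _ pz sz (leq_trans (nf_rmf_le _ _ _ _) (leq_trans (leq_trans (leq_addr _ _) h12) hF)).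
    have [|z' [_ sz' [[k1 k2]|[q [x [y [k1 k2 k3 k4]]]]]]] := cut_cycle (split_sub1 sp) hp pz.
    - by arith.
    - by apply: (finish_cycle n7 sp hn5 hF k1 _ k2); arith.
    have [_ qV _] := gd_size1 sp k4.
    apply: (finish_walk n7 sp hn5 hF k1 _ k4); first by arith.
      exact: far (qV _ (walk_mem1 k1)) k2.
    exact: far (qV _ (walk_mem2 k1)) k3.
  have [|u [w [fuw uV wV hlt]]] := @exists_fault _ V1 F; first by arith.
  have [|p [z [sz hp pz]]] := @cc V1 (rmf u w F) (split_sub1 sp); first by arith.
  have sp4 : 4 < size p by apply: sz_gd pz sz _; arith.
  have [|z' [_ sz' [[k1 k2]|[q [x [y [k1 k2 k3 k4]]]]]]] := cut_cycle (split_sub1 sp) hp pz.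
  - by arith.
  - by apply: (finish_cycle n7 sp hn5 hF k1 _ k2); arith.
  have {}sz' : size z' <= 1 by arith.
  have sq : 4 < size q by apply: sz_gd k4 sz' _; arith.
  have [uq qV _] := gd_size1 sp k4.
  (* [x0] is the one vertex that has lost its cross edge, and it is given up. If a vertex [z0] was
     already missed, it has lost at most three neighbours, since all faults touch [x0], and can be
     put back. *)
  have drop x0 y0 q0 : walk (adj F) x0 q0 y0 -> perm_eq q0 q -> ~~ link F mu x0 -> near_cycle V F.
    move=> w0 pq lx0; have gx0 : x0 \in gd F V1 by apply: qV; rewrite -(perm_mem pq) (walk_mem1 w0).
    case: q0 w0 pq => [|x1 [|x2 q0]] // w0 pq; have ex := walk_cons_start w0; subst x1.
      by have := perm_size pq; move: sq; rewrite /=; arith.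
    have [//|//|a [c [_ _ w1]]] := walk_catP (p := [:: x0]) w0; have ec := walk_cons_start w1; subst c.
    have sq1 : 3 < size (x2 :: q0) by have := perm_size pq; move: sq; rewrite /=; arith.
    have pz1 : perm_eq (z' ++ x0 :: x2 :: q0) (gd F V1) by perm_count.
    have [uz hz _] := gd_size1 sp (z := [::]) pz1.
    have lk v : v \in z' ++ x2 :: q0 -> link F mu v.
      move=> hv; apply: contraT => nl.
      have ev : v = x0.
        apply: (nonlink_unique n7 sp one) => //; apply: hz; move: hv.
        by rewrite !mem_cat (in_cons x0) => /orP[->|->]; rewrite ?orbT.
      move: uz; rewrite -cat1s uniq_catCA cat1s cons_uniq => /andP[/negP[]].
      by rewrite -ev.
    case: (z') sz' pz1 lk => [|z0 [|]] // _ pz1 lk.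
      apply: (finish_walk n7 sp hn5 hF w1 (z := [:: x0])) => //.
        exact: lk (walk_mem1 w1).
      exact: lk (walk_mem2 w1).
    have gz0 : z0 \in gd F V1 by rewrite -(perm_mem pz1) mem_head.
    have z0x : z0 != x0.
      have [u1 _ _] := gd_size1 sp (z := [::]) pz1.
      by move: u1; rewrite /= inE negb_or => /andP[/andP[]].
    have bz := bnb_all_touch (split_sub1 sp) (gd1V gx0) gz0 z0x (far_faultPn nfar one gx0 lx0).
    have nz := nb_size F (split_sub1 sp) (gd1V gz0).
    have [||w' w'g w'x] := @pick_avoid _ (gnb F V1 z0) [:: x0].
    - by apply: filter_uniq; apply: sub_uniq (split_sub1 sp).
    - by rewrite /=; arith.
    move: w'g w'x; rewrite mem_gnb inE => /andP[zw' w'V] w'x.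
    have gw' : w' \in gd F V1 by rewrite mem_gd w'V (adj_good zw').2.
    apply: (@near_cycleI _ _ _ [:: x0]) => //.
    apply: (rescue_cycle n7 sp hn5 (z := [:: x0]) w1 _ zw') => //.
    - have := perm_mem pz1 w'; rewrite gw' !inE eq_sym (negPf (adj_neq zw')) (negPf w'x) /=.
      by [].
    - by move=> v vq; apply: lk; rewrite inE vq orbT.
    - by apply: lk; rewrite mem_head.
    by perm_count.
  have [lx|lx] := boolP (link F mu x); last exact: (drop x y q k1).
  have [ly|ly] := boolP (link F mu y).
    exact: (finish_walk n7 sp hn5 hF k1 sz' k4).
  by apply: (drop y x (rev q)) => //; [exact: walk_rev (@adj_sym _ F) k1|perm_count].
have al x : x \in gd F V1 -> link F mu x by apply: (all_link sp).
have [|u [w [fuw uV wV hlt]]] := @exists_fault _ V1 F; first by arith.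
have [z [sz st]] : exists z, size z <= 1 /\
    ((exists p, cycle (adj (rmf u w F)) p /\ perm_eq (z ++ p) (gd (rmf u w F) V1)) \/
     (exists q x y, walk (adj (rmf u w F)) x q y /\ perm_eq (z ++ q) (gd (rmf u w F) V1))).
  have [k|k] := leqP (nf V1 (rmf u w F)) (2 * n - 9).
    by have [p [z [sz hp pz]]] := cc (split_sub1 sp) k; exists z; split => //; left; exists p.
  have [|u2 [w2 [fuw2 uV2 wV2 hlt2]]] := @exists_fault _ V1 (rmf u w F); first by arith.
  have [|p [z [sz hp pz]]] := @cc V1 (rmf u2 w2 (rmf u w F)) (split_sub1 sp); first by arith.
  have sp4 : 4 < size p by apply: sz_gd pz sz _; arith.
  have [|z' [_ sz' [[k1 k2]|[q [x [y [k1 _ _ k4]]]]]]] := cut_cycle (split_sub1 sp) hp pz.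
  - by arith.
  - by exists z'; split; [arith|left; exists p].
  by exists z'; split; [arith|right; exists q, x, y].
case: st => [[p [k1 k2]]|[q [x [y [k1 k2]]]]]; last exact: (finish_walk2 n7 sp hn5 hF al k1 sz k2).
have sp4 : 4 < size p by apply: sz_gd k2 sz _; arith.
have [|z2 [_ sz2 [[g1 g2]|[q [x [y [g1 g2 g3 g4]]]]]]] := cut_cycle (split_sub1 sp) k1 k2.
- by arith.
- by apply: (finish_cycle n7 sp hn5 hF g1 _ g2); arith.
have [_ qV _] := gd_size1 sp g4.
apply: (finish_walk n7 sp hn5 hF g1 _ g4); first by arith.
  exact: al (qV _ (walk_mem1 g1)).
exact: al (qV _ (walk_mem2 g1)).
Qed.

End Half.

Lemma cc_step n : 7 <= n -> CC G n -> CC G n.+1.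
Proof.
move=> n7 cc V F sV hF; have n3 : 3 <= n by arith.
have [V1 [V2 [mu sp]]] := sub_split n3 sV; have spS := split_sym sp.
have {}hF : nf V F <= 2 * n - 7 by arith.
have [h|h] := leqP (nf V2 F) (nf V1 F); first exact: (cc_half n7 sp cc).
by apply: (cc_half n7 spS cc) => //; apply: ltnW.
Qed.

(** The induction starts at 7, where 2n - 9 is the bound n - 2 of [HH]. *)
Lemma cc_all n : 7 <= n -> CC G n.
Proof.
elim: n => // n IH; rewrite leq_eqVlt => /orP[/eqP n7|n7]; last by apply: cc_step; auto.
have {n7} -> : n = 6 by arith.
move=> V F sV hF; have [|_ hh _] := @hc_hh_d2 G 7; first by [].
by have [p h1 h2] := hh V F sV hF; exists p, [::].
Qed.

End CycleStep2.

(** * Near-hamiltonian paths: the induction hypothesis and isolated ends *)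

Lemma walk_inner (T : eqType) (r : rel T) x p y s : symmetric r -> walk r x p y -> uniq p ->
  s \in p -> s != x -> s != y ->
  exists a b, [/\ a != b, a \in p, b \in p, r s a & r s b].
Proof.
move=> rS hp up sp sx sy; have [A [a [B [ep h1 h2 h3]]]] := walk_before hp sp sx.
have Bn : B != [::].
  by apply: contra_neq sy => B0; move: h3; rewrite B0 /= => /andP[_ /eqP].
have [c [b [h4 h5 h6]]] := walk_catP (p := [:: s]) h3 isT Bn.
have cs : c = s by move: h4 => /= /andP[_ /eqP].
have ap : a \in p by rewrite ep mem_cat (walk_mem2 h1).
have bp : b \in p by rewrite ep mem_cat inE (walk_mem1 h6) !orbT.
subst c; exists a, b; split; rewrite // 1?rS //.
move: up; rewrite ep cat_uniq => /and3P[_ /hasPn hd _].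
have := hd b; rewrite inE (walk_mem1 h6) orbT => /(_ isT) /=.
by apply: contraNneq => <-; apply: walk_mem2 h1.
Qed.

Section PathStep.
Variable G : sgraph.
Local Notation T := (vertex G).
Implicit Types (F : seq (T * T)) (V X Y D p q z l : seq T) (x y s t u v w : T) (mu : T -> T).

(** The condition of the theorem on the end s, but relative to [V]: it may hold in a network and
    fail in its half. *)
Definition el F V s t := has (fun w => w != t) (gnb F V s).
Definition near F V s t := exists p z,
  [/\ size z <= 1, walk (adj F) s p t & perm_eq (z ++ p) (gd F V)].

Definition PP n := forall V F s t, @sub G n V -> nf V F <= 2 * n - 10 ->
  s \in gd F V -> t \in gd F V -> s != t -> el F V s t -> el F V t s -> near F V s t.

Lemma nearI F V s t z : size z <= 1 ->
  (exists2 p, walk (adj F) s p t & perm_eq (z ++ p) (gd F V)) -> near F V s t.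
Proof. by move=> sz [p h1 h2]; exists p, z. Qed.

Lemma near_rev F V s t : near F V s t -> near F V t s.
Proof.
move=> [p [z [sz h1 h2]]]; exists (rev p), z; split => //; last by perm_count.
exact: walk_rev (@adj_sym _ F) h1.
Qed.

Lemma gnb_uniq n F V s : @sub G n V -> uniq (gnb F V s).
Proof. by move=> sV; apply: filter_uniq; apply: sub_uniq sV. Qed.

Lemma gnb_avoid n F V s Y : @sub G n V -> s \in gd F V ->
  size (bnb F V s) + size Y < n -> exists w, [/\ w \in gd F V, w \notin Y & adj F s w].
Proof.
move=> sV hs h; have sV' : s \in V by move: hs; rewrite mem_gd => /andP[].
have nb := nb_size F sV sV'.
have [||w] := @pick_avoid _ (gnb F V s) Y; [exact: gnb_uniq sV|by arith|].
rewrite mem_gnb => /andP[sw wV] wY; exists w; split => //.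
by rewrite mem_gd wV (adj_good sw).2.
Qed.

Lemma el_big n F V s t : @sub G n V -> s \in gd F V -> size (bnb F V s) + 1 < n -> el F V s t.
Proof.
move=> sV hs h; have [w [wV wt sw]] := @gnb_avoid n F V s [:: t] sV hs h.
apply/hasP; exists w; last by move: wt; rewrite inE.
by rewrite mem_gnb sw; move: wV; rewrite mem_gd => /andP[].
Qed.

Lemma el_small n F V s t : @sub G n V -> s \in gd F V -> ~~ el F V s t ->
  n <= size (bnb F V s) + 1.
Proof. by move=> sV hs; apply: contraNT; rewrite -ltnNge; apply: el_big. Qed.

Lemma el_mono F F' V s t : subrel (adj F) (adj F') -> el F V s t -> el F' V s t.
Proof.
move=> h /hasP[w]; rewrite mem_gnb => /andP[sw wV] wt; apply/hasP; exists w => //.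
by rewrite mem_gnb wV (h _ _ sw).
Qed.

Lemma el_rmf F V s t w : good F s -> w \in bnb F V s -> w != t -> el (rmf s w F) V s t.
Proof.
move=> gs; rewrite mem_bnb // => /and3P[wV sw _] wt; apply/hasP; exists w => //.
rewrite mem_gnb wV andbT /adj sw !good_rmf gs eqxx orbT /=.
by rewrite !mem_filter !inE !eqxx !orbT.
Qed.

Lemma nf_rmf_bnb F V s w : good F s -> s \in V -> w \in bnb F V s -> nf V (rmf s w F) < nf V F.
Proof.
move=> gs sV; rewrite mem_bnb // => /and3P[wV sw h]; apply: nf_rmf => //.
by move: h; rewrite /good negbK.
Qed.

(** If s has no healthy neighbour besides t, the repair is spent on another neighbour of s;
    otherwise any fault is repaired. *)
Lemma fix_el n F V s t : 3 <= n -> @sub G n V -> s \in gd F V -> exists u w,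
  nf V (rmf u w F) <= nf V F - 1 /\ el (rmf u w F) V s t.
Proof.
move=> n3 sV hs; have [e1|e0] := boolP (el F V s t).
  have [f0|f0] := leqP (nf V F) 0.
    exists s, s; split; first by have := nf_rmf_le s s F V; arith.
    by apply: el_mono e1 => x y; apply: sub_adj_rmf.
  have [u [w [_ _ _ h]]] := exists_fault f0.
  exists u, w; split; first by arith.
  by apply: el_mono e1 => x y; apply: sub_adj_rmf.
have := el_small sV hs e0; move: hs; rewrite mem_gd => /andP[gs sV'] h.
have [||w wb] := @pick_avoid _ (bnb F V s) [:: t].
- by apply: filter_uniq; apply: sub_uniq sV.
- by rewrite /=; arith.
rewrite inE => wt; exists s, w; split; last exact: el_rmf.
by have := nf_rmf_bnb gs sV' wb; arith.
Qed.

(** These are the vertices for which [el] can fail. Two of them would lose 2n - 2 neighbours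
    together, more than the f + 3 that [bnb2] allows for f <= 2n - 8. *)
Definition low F V n := [seq x <- gd F V | n <= size (bnb F V x) + 1].

Lemma low_size n F V : @sub G n V -> 7 <= n -> nf V F <= 2 * n - 8 -> size (low F V n) <= 1.
Proof.
move=> sV n7 hF; case e : (low F V n) => [|a [|b l]] //.
have ul : uniq (low F V n) by apply: filter_uniq; apply: gd_uniq sV.
have [ha1 ha2] : n <= size (bnb F V a) + 1 /\ a \in gd F V.
  have : a \in low F V n by rewrite e mem_head.
  by rewrite mem_filter => /andP[].
have [hb1 hb2] : n <= size (bnb F V b) + 1 /\ b \in gd F V.
  have : b \in low F V n by rewrite e !inE eqxx orbT.
  by rewrite mem_filter => /andP[].
have ab : a != b by move: ul; rewrite e /= inE negb_or => /andP[/andP[]].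
by have := bnb2 sV ha2 hb2 ab; arith.
Qed.

Lemma el_notlow n F V x t : @sub G n V -> x \in gd F V -> x \notin low F V n -> el F V x t.
Proof.
move=> sV hx; rewrite mem_filter hx andbT -ltnNge => h; exact: el_big sV hx h.
Qed.

End PathStep.

(** * Paths with an end in the half that holds few faults *)

Section PathHalf.
Variable G : sgraph.
Local Notation T := (vertex G).
Implicit Types (F : seq (T * T)) (V X Y D p q z l : seq T) (x y s t u v w : T) (mu : T -> T).

Section Half.
Variables (n : nat) (V V1 V2 : seq T) (mu : T -> T) (F : seq (T * T)).
Hypotheses (n7 : 7 <= n) (sp : bisection n V V1 V2 mu).
Hypotheses (hF : nf V F <= 2 * n - 8).
Let hc : HC G n. Proof. by apply: hc_all; arith. Qed.
Let d2 : D2 G n. Proof. by apply: d2_all; arith. Qed.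
Let cc : CC G n. Proof. exact: cc_all. Qed.
Let pw : 6 * n + 2 <= 2 ^ n. Proof. by apply: pow_ge; arith. Qed.
Let h12 : nf V1 F + nf V2 F <= nf V F. Proof. exact: nf_split sp F. Qed.

Lemma sub_one t : t \in gd F V2 -> {subset [:: t] <= gd F V2}.
Proof. by move=> h x; rewrite inE => /eqP->. Qed.

Section FewOutside.
Hypothesis hn5 : nf V2 F <= n - 5.
Let hn3 : nf V2 F <= n - 3. Proof. by arith. Qed.

(* when [y] is matched with [t], the rest of [V2] is inserted into the path of [V1] instead *)
Lemma exit_at s q y t z : walk (adj F) s q y -> link F mu y -> t \in gd F V2 ->
  perm_eq (z ++ q) (gd F V1) -> size z <= 2 ->
  exists2 p, walk (adj F) s p t & perm_eq (z ++ p) (gd F V).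
Proof.
move=> hq ly ht pz sz; have [e1|n1] := eqVneq (mu y) t; last first.
  exact: (exit0 sp hc hn3 ly ht n1 hq pz).
have [||p h1 h2] := insert1 sp (D := [:: t]) hc _ isT (sub_one ht) hq pz.
- by rewrite /=; arith.
- by rewrite /=; arith.
exists (p ++ [:: t]); last by perm_count.
apply: walk_cat h1 (_ : adj F y t) (walk1 _ _); by rewrite -e1.
Qed.

(* [mu c = t] is allowed *)
Lemma exit_two s p1 a b p2 c t z : walk (adj F) s p1 a -> walk (adj F) b p2 c -> b != c ->
  [/\ link F mu a, link F mu b & link F mu c] -> t \in gd F V2 -> mu a != t -> mu b != t ->
  perm_eq (z ++ p1 ++ p2) (gd F V1) ->
  exists2 p, walk (adj F) s p t & perm_eq (z ++ p) (gd F V).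
Proof.
have hsp := split_gd sp F.
move=> h1 h2 bc [la lb lc] ht at' bt pz; have [up hp _] := gd_size1 sp pz.
have [ec|nc] := eqVneq (mu c) t.
  have [|||p k1 k2] := join1 sp (D := [:: t]) hc _ isT (sub_one ht) h1 h2 la lb _ _ pz.
  - by rewrite /=; arith.
  - by rewrite inE.
  - by rewrite inE.
  exists (p ++ [:: t]); last by perm_count.
  apply: walk_cat k1 (_ : adj F c t) (walk1 _ _); by rewrite -ec.
have a1 := walk_mem2 h1; have b1 := walk_mem1 h2; have c1 := walk_mem2 h2.
have dj x : x \in p2 -> x \notin p1.
  by move: up; rewrite cat_uniq => /and3P[_ /hasPn dj _] /dj.
have ab : a != b by apply: contraTneq a1 => ->; apply: dj.
have ac : a != c by apply: contraTneq a1 => ->; apply: dj.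
have inV x : x \in p1 ++ p2 -> x \in V1 by move=> /hp /gd1V.
have aV : a \in V1 by apply: inV; rewrite mem_cat a1.
have bV : b \in V1 by apply: inV; rewrite mem_cat b1 orbT.
have cV : c \in V1 by apply: inV; rewrite mem_cat c1 orbT.
have [||q1 [q2 [g1 g2 g3]]] := d2 (a := mu a) (b := mu b) (c := mu c) (d := t) (split_sub2 sp) hn5.
- by rewrite /= !inE !negb_or !(split_mu_inj sp) // ab ac bc at' bt nc.
- by move=> x; rewrite !inE => /or4P[]/eqP-> //; apply: (link_gd2 sp).
exists (p1 ++ q1 ++ p2 ++ q2); last by perm_count.
apply: walk_cat h1 la _; apply: walk_cat g1 (_ : adj F (mu b) b) _; first by rewrite adj_sym.
exact: walk_cat h2 lc g2.
Qed.

(** Up to reversing [q], the mate of x is not t and the mate of y is not s. The four cases of [main]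
    then depend on whether the mates are s and t; if both are, the rest of [V2] is inserted into
    [q]. *)
Lemma through s t x q y z : walk (adj F) x q y -> 1 < size q -> link F mu x -> link F mu y ->
  s \in gd F V2 -> t \in gd F V2 -> s != t -> perm_eq (z ++ q) (gd F V1) -> size z <= 1 ->
  exists2 p, walk (adj F) s p t & perm_eq (z ++ p) (gd F V).
Proof.
have hsp := split_gd sp F.
have main x0 q0 y0 : walk (adj F) x0 q0 y0 -> 1 < size q0 -> link F mu x0 -> link F mu y0 ->
  s \in gd F V2 -> t \in gd F V2 -> s != t -> perm_eq (z ++ q0) (gd F V1) -> size z <= 1 ->
  mu x0 != t -> mu y0 != s ->
  exists2 p, walk (adj F) s p t & perm_eq (z ++ p) (gd F V).
  move=> hw sq lx ly hs ht st pz sz xt ys; have [up hp _] := gd_size1 sp pz.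
  have xy := walk_ends_neq up hw sq.
  have xV := gd1V (hp _ (walk_mem1 hw)); have yV := gd1V (hp _ (walk_mem2 hw)).
  have gx := link_gd2 sp xV lx; have gy := link_gd2 sp yV ly.
  have mxy : mu x0 != mu y0 by rewrite (split_mu_inj sp).
  have xl : adj F (mu x0) x0 by rewrite adj_sym.
  have [ex|nx] := eqVneq (mu x0) s; have [ey|ny] := eqVneq (mu y0) t.
  - have uD : uniq [:: s; t] by rewrite /= inE st.
    have sD : {subset [:: s; t] <= gd F V2} by move=> v; rewrite !inE => /orP[]/eqP->.
    have [||p h1 h2] := insert1 sp (D := [:: s; t]) hc _ uD sD hw pz.
    + by rewrite /=; arith.
    + by rewrite /=; arith.
    exists (s :: p ++ [:: t]); last by perm_count.
    apply: (walk_cons (a := x0)); first by rewrite -ex.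
    apply: walk_cat h1 (_ : adj F y0 t) (walk1 _ _); by rewrite -ey.
  - have [|||p h1 h2] := hc_avoid (D := [:: s]) hc (split_sub2 sp) _ isT (sub_one hs) gy ht _ _ ny.
    + by rewrite /=; arith.
    + by rewrite inE.
    + by rewrite inE eq_sym.
    exists (s :: q0 ++ p); last by perm_count.
    by apply: (walk_cons (a := x0)); [rewrite -ex|apply: walk_cat hw ly h1].
  - have sx : s != mu x0 by rewrite eq_sym.
    have [|||p h1 h2] := hc_avoid (D := [:: t]) hc (split_sub2 sp) _ isT (sub_one ht) hs gx _ _ sx.
    + by rewrite /=; arith.
    + by rewrite inE.
    + by rewrite inE.
    exists (p ++ q0 ++ [:: t]); last by perm_count.
    apply: walk_cat h1 xl _; apply: walk_cat hw (_ : adj F y0 t) (walk1 _ _); by rewrite -ey.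
  have sx : s != mu x0 by rewrite eq_sym. have sy : s != mu y0 by rewrite eq_sym.
  have [||q1 [q2 [g1 g2 g3]]] := d2 (a := s) (b := mu x0) (c := mu y0) (d := t) (split_sub2 sp) hn5.
  - by rewrite /= !inE !negb_or sx sy st mxy xt ny.
  - by move=> v; rewrite !inE => /or4P[]/eqP->.
  exists (q1 ++ q0 ++ q2); last by perm_count.
  by apply: walk_cat g1 xl _; apply: walk_cat hw ly g2.
move=> hw sq lx ly hs ht st pz sz; have [up hp _] := gd_size1 sp pz.
have xy := walk_ends_neq up hw sq.
have xV := gd1V (hp _ (walk_mem1 hw)); have yV := gd1V (hp _ (walk_mem2 hw)).
have mxy : mu x != mu y by rewrite (split_mu_inj sp).
have rev_main : mu y != t -> mu x != s -> exists2 p, walk (adj F) s p t & perm_eq (z ++ p) (gd F V).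
  move=> yt xs; apply: (main y (rev q) x) => //; last by perm_count.
    exact: walk_rev (@adj_sym _ F) hw.
  by rewrite size_rev.
have [ext|nxt] := eqVneq (mu x) t.
  by apply: rev_main; [rewrite -ext eq_sym|rewrite ext eq_sym].
have [eys|nys] := eqVneq (mu y) s; last exact: (main x q y).
by apply: rev_main; [rewrite eys|rewrite -eys].
Qed.

End FewOutside.

Section NoneOutside.
Hypotheses (al : forall x, x \in gd F V1 -> link F mu x) (h1F : 2 * n - 9 <= nf V1 F).
Let hn5 : nf V2 F <= n - 5. Proof. by arith. Qed.
Let hn3 : nf V2 F <= n - 3. Proof. by arith. Qed.

(** At most 2n - 8 faults are in [V1], so one repair suffices for [cc], and putting the fault back
    leaves a walk. *)
Lemma long_walk : exists x q y z, [/\ walk (adj F) x q y, size z <= 1,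
  perm_eq (z ++ q) (gd F V1) & 5 < size q].
Proof.
have fin x q y z : walk (adj F) x q y -> size z <= 1 -> perm_eq (z ++ q) (gd F V1) ->
    exists x q y z, [/\ walk (adj F) x q y, size z <= 1, perm_eq (z ++ q) (gd F V1) & 5 < size q].
  move=> hw sz pz; exists x, q, y, z; split => //.
  by have [_ _ h] := gd_size1 sp pz; arith.
have [|u [w [fuw uV wV hlt]]] := @exists_fault _ V1 F; first by arith.
have [|p [z [sz hp pz]]] := @cc V1 (rmf u w F) (split_sub1 sp); first by arith.
have [_ _ h] := gd_size1 sp pz.
have [|z' [_ sz' [[k1 k2]|[q [x [y [k1 _ _ k4]]]]]]] := cut_cycle (split_sub1 sp) hp pz.
- by arith.
- have pn : p != [::] by rewrite -size_eq0; apply/eqP; arith.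
  have [x [y [hw _]]] := cycle_walk k1 pn.
  by apply: fin hw _ k2; arith.
by apply: fin k1 _ k4; arith.
Qed.

Lemma near22_none s t : s \in gd F V2 -> t \in gd F V2 -> s != t -> near F V s t.
Proof.
move=> hs ht st; have [x [q [y [z [hw sz pz sq]]]]] := long_walk.
have [_ hp _] := gd_size1 sp pz.
apply: (nearI sz); apply: (through hn5 hw _ _ _ hs ht st pz sz); first by arith.
  exact: al (hp _ (walk_mem1 hw)).
exact: al (hp _ (walk_mem2 hw)).
Qed.

(** The long walk of [V1] ignores s. Either it misses s, which is then put in front, or s splits it
    into A and B, and the path starts at s into one part and reaches the other through [V2]. *)
Lemma near12_none s t : s \in gd F V1 -> t \in gd F V2 -> el F V s t -> near F V s t.
Proof.
move=> hs ht es; have [x [q [y [z [hw sz pz sq]]]]] := long_walk.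
have [uq hp _] := gd_size1 sp pz.
have rS := @adj_sym _ F.
have lq v : v \in z ++ q -> link F mu v by rewrite (perm_mem pz); apply: al.
have sV := gd1V hs;
have lx : link F mu x by apply: lq; rewrite mem_cat (walk_mem1 hw) orbT.
have ly : link F mu y by apply: lq; rewrite mem_cat (walk_mem2 hw) orbT.
have [sq'|sq'] := boolP (s \in q); last first.
  have ez : z = [:: s].
    have : s \in z ++ q by rewrite (perm_mem pz).
    rewrite mem_cat (negPf sq') orbF; case: (z) sz => [|a [|]] //= _.
    by rewrite inE => /eqP->.
  rewrite ez in pz.
  have ls := al hs; have gs := link_gd2 sp sV ls.
  have [est|nst] := eqVneq (mu s) t; last first.
    have sq1 : 1 < size q by arith.
    have [|p k1 k2] := through hn5 hw sq1 lx ly gs ht nst pz; first by [].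
    apply: (nearI (z := [::])) => //; exists (s :: p); last by perm_count.
    exact: walk_cons ls k1.
  have [w [wV ws sw]] : exists w, [/\ w \in gd F V1, w != s & adj F s w].
    case/hasP: es => w; rewrite mem_gnb => /andP[sw wV] wt; exists w.
    have ws : w != s by rewrite eq_sym (adj_neq sw).
    split => //; move: wV; rewrite (split_mem sp) => /orP[wV|wV].
      by rewrite mem_gd wV (adj_good sw).2.
    by move: wt; rewrite -est -(split_e sp sV wV) (adj_e sw).
  have wq : w \in q by have := perm_mem pz w; rewrite wV mem_cat inE (negPf ws).
  have nt v : v \in q -> mu v != t.
    move=> vq; rewrite -est (split_mu_inj sp) ?(gd1V (hp _ vq)) //.
    by apply: contraNneq sq' => <-.
  (* From s the path enters the walk at w, follows it to its end, and crosses through [V2] to the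
     first vertex of A, which needs two vertices. No vertex of [q] is matched with t, because s
     is. *)
  have two x0 q0 y0 A B : walk (adj F) x0 q0 y0 -> perm_eq q0 q -> q0 = A ++ w :: B ->
      1 < size A -> near F V s t.
    move=> w0 pq eq0 sA; rewrite eq0 in w0 pq.
    have An : A != [::] by case: (A) sA.
    have [//|a [b [k1 k2 k3]]] := walk_catP w0 An; have eb := walk_cons_start k3; subst b.
    have inq v : v \in A ++ w :: B -> v \in q by rewrite (perm_mem pq).
    have xA : x0 \in q by apply: inq; rewrite mem_cat (walk_mem1 k1).
    have aA : a \in q by apply: inq; rewrite mem_cat (walk_mem2 k1).
    have yB : y0 \in q by apply: inq; rewrite mem_cat (walk_mem2 k3) orbT.
    have xa : x0 != a.
      apply: (walk_ends_neq _ k1 sA); move: uq; rewrite -(perm_uniq pq) cat_uniq.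
      by case/and3P.
    apply: (nearI (z := [::])) => //.
    apply: (exit_two hn5 (walk_cons sw k3) k1 xa _ ht); rewrite ?nt //.
      by split; apply: lq; rewrite mem_cat ?aA ?xA ?yB orbT.
    by perm_count.
  have [A [B eq]] : exists A B, q = A ++ w :: B.
    by case/splitPr: wq => A B; exists A, B.
  have [sA|sA] := leqP 2 (size A); first exact: (two x q y A B hw (perm_refl _) eq).
  apply: (two y (rev q) x (rev B) (rev A)).
  - exact: walk_rev rS hw.
  - by perm_count.
  - by rewrite eq rev_cat rev_cons cat_rcons.
  by move: sq; rewrite eq size_rev size_cat /=; arith.
have fin1 q0 y0 : walk (adj F) s q0 y0 -> perm_eq q0 q -> near F V s t.
  move=> w0 pq; apply: (nearI sz); apply: (exit_at hn5 w0 _ ht); last by arith.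
    by apply: lq; rewrite mem_cat -(perm_mem pq) (walk_mem2 w0) orbT.
  by perm_count.
(* If t is not the mate of [y0], the order is s, B, then A from [x0] to a. If it is, the order is s,
   A backwards, then B, whose last vertex [y0] steps to t. *)
have main x0 y0 A a B b : walk (adj F) x0 A a -> adj F a s -> adj F s b -> walk (adj F) b B y0 ->
    perm_eq (A ++ s :: B) q -> mu x0 != t -> (mu y0 != t /\ 1 < size A) \/ mu y0 = t -> near F V s t.
  move=> wA as' sb wB pq xt h.
  have inq v : v \in A ++ s :: B -> v \in q by rewrite (perm_mem pq).
  have xA := walk_mem1 wA; have aA := walk_mem2 wA; have bB := walk_mem1 wB; have yB := walk_mem2 wB.
  have uAB : uniq (A ++ s :: B) by rewrite (perm_uniq pq).
  have [uA [uB [dAB sA]]] : uniq A /\ uniq B /\ (forall v, v \in B -> v \notin A) /\ (s \notin A) /\ (s \notin B).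
    move: uAB; rewrite cat_uniq cons_uniq => /and3P[uA /hasPn d /andP[sB uB]].
    split=> //; split=> //; split; last by split => //; apply: (d s (mem_head _ _)).
    by move=> v vB; apply: (d v); rewrite inE vB orbT.
  have lk v : v \in A ++ s :: B -> link F mu v.
    by move=> /inq vq; apply: lq; rewrite mem_cat vq orbT.
  have lx0 : link F mu x0 by apply: lk; rewrite mem_cat xA.
  have la : link F mu a by apply: lk; rewrite mem_cat aA.
  have lb : link F mu b by apply: lk; rewrite mem_cat inE bB !orbT.
  have ly0 : link F mu y0 by apply: lk; rewrite mem_cat inE yB !orbT.
  have inV v : v \in A ++ s :: B -> v \in V1 by move=> /inq /hp /gd1V.
  have x0V : x0 \in V1 by apply: inV; rewrite mem_cat xA.
  have y0V : y0 \in V1 by apply: inV; rewrite mem_cat inE yB !orbT.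
  have bV : b \in V1 by apply: inV; rewrite mem_cat inE bB !orbT.
  case: h => [[yt sA2]|yt].
    apply: (nearI sz); apply: (exit_two hn5 (walk_cons sb wB) wA (walk_ends_neq uA wA sA2) _ ht yt xt) => //.
    by perm_count.
  have wS : walk (adj F) s (s :: rev A) x0.
    by apply: walk_cons (walk_rev rS wA); rewrite rS.
  have [sB|sB] := leqP 2 (size B).
    have by0 := walk_ends_neq uB wB sB.
    apply: (nearI sz); apply: (exit_two hn5 wS wB by0 _ ht xt _) => //.
      by rewrite -yt (split_mu_inj sp).
    by perm_count.
  (* A part consisting of [y0] alone cannot be visited on its own. It is given up if nothing else is
     missed. Otherwise, with v missed, either v and [y0] are adjacent and form a part of two
     vertices, or by [bnb2] one of them has a neighbour in A and is attached there, while the other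
     is given up. *)
  have eB : B = [:: y0].
    by case: (B) sB yB => [|c [|]] //= _; rewrite inE => /eqP->.
  rewrite eB in pq.
  have pA v : v \in rev A -> v \in V1 /\ mu v != t.
    rewrite mem_rev => vA; have vV : v \in V1 by apply: inV; rewrite mem_cat vA.
    split=> //; rewrite -yt (split_mu_inj sp) //.
    by apply: contraTneq vA => ->; apply: dAB.
  have sy : s != y0.
    by apply: contraNneq sA.2 => ->.
  have smu : mu s != t by rewrite -yt (split_mu_inj sp).
  have pS v : v \in s :: rev A -> [/\ link F mu v, v \in V1 & mu v != t].
    rewrite inE => /orP[/eqP->|vA]; first by split => //; apply: al.
    have [vV vt] := pA v vA; split => //; apply: lk.
    by move: vA; rewrite mem_rev mem_cat => ->.
  case: z sz pz lq => [|v [|]] // _ pz lq.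
    apply: (nearI (z := [:: y0])) => //.
    by apply: (exit0 sp hc hn3 lx0 ht xt wS); perm_count.
  have gv : v \in gd F V1 by rewrite -(perm_mem pz) mem_head.
  have vq : v \notin q.
    have [u' _ _] := gd_size1 sp (z := [::]) pz.
    by case/andP: u'.
  have gy : y0 \in gd F V1 by rewrite mem_gd y0V (adj_good ly0).1.
  have vy : v != y0.
    by apply: contraNneq vq => ->; apply: inq; rewrite mem_cat inE yB !orbT.
  have vt : mu v != t by rewrite -yt (split_mu_inj sp) ?(gd1V gv).
  have lv : link F mu v by apply: al.
  have b2 := bnb2 (split_sub1 sp) gv gy vy.
  have [vy'|nvy] := boolP (adj F v y0).
    apply: (nearI (z := [::])) => //.
    apply: (exit_two hn5 wS (_ : walk (adj F) v [:: v; y0] y0) vy _ ht xt vt) => //.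
      by rewrite /= !eqxx vy'.
    by perm_count.
  have [k|k] := leqP (n - 1) (size (bnb F V1 v)); last first.
    have [|w [wV ws vw]] := @gnb_avoid _ n F V1 v [:: s] (split_sub1 sp) gv; first by rewrite /=; arith.
    have vw' := adj_neq vw; rewrite inE in ws.
    have := perm_mem pz w; rewrite wV mem_cat inE eq_sym (negPf vw') /= -(perm_mem pq).
    have wy : w != y0 by apply: contraNneq nvy => <-.
    rewrite mem_cat !inE (negPf ws) (negPf wy) /= orbF => wA'.
    have wS' : w \in s :: rev A by rewrite inE mem_rev wA' orbT.
    have [A' [a' [B' [ep k1 k2 k3]]]] := walk_before wS wS' ws.
    have a'S : a' \in s :: rev A by rewrite ep mem_cat (walk_mem2 k1).
    have [la' a'V a't] := pS _ a'S.
    have vx : v != x0 by apply: contraNneq vq => ->; apply: inq; rewrite mem_cat xA.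
    apply: (nearI (z := [:: y0])) => //.
    apply: (exit_two hn5 k1 (walk_cons vw k3) vx _ ht a't vt) => //.
    have : perm_eq (s :: rev A) (A' ++ w :: B') by rewrite ep.
    by move=> pe; perm_count.
  have [|w [wV ws yw]] := @gnb_avoid _ n F V1 y0 [:: s] (split_sub1 sp) gy; first by rewrite /=; arith.
  have yw' := adj_neq yw; rewrite inE in ws.
  have wv : w != v by apply: contraNneq nvy => <-; rewrite rS.
  have := perm_mem pz w; rewrite wV mem_cat inE (negPf wv) /= -(perm_mem pq).
  rewrite mem_cat !inE (negPf ws) /= [w == y0]eq_sym (negPf yw') orbF => wA'.
  have wS' : w \in s :: rev A by rewrite inE mem_rev wA' orbT.
  have [A' [a' [B' [ep k1 k2 k3]]]] := walk_before wS wS' ws.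
  have a'S : a' \in s :: rev A by rewrite ep mem_cat (walk_mem2 k1).
  have [la' a'V a't] := pS _ a'S.
  have xy : x0 != y0 by apply: contraTneq xA => ->; apply: dAB.
  have wy : adj F w y0 by rewrite rS.
  apply: (nearI (z := [:: v])) => //.
  apply: (exit_two hn5 k1 (walk_cat (walk_rev rS k3) wy (walk1 _ y0)) xy _ ht a't xt) => //.
  have : perm_eq (s :: rev A) (A' ++ w :: B') by rewrite ep.
  by move=> pe; perm_count.
have [A [B eq]] : exists A B, q = A ++ s :: B.
  by case/splitPr: sq' => A B; exists A, B.
have [A0|An] := eqVneq A [::].
  have xs : x = s by move: (hw); rewrite eq A0; apply: walk_cons_start.
  by apply: (fin1 q y) => //; rewrite -{1}xs.
have [B0|Bn] := eqVneq B [::].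
  apply: (fin1 (rev q) x); last by perm_count.
  have w1 := walk_rev rS hw.
  have ys : y = s by move: (w1); rewrite eq B0 rev_cat; apply: walk_cons_start.
  by rewrite -{1}ys.
have w0 := hw; rewrite eq in w0; have [//|a [s' [wA as' wsB]]] := walk_catP w0 An.
have es' := walk_cons_start wsB; subst s'.
have [c [b [k1 k2 wB]]] := walk_catP (p := [:: s]) wsB isT Bn.
have ec : c = s by move: k1 => /= /andP[_ /eqP].
subst c; have pq : perm_eq (A ++ s :: B) q by rewrite eq.
have pq' : perm_eq (rev B ++ s :: rev A) q by perm_count.
have wA' := walk_rev rS wA; have wB' := walk_rev rS wB.
have sa : adj F s a by rewrite rS.
have bs : adj F b s by rewrite rS.
have xV := gd1V (hp _ (walk_mem1 hw)); have yV := gd1V (hp _ (walk_mem2 hw)).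
have xy : x != y by apply: (walk_ends_neq uq hw); arith.
(* The walk is oriented so that an end matched with t comes last; if there is none, so that at least
   two vertices precede s. *)
have [ext|nxt] := eqVneq (mu x) t.
  apply: (main y x (rev B) b (rev A) a) => //; last by right.
  by rewrite -ext eq_sym (split_mu_inj sp).
have [eyt|nyt] := eqVneq (mu y) t.
  by apply: (main x y A a B b) => //; right.
have [sA|sA] := leqP 2 (size A).
  by apply: (main x y A a B b) => //; left.
apply: (main y x (rev B) b (rev A) a) => //; left; split => //.
by move: sq; rewrite eq size_rev size_cat /=; arith.
Qed.

End NoneOutside.
End Half.
End PathHalf.

(** * Almost all faults in one half: the remaining positions of the ends *)

Section PathStep2.
Variable G : sgraph.
Local Notation T := (vertex G).
Implicit Types (F : seq (T * T)) (V X Y D p q z l : seq T) (x y s t u v w : T) (mu : T -> T).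

Lemma gd_rmf u w F V s : s \in gd F V -> s \in gd (rmf u w F) V.
Proof. by rewrite !mem_gd good_rmf => /andP[-> ->]. Qed.

Section Half.
Variables (n : nat) (V V1 V2 : seq T) (mu : T -> T) (F : seq (T * T)).
Hypotheses (n7 : 7 <= n) (sp : bisection n V V1 V2 mu) (pp : PP G n).
Hypotheses (hF : nf V F <= 2 * n - 8).
Let hc : HC G n. Proof. by apply: hc_all; arith. Qed.
Let cc : CC G n. Proof. exact: cc_all. Qed.
Let pw : 6 * n + 2 <= 2 ^ n. Proof. by apply: pow_ge; arith. Qed.
Let h12 : nf V1 F + nf V2 F <= nf V F. Proof. exact: nf_split sp F. Qed.
Let sV1 := split_sub1 sp.
Let sV2 := split_sub2 sp.
Let rS := @adj_sym G F.

Lemma gd_V1_el s w : s \in gd F V1 -> adj F s w -> w \in V -> w \in gd F V1 \/ w = mu s.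
Proof.
move=> hs sw; rewrite (split_mem sp) => /orP[wV|wV].
  by left; rewrite mem_gd wV (adj_good sw).2.
by right; apply/eqP; rewrite -(split_e sp (gd1V hs) wV) (adj_e sw).
Qed.

Section Main11.
Hypotheses (h1 : 2 * n - 9 <= nf V1 F) (h2 : nf V F <= nf V1 F + 1).
Let hn5 : nf V2 F <= n - 5. Proof. by arith. Qed.
Let hn3 : nf V2 F <= n - 3. Proof. by arith. Qed.

Lemma insert_near s t p z : walk (adj F) s p t -> perm_eq (z ++ p) (gd F V1) ->
  size z <= 2 -> exists2 p', walk (adj F) s p' t & perm_eq (z ++ p') (gd F V).
Proof. by move=> hw pz sz; apply: (insert0 sp hc hn3 hw pz); arith. Qed.

(** Two repairs bring 2n - 8 faults down to the 2n - 10 of [pp]; they are chosen at s and at t where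
    [el] would fail in [V1]. *)
Lemma near11_none s t : nf V F <= nf V1 F -> s \in gd F V1 -> t \in gd F V1 -> s != t ->
  near F V s t.
Proof.
move=> hall hs ht st.
have al x : x \in gd F V1 -> link F mu x by apply: (all_link sp).
have n3 : 3 <= n by arith.
have [u1 [w1 [f1 e1]]] := fix_el t n3 sV1 hs.
have ht1 := gd_rmf u1 w1 ht; have hs1 := gd_rmf u1 w1 hs.
have [u2 [w2 [f2 e2]]] := fix_el s n3 sV1 ht1.
have [||p [z [sz hp pz]]] := pp sV1 _ (gd_rmf u2 w2 hs1) (gd_rmf u2 w2 ht1) st _ e2.
- by arith.
- by apply: el_mono e1 => x y; apply: sub_adj_rmf.
have gs : good F s by move: hs; rewrite mem_gd => /andP[].
have gt : good F t by move: ht; rewrite mem_gd => /andP[].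
have [z' [sz' cases]] := cut_path2 sV1 hp pz gs gt.
have {}sz' : size z' <= 1 by arith.
case: cases => [[p1 k1 k2]|[p1 [a [b [p2 [k1 k2 k3]]]]]|[p1 [a [b [p2 [c [d [p3 [k1 k2 k3 k4]]]]]]]]].
- by apply: (nearI sz'); apply: insert_near k1 k2 _; arith.
- have lk v : v \in z' ++ p1 ++ p2 -> link F mu v by rewrite (perm_mem k3); apply: al.
  apply: (nearI sz'); apply: (join0 sp hc hn3 k1 k2 _ _ k3); apply: lk.
    by rewrite !mem_cat (walk_mem2 k1) !orbT.
  by rewrite !mem_cat (walk_mem1 k2) !orbT.
have n5 : 5 <= n by arith.
have [||p0 [z0 [g1 g2 g3]]] := join_segments n5 sp hn5 (D := [::]) k1 k2 k3 _ k4 sz'.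
- by move=> v; rewrite (perm_mem k4); apply: al.
- move=> y ep ez; rewrite ep ez in k4.
  have gb : b \in gd F V1 by rewrite -(perm_mem k4) !mem_cat mem_head !orbT.
  have gy : y \in gd F V1 by rewrite -(perm_mem k4) mem_head.
  have [uz _ _] := gd_size1 sp (z := [::]) k4.
  have yb : y != b.
    by apply: contraTneq uz => ->; rewrite cat1s cons_uniq !mem_cat mem_head ?orbT.
  (* Together y and b lose at most 2n - 8 + 3 < 2(n - 2) neighbours, so one of them keeps three,
     hence one besides s and t. *)
  have b2 := bnb2 sV1 gy gb yb.
  have [k|k] := leqP (size (bnb F V1 y)) (n - 3).
    have [|w [wV wst yw]] := @gnb_avoid _ n F V1 y [:: s; t] sV1 gy; first by rewrite /=; arith.
    by move: wst; rewrite !inE negb_or => /andP[ws wt]; exists w; split => //; rewrite yw.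
  have [|w [wV wst yw]] := @gnb_avoid _ n F V1 b [:: s; t] sV1 gb; first by rewrite /=; arith.
  by move: wst; rewrite !inE negb_or => /andP[ws wt]; exists w; split => //; rewrite yw orbT.
by exists p0, z0.
Qed.

Lemma cycle_links p z : cycle (adj F) p -> perm_eq (z ++ p) (gd F V1) -> size z <= 1 ->
  exists x q y, [/\ walk (adj F) x q y, perm_eq q p, link F mu x & link F mu y].
Proof.
move=> hp pz sz; have [up sub hs] := gd_size1 sp pz.
have [|p1 [u [v [p2 [ep hu hv]]]]] := @adj_avoid _ (predC (link F mu)) p.
  by have := nonlink_sub sp up sub; arith.
move: hu hv; rewrite /= !negbK => lu lv.
move: hp; rewrite ep -cat_rcons cycle_swap cat_cons => hp.
exists v, (v :: p2 ++ rcons p1 u), u; split => //; last by perm_count.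
move: hp; rewrite /= rcons_path => /andP[h _].
by rewrite eqxx h last_cat last_rcons eqxx.
Qed.

Lemma near_of_cycle : nf V1 F <= 2 * n - 9 -> exists p z, [/\ size z <= 1,
  cycle (adj F) p, perm_eq (z ++ p) (gd F V1) & 5 < size p].
Proof.
move=> h; have [p [z [sz hp pz]]] := cc sV1 h; exists p, z; split => //.
by have [_ _ hs] := gd_size1 sp pz; arith.
Qed.

Lemma near22_one s t : nf V1 F <= 2 * n - 9 -> s \in gd F V2 -> t \in gd F V2 -> s != t ->
  near F V s t.
Proof.
move=> h hs ht st; have [p [z [sz hp pz sq]]] := near_of_cycle h.
have [x [q [y [hw pq lx ly]]]] := cycle_links hp pz sz.
apply: (nearI sz); apply: (through n7 sp hF hn5 hw _ lx ly hs ht st _ sz).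
  by rewrite (perm_size pq); arith.
by perm_count.
Qed.

(** At most one vertex of [V1] has lost its cross edge, so of the two directions around the cycle
    one ends at a vertex from which [V2] can be reached. *)
Lemma near12_one s t : nf V1 F <= 2 * n - 9 -> s \in gd F V1 -> t \in gd F V2 ->
  el F V s t -> near F V s t.
Proof.
move=> h hs ht es; have [p [z [sz hp pz sq]]] := near_of_cycle h.
have [up sub _] := gd_size1 sp pz.
have from w : w \in p -> exists q y, [/\ walk (adj F) w q y, perm_eq q p & link F mu y].
  move=> wp; have [|p1 [y1 [p2 [y2 [[k1 k2] [k3 k4] k5]]]]] := cycle_from rS hp up wp; first by arith.
  have [l1|l1] := boolP (link F mu y1); first by exists p1, y1.
  exists p2, y2; split => //; apply: contraNT k5 => l2; apply/eqP.
  apply: (nonlink_unique n7 sp h2) => //; apply: sub.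
    by rewrite -(perm_mem k2) (walk_mem2 k1).
  by rewrite -(perm_mem k4) (walk_mem2 k3).
have [sq'|sq'] := boolP (s \in p).
  have [q [y [k1 k2 k3]]] := from s sq'.
  by apply: (nearI sz); apply: (exit_at n7 sp hF hn5 k1 k3 ht); [perm_count|arith].
have ez : z = [:: s].
  have : s \in z ++ p by rewrite (perm_mem pz).
  rewrite mem_cat (negPf sq') orbF; case: (z) sz => [|a [|]] //= _.
  by rewrite inE => /eqP->.
rewrite ez in pz; case/hasP: es => w; rewrite mem_gnb => /andP[sw wV] wt.
have [gw|ew] := gd_V1_el hs sw wV; last first.
  subst w; have [x [q [y [hw pq lx ly]]]] := cycle_links hp pz isT.
  have [||k k1 k2] := through n7 sp hF hn5 hw _ lx ly (link_gd2 sp (gd1V hs) sw) ht wt (z := [:: s]) _ isT.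
  - by rewrite (perm_size pq); arith.
  - by perm_count.
  apply: (nearI (z := [::])) => //; exists (s :: k); last by perm_count.
  exact: walk_cons sw k1.
have wp : w \in p.
  have := perm_mem pz w; rewrite gw mem_cat inE => /orP[/eqP ews|//].
  by have := adj_neq sw; rewrite ews eqxx.
have [q [y [k1 k2 k3]]] := from w wp.
apply: (nearI (z := [::])) => //.
by apply: (exit_at n7 sp hF hn5 (walk_cons sw k1) k3 ht) => //; perm_count.
Qed.

(** One repair suffices; [far] says that the path is cut only at vertices with a cross edge. *)
Lemma near11_direct s t u w : nf V1 (rmf u w F) <= 2 * n - 10 -> s \in gd F V1 -> t \in gd F V1 ->
  s != t -> el (rmf u w F) V1 s t -> el (rmf u w F) V1 t s ->
  (forall x, x \in gd F V1 -> tch F u w x -> link F mu x) -> near F V s t.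
Proof.
move=> hf hs ht st es et far.
have [p [z [sz hp pz]]] := pp sV1 hf (gd_rmf u w hs) (gd_rmf u w ht) st es et.
have gs : good F s by move: hs; rewrite mem_gd => /andP[].
have gt : good F t by move: ht; rewrite mem_gd => /andP[].
have [z' [_ sz' [[k1 k2]|[p1 [a [b [p2 [k1 k2 [ta tb] k3]]]]]]]] := cut_path sV1 hp pz gs gt.
  have {}sz' : size z' <= 1 by arith.
  by apply: (nearI sz'); apply: insert_near k1 k2 _; arith.
have [_ sub _] := gd_size1 sp (p := p1 ++ p2) k3.
have {}sz' : size z' <= 1 by arith.
apply: (nearI sz'); apply: (join0 sp hc hn3 k1 k2 _ _ k3).
  by apply: far ta; apply: sub; rewrite mem_cat (walk_mem2 k1).
by apply: far tb; apply: sub; rewrite mem_cat (walk_mem1 k2) orbT.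
Qed.

(** The repair restores a lost neighbour w of s. It is chosen different from t, from the vertex b
    without cross edge, and from the common neighbours of s and b, so that the path is not cut at b;
    s has lost at least n - 1 neighbours, enough for this choice. *)
Lemma near11_isolated s t : nf V1 F <= 2 * n - 9 -> s \in gd F V1 -> t \in gd F V1 -> s != t ->
  link F mu s -> ~~ el F V1 s t -> near F V s t.
Proof.
move=> hf hs ht st ls nes; have k := el_small sV1 hs nes.
have gs : good F s by move: hs; rewrite mem_gd => /andP[].
have b2 := bnb2 sV1 hs ht st.
have et : el F V1 t s by apply: (el_big s sV1 ht); arith.
have ub : uniq (bnb F V1 s) by apply: filter_uniq; apply: sub_uniq sV1.
have main Y : size Y <= 4 ->
    (forall x w, w \in bnb F V1 s -> w \notin Y -> x \in gd F V1 -> ~~ link F mu x ->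
       w != x /\ ~~ edge x w) -> near F V s t.
  move=> sY hY; have [|w wb] := @pick_avoid _ (bnb F V1 s) (t :: Y) ub.
    by rewrite /=; arith.
  rewrite inE negb_or => /andP[wt wY].
  have lt := nf_rmf_bnb gs (gd1V hs) wb.
  apply: (@near11_direct s t s w) => //; first by arith.
  - exact: el_rmf.
  - by apply: el_mono et => x y; apply: sub_adj_rmf.
  move=> x gx tx; apply: contraT => lx; have [wx xw] := hY x w wb wY gx lx.
  move: tx; rewrite /tch (negPf xw); case: ifP => // _ /orP[/eqP xs|/eqP xw'].
    by move: lx; rewrite xs ls.
  by move: wx; rewrite xw' eqxx.
have [al|/allPn[b gb lb]] := boolP (all (link F mu) (gd F V1)).
  apply: (main [::]) => // x w _ _ gx lx.
  by move: lx; rewrite (allP al x gx).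
have sb : s != b by apply: contraTneq ls => ->.
have cm := sub_common sV1 (gd1V hs) (gd1V gb) sb.
apply: (main (b :: [seq w <- V1 | edge s w && edge b w])).
  by rewrite /= size_filter; move: cm; arith.
move=> x w wb; rewrite inE mem_filter negb_or => /andP[nwb nc] gx lx.
have -> : x = b by apply: (nonlink_unique n7 sp h2).
split => //; apply: contraNN nc => bw.
by move: wb; rewrite mem_bnb // => /and3P[-> -> _]; rewrite bw.
Qed.

(* all faults of [V1] surround a vertex [b] that has lost its cross edge *)
Section AllTouch.
Variables (b : T).
Hypotheses (f9 : nf V1 F <= 2 * n - 9) (gb : b \in gd F V1) (lb : ~~ link F mu b).
Hypothesis touch : forall u w, (u, w) \in F -> u \in V1 -> w \in V1 -> tch F u w b.

Lemma link_other x : x \in gd F V1 -> x != b -> link F mu x.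
Proof.
by move=> gx; apply: contraNT => lx; apply/eqP; apply: (nonlink_unique n7 sp h2).
Qed.

Lemma few_bad x : x \in gd F V1 -> x != b -> size (bnb F V1 x) <= 3.
Proof. by move=> gx xb; apply: (bnb_all_touch sV1 (gd1V gb) gx xb touch). Qed.

(** The first piece ends at b, which has no cross edge; b is given up, and a vertex missed before is
    put back, as it has lost at most three neighbours. *)
Lemma drop_center s p1 a c p2 t z : walk (adj F) s p1 b -> walk (adj F) c p2 t -> a = b ->
  s != b -> t != b -> perm_eq (z ++ p1 ++ p2) (gd F V1) -> size z <= 1 -> near F V s t.
Proof.
move=> k1 k2 _ sb tb pz sz; have bs : b != s by rewrite eq_sym.
have [up sub _] := gd_size1 sp (p := p1 ++ p2) pz.
have [A [a' [B [ep w1 w2 w3]]]] := walk_before k1 (walk_mem2 k1) bs.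
have uB : uniq (b :: B) by move: up; rewrite ep !cat_uniq => /and3P[/and3P[_ _ ->]].
have [eB] := walk_loop w3 uB; subst B.
have pz1 : perm_eq (z ++ b :: A ++ p2) (gd F V1) by rewrite ep in pz; perm_count.
have [uz suball _] := gd_size1 sp (z := [::]) pz1.
have bn : b \notin z ++ A ++ p2.
  have : perm_eq (z ++ b :: A ++ p2) (b :: z ++ A ++ p2) by perm_count.
  by move/perm_uniq; rewrite uz => /esym /andP[].
have lk v : v \in z ++ A ++ p2 -> link F mu v.
  move=> hv; apply: link_other; last by apply: contraNneq bn => <-.
  by apply: suball; move: hv; rewrite !mem_cat inE mem_cat => /or3P[->|->|->]; rewrite ?orbT.
have la : link F mu a' by apply: lk; rewrite !mem_cat (walk_mem2 w1) !orbT.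
have lc : link F mu c by apply: lk; rewrite !mem_cat (walk_mem1 k2) !orbT.
case: z sz pz pz1 bn lk uz suball => [|y [|]] // _ pz pz1 bn lk uz suball.
  apply: (nearI (z := [:: b])) => //.
  by apply: (join0 sp hc hn3 w1 k2 la lc); perm_count.
have gy : y \in gd F V1 by apply: suball; rewrite mem_head.
have yb : y != b by move: bn; rewrite inE negb_or eq_sym => /andP[].
have fb := few_bad gy yb.
have [|w [wV wst yw]] := @gnb_avoid _ n F V1 y [:: s; t; b] sV1 gy; first by rewrite /=; arith.
move: wst; rewrite !inE !negb_or => /and3P[ws wt wb].
have n5 : 5 <= n by arith.
have ly : link F mu y by apply: lk; rewrite mem_head.
apply: (nearI (z := [:: b])) => //.
have pz2 : perm_eq ([:: b] ++ y :: A ++ p2) (gd F V1) by perm_count.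
have := perm_mem pz2 w; rewrite wV !(mem_cat, inE) (negPf wb) eq_sym (negPf (adj_neq yw)) /=.
move=> /orP[wA|wA].
  apply: (rescue n5 sp hn5 w1 k2 wA ws yw _ ly lc pz2) => v vA.
  by apply: lk; rewrite inE mem_cat vA orbT.
apply: (rescue_last n5 sp hn5 w1 k2 wA wt yw _ ly la pz2) => v vA.
by apply: lk; rewrite inE mem_cat vA !orbT.
Qed.

Lemma near11_touch s t : s \in gd F V1 -> t \in gd F V1 -> s != t -> s != b -> t != b ->
  el F V1 s t -> el F V1 t s -> near F V s t.
Proof.
move=> hs ht st sb tb es et.
have [|u [w [fuw uV wV hlt]]] := @exists_fault _ V1 F; first by arith.
have [|||p [z [sz hp pz]]] := pp sV1 _ (gd_rmf u w hs) (gd_rmf u w ht) st.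
- by arith.
- by apply: el_mono es => x y; apply: sub_adj_rmf.
- by apply: el_mono et => x y; apply: sub_adj_rmf.
have gs : good F s by move: hs; rewrite mem_gd => /andP[].
have gt : good F t by move: ht; rewrite mem_gd => /andP[].
have [z' [_ sz' [[k1 k2]|[p1 [a [c [p2 [k1 k2 _ k3]]]]]]]] := cut_path sV1 hp pz gs gt.
  have {}sz' : size z' <= 1 by arith.
  by apply: (nearI sz'); apply: insert_near k1 k2 _; arith.
have {}sz' : size z' <= 1 by arith.
have [_ sub _] := gd_size1 sp (p := p1 ++ p2) k3.
have ga : a \in gd F V1 by apply: sub; rewrite mem_cat (walk_mem2 k1).
have gc : c \in gd F V1 by apply: sub; rewrite mem_cat (walk_mem1 k2) orbT.
have [eab|ab] := eqVneq a b; first by subst a; apply: (drop_center k1 k2 erefl sb tb k3).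
have [ecb|cb] := eqVneq c b.
  subst c; apply: near_rev.
  apply: (drop_center (walk_rev rS k2) (walk_rev rS k1) erefl tb sb _ sz').
  by perm_count.
by apply: (nearI sz'); apply: (join0 sp hc hn3 k1 k2 _ _ k3); apply: link_other.
Qed.

(** The path must start at b, so it steps to a healthy neighbour [w0], and b is declared faulty for
    the rest. This adds one fault to 2n - 9, and two repairs bring the number down to 2n - 10. *)
Lemma near11_center t : t \in gd F V1 -> b != t -> el F V1 b t -> near F V b t.
Proof.
move=> ht bt es.
have [w0 [gw0 w0t bw0]] : exists w, [/\ w \in gd F V1, w != t & adj F b w].
  case/hasP: es => w; rewrite mem_gnb => /andP[bw wV] wt; exists w; split => //.
  by rewrite mem_gd wV (adj_good bw).2.
have w0b : w0 != b by rewrite eq_sym (adj_neq bw0).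
have tb : t != b by rewrite eq_sym.
have bV := gd1V gb; have gb' : good F b by move: gb; rewrite mem_gd => /andP[].
pose Fb := map (fun x => (x, x)) [:: b] ++ F.
(* [rmf u w] also makes w healthy, so w must not be b, which has to stay deleted; a fault [(u, b)]
   is therefore repaired with its ends exchanged. *)
have other F0 : good F0 b -> exists u w, w != b /\ nf V1 (rmf u w F0) <= nf V1 F0 - 1.
  move=> gF0; have [f0|f0] := leqP (nf V1 F0) 0.
    by exists w0, w0; split => //; have := nf_rmf_le w0 w0 F0 V1; arith.
  have [u [w [uwF uV wV hlt]]] := exists_fault f0.
  have [ewb|wb] := eqVneq w b; last by exists u, w; split => //; arith.
  subst w; exists b, u; split; first by apply: contraNneq gF0 => eub; rewrite -[X in (X, _)]eub.
  have := @nf_rmf _ b u F0 V1 bV uV; rewrite uwF !orbT => /(_ isT); arith.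
have [u1 [x1 [xb1 f1]]] := other F gb'.
have gb1 : good (rmf u1 x1 F) b by rewrite good_rmf gb'.
have [u2 [x2 [xb2 f2]]] := other _ gb1.
have eFb : rmf u2 x2 (rmf u1 x1 Fb) = map (fun x => (x, x)) [:: b] ++ rmf u2 x2 (rmf u1 x1 F).
  have nb u x : x != b -> (b, b) \notin [:: (x, x); (u, x); (x, u)].
    by move=> xb; rewrite !inE !xpair_eqE ![b == x]eq_sym (negPf xb) !andbF.
  have cF u x F0 : x != b -> rmf u x ((b, b) :: F0) = (b, b) :: rmf u x F0.
    by move/(nb u); rewrite /rmf; set L := [:: _; _; _] => h /=; rewrite h.
  by rewrite /Fb [map _ _]/= !cat1s !cF.
pose F2 := rmf u2 x2 (rmf u1 x1 Fb).
have nF2 : nf V1 F2 <= 2 * n - 10.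
  by rewrite /F2 eFb; have := nf_cat [:: b] (rmf u2 x2 (rmf u1 x1 F)) V1; rewrite /=; arith.
have gdb v : v \in gd F V1 -> v != b -> v \in gd Fb V1.
  by move=> gv vb; rewrite /Fb gd_cat mem_filter gv inE vb.
have el2 v v' : v \in gd F V1 -> v != b -> el F2 V1 v v'.
  move=> gv vb; have [|w [wV wb vw]] := @gnb_avoid _ n F V1 v [:: b; v'] sV1 gv.
    by have := few_bad gv vb; rewrite /=; arith.
  move: wb; rewrite !inE negb_or => /andP[wb wv'].
  apply: (@el_mono _ Fb); first by move=> x y h; do 2!apply: sub_adj_rmf.
  apply/hasP; exists w => //; rewrite mem_gnb (gd1V wV) andbT /Fb adj_cat vw !inE.
  by rewrite vb wb.
have sb' : {subset gd Fb V1 <= gd F2 V1}.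
  by move=> v hv; do 2!apply: gd_rmf.
have [p [z [sz hp pz]]] := pp sV1 nF2 (sb' _ (gdb _ gw0 w0b)) (sb' _ (gdb _ ht tb)) w0t
  (el2 _ t gw0 w0b) (el2 _ w0 ht tb).
have gw0' : good Fb w0 by have := gdb _ gw0 w0b; rewrite mem_gd => /andP[].
have gt' : good Fb t by have := gdb _ ht tb; rewrite mem_gd => /andP[].
have [z' [sz' cases]] := cut_path2 sV1 hp pz gw0' gt'.
have {}sz' : size z' <= 1 by arith.
have pb X : perm_eq X (gd Fb V1) -> perm_eq (b :: X) (gd F V1).
  move=> hX; have uX := gd_uniq F sV1.
  have sub1 : {subset [:: b] <= gd F V1} by move=> v; rewrite inE => /eqP->.
  have := perm_cat_filter (isT : uniq [:: b]) uX sub1; rewrite -gd_cat -/Fb => h.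
  by apply: perm_trans h; rewrite /= perm_cons.
have wF s p0 t0 : walk (adj Fb) s p0 t0 -> walk (adj F) s p0 t0.
  by apply: sub_walk => x y _ _; rewrite /Fb adj_cat => /and3P[].
have lk X v : perm_eq X (gd Fb V1) -> v \in X -> link F mu v.
  move=> hX; rewrite (perm_mem hX) /Fb gd_cat mem_filter inE => /andP[vb gv].
  exact: link_other.
have fin z0 : size z0 <= 1 -> (exists2 p', walk (adj F) w0 p' t & perm_eq (b :: z0 ++ p') (gd F V)) ->
    near F V b t.
  move=> sz0 [p' g1 g2]; apply: (nearI sz0); exists (b :: p'); last by perm_count.
  exact: walk_cons bw0 g1.
case: cases => [[p1 k1 k2]|[p1 [a [c [p2 [k1 k2 k3]]]]]|[p1 [a [c [p2 [d [f [p3 [k1 k2 k3 k4]]]]]]]]].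
- apply: (fin z' sz'); apply: (insert_near (z := b :: z') (wF _ _ _ k1) (pb _ k2)).
  by rewrite /=; arith.
- apply: (fin z' sz'); apply: (join0 (z := b :: z') sp hc hn3 (wF _ _ _ k1) (wF _ _ _ k2) _ _ (pb _ k3)).
    by apply: (lk _ _ k3); rewrite !mem_cat (walk_mem2 k1) !orbT.
  by apply: (lk _ _ k3); rewrite !mem_cat (walk_mem1 k2) !orbT.
have n5 : 5 <= n by arith.
have [||p0 [z0 [g1 g2 g3]]] := join_segments n5 sp hn5 (D := [:: b]) (wF _ _ _ k1) (wF _ _ _ k2)
   (wF _ _ _ k3) _ (pb _ k4) sz'.
- by move=> v; apply: lk k4.
- move=> y ep ez; rewrite ez in k4.
  have hy : y \in gd Fb V1 by rewrite -(perm_mem k4) mem_head.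
  move: hy; rewrite /Fb gd_cat mem_filter inE => /andP[yb gy].
  have [|w [wV wst yw]] := @gnb_avoid _ n F V1 y [:: b; w0; t] sV1 gy.
    by have := few_bad gy yb; rewrite /=; arith.
  move: wst; rewrite !inE !negb_or => /and3P[wb ww wt].
  by exists w; split => //; rewrite ?inE ?yw.
by apply: (fin z0 g1); exists p0.
Qed.

End AllTouch.

Lemma near11_one s t : nf V1 F <= 2 * n - 9 -> s \in gd F V1 -> t \in gd F V1 -> s != t ->
  el F V s t -> el F V t s -> near F V s t.
Proof.
move=> f9 hs ht st es et; have ts : t != s by rewrite eq_sym.
(* If v has a suitable neighbour in the network but none in [V1], that neighbour is its mate. *)
have out v v' : v \in gd F V1 -> el F V v v' -> ~~ el F V1 v v' -> link F mu v.
  move=> gv /hasP[w]; rewrite mem_gnb => /andP[vw wV] wv' nel.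
  have [gw|ew] := gd_V1_el gv vw wV; last by rewrite /link -ew.
  by case/hasP: nel; exists w => //; rewrite mem_gnb vw (gd1V gw).
have [e1|e1] := boolP (el F V1 s t); last first.
  by apply: near11_isolated => //; apply: out es e1.
have [e2|e2] := boolP (el F V1 t s); last first.
  by apply: near_rev; apply: near11_isolated => //; apply: out et e2.
have [/far_faultP[u [w [fuw uV wV far]]]|nfar] := boolP (far_fault V1 mu F).
  apply: (@near11_direct s t u w) => //.
  - have := @nf_rmf _ u w F V1 uV wV; rewrite fuw orbT => /(_ isT); arith.
  - by apply: el_mono e1 => x y; apply: sub_adj_rmf.
  - by apply: el_mono e2 => x y; apply: sub_adj_rmf.
have [b gb lb] : exists2 b, b \in gd F V1 & ~~ link F mu b.
  have [|u [w [fuw uV wV _]]] := @exists_fault _ V1 F; first by arith.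
  have := hasPn nfar _ fuw; rewrite /inside /= uV wV /= => /allPn[x gx].
  by rewrite negb_or => /andP[lx _]; exists x.
have touch := far_faultPn n7 sp nfar h2 gb lb.
have [esb|sb] := eqVneq s b; first by subst b; apply: near11_center.
have [etb|tb] := eqVneq t b; first by subst b; apply: near_rev; apply: near11_center.
exact: (near11_touch f9 gb lb touch).
Qed.

End Main11.
End Half.
End PathStep2.

(** * Faults within the induction hypothesis in both halves, and the induction *)

Section PathStep3.
Variable G : sgraph.
Local Notation T := (vertex G).
Implicit Types (F : seq (T * T)) (V X Y D p q z l : seq T) (x y s t u v w : T) (mu : T -> T).

Section Half.
Variables (n : nat) (V V1 V2 : seq T) (mu : T -> T) (F : seq (T * T)).
Hypotheses (n7 : 7 <= n) (sp : bisection n V V1 V2 mu) (pp : PP G n).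
Hypotheses (hF : nf V F <= 2 * n - 8) (h21 : nf V2 F <= nf V1 F).
Let hc : HC G n. Proof. by apply: hc_all; arith. Qed.
Let pw : 6 * n + 2 <= 2 ^ n. Proof. by apply: pow_ge; arith. Qed.
Let h12 : nf V1 F + nf V2 F <= nf V F. Proof. exact: nf_split sp F. Qed.
Let sV1 := split_sub1 sp.
Let sV2 := split_sub2 sp.
Let rS := @adj_sym G F.
Let hn3 : nf V2 F <= n - 3. Proof. by arith. Qed.

Lemma avoided_single s z p : size z <= 1 -> perm_eq (z ++ p) (gd F V1) -> s \in gd F V1 ->
  s \notin p -> z = [:: s].
Proof.
move=> sz pz hs sp'; have : s \in z ++ p by rewrite (perm_mem pz).
rewrite mem_cat (negPf sp') orbF; case: (z) sz => [|a [|]] //= _.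
by rewrite inE => /eqP->.
Qed.

Section Evenly.
Hypothesis h1 : nf V1 F <= 2 * n - 10.

(** In [V1] only t can still be a neighbour of s, so a path from y to t cannot have s as an inner
    vertex. The one missed vertex is thus s, which is joined to y through [V2]. *)
Lemma even11_isolated s t : s \in gd F V1 -> t \in gd F V1 -> s != t -> link F mu s ->
  ~~ el F V1 s t -> near F V s t.
Proof.
move=> hs ht st ls nes; have k := el_small sV1 hs nes.
have [|y /and3P[yV gy ly]] := @pick_link _ _ _ _ _ _ sp F [:: s; t].
  by rewrite /=; arith.
rewrite !inE negb_or => /andP[ys yt].
have sy : s != y by rewrite eq_sym.
have by' := bnb2 sV1 hs gy sy; have bt := bnb2 sV1 hs ht st.
have ey : el F V1 y t by apply: (el_big t sV1 gy); arith.
have et : el F V1 t y by apply: (el_big y sV1 ht); arith.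
have [p [z [sz hp pz]]] := pp sV1 h1 gy ht yt ey et.
have [up hin _] := gd_size1 sp pz.
have spn : s \notin p.
  apply/negP => spi; have [a [b [ab ap bp sa sb]]] := walk_inner rS hp up spi sy st.
  have eqt v : v \in p -> adj F s v -> v = t.
    move=> vp sv; apply/eqP; apply: contraNT nes => vt; apply/hasP; exists v => //.
    by rewrite mem_gnb sv (gd1V (hin _ vp)).
  by move: ab; rewrite (eqt a) // (eqt b) // eqxx.
have ez := avoided_single sz pz hs spn; rewrite ez in pz.
apply: (nearI (z := [::])) => //.
by apply: (join0 sp hc hn3 (walk1 _ s) hp ls ly).
Qed.

Lemma even11 s t : s \in gd F V1 -> t \in gd F V1 -> s != t -> el F V s t -> el F V t s ->
  near F V s t.
Proof.
move=> hs ht st es et; have ts : t != s by rewrite eq_sym.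
have out v v' : v \in gd F V1 -> el F V v v' -> ~~ el F V1 v v' -> link F mu v.
  move=> gv /hasP[w]; rewrite mem_gnb => /andP[vw wV] wv' nel.
  have [gw|ew] := gd_V1_el sp gv vw wV; last by rewrite /link -ew.
  by case/hasP: nel; exists w => //; rewrite mem_gnb vw (gd1V gw).
have [e1|e1] := boolP (el F V1 s t); last first.
  by apply: even11_isolated => //; apply: out es e1.
have [e2|e2] := boolP (el F V1 t s); last first.
  by apply: near_rev; apply: even11_isolated => //; apply: out et e2.
have [p [z [sz hp pz]]] := pp sV1 h1 hs ht st e1 e2.
by apply: (nearI sz); apply: (insert0 sp hc hn3 hp pz); arith.
Qed.

Let low1 : size (low F V1 n) <= 1. Proof. by apply: low_size => //; arith. Qed.

(** The path of [V2] is opened at vertices whose mates are not in [low], so that [pp] applies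
    between the mates without further conditions. *)
Lemma even_detour D s q t : walk (adj F) s q t -> perm_eq q (gd F V2) -> size D <= 1 ->
  exists x p y z q', [/\ size z <= 1, walk (adj F) x p y, perm_eq (z ++ p) (gd F V1),
    x \notin D /\ y \notin D & walk (adj F) s q' t /\ perm_eq q' (p ++ q)].
Proof.
move=> hq pq sD; have spS := split_sym sp.
have [uq sub hs] := gd_size1 spS (z := [::]) pq; rewrite /= addn0 in hs.
have [|q1 [u [v [q2 [eq hu hv]]]]] :=
    @adj_avoid _ (fun x => ~~ link F mu x || (mu x \in D ++ low F V1 n)) q.
  by have := count_blocked spS (D ++ low F V1 n) uq sub; rewrite size_cat; arith.
move: hu hv; rewrite !negb_or !negbK !mem_cat !negb_or => /and3P[lu uD ul] /and3P[lv vD vl].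
have uq' : u \in q by rewrite eq mem_cat mem_head orbT.
have vq' : v \in q by rewrite eq mem_cat !inE eqxx !orbT.
have uV := gd2V (sub _ uq'); have vV := gd2V (sub _ vq').
have gu := link_gd2 spS uV lu; have gv := link_gd2 spS vV lv.
have uv : u != v.
  by move: uq; rewrite eq cat_uniq cons_uniq inE negb_or => /and3P[_ _ /andP[/andP[]]].
have muv : mu u != mu v by rewrite (split_mu_inj spS).
have [p [z [sz hp pz]]] := pp sV1 h1 gu gv muv (el_notlow _ sV1 gu ul) (el_notlow _ sV1 gv vl).
have lv' : adj F (mu v) v by rewrite adj_sym.
exists (mu u), p, (mu v), z, (rcons q1 u ++ p ++ v :: q2); split => //; split.
  by rewrite eq in hq; apply: walk_insert hq lu hp lv'.
by rewrite eq; perm_count.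
Qed.

Lemma even22 s t : s \in gd F V2 -> t \in gd F V2 -> s != t -> near F V s t.
Proof.
move=> hs ht st; have [q hq pq] := hc sV2 hn3 hs ht st.
have [x [p [y [z [q' [sz hp pz _ [hq' pq']]]]]]] := even_detour (D := [::]) hq pq isT.
by have hsp := split_gd sp F; exists q', z; split => //; perm_count.
Qed.

Lemma even12 s t : s \in gd F V1 -> t \in gd F V2 -> el F V s t -> near F V s t.
Proof.
move=> hs ht es; have hsp := split_gd sp F.
(* If s has no neighbour left in [V1], every path there with other ends misses s, which then only
   serves as the start before its cross edge. Otherwise the far end x is chosen different from w, so
   that w witnesses [el]. *)
case e : (gnb F V1 s) => [|w l].
  have none v : v \in gd F V1 -> ~~ adj F s v.
    move=> gv; apply/negP => sv.
    have : v \in gnb F V1 s by rewrite mem_gnb sv (gd1V gv).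
    by rewrite e.
  case/hasP: es => w; rewrite mem_gnb => /andP[sw wV] wt.
  have [gw|ew] := gd_V1_el sp hs sw wV; first by case/negP: (none w gw).
  subst w; have gm := link_gd2 sp (gd1V hs) sw.
  have [q hq pq] := hc sV2 hn3 gm ht wt.
  have [x [p [y [z [q' [sz hp pz [xD yD] [hq' pq']]]]]]] := even_detour (D := [:: s]) hq pq isT.
  move: xD yD; rewrite !inE ![_ == s]eq_sym => sx sy.
  have [up hin _] := gd_size1 sp pz.
  have spn : s \notin p.
    apply/negP => spi; have [a [b [_ ap _ sa _]]] := walk_inner rS hp up spi sx sy.
    by case/negP: (none a (hin _ ap)).
  have ez := avoided_single sz pz hs spn; rewrite ez in pz.
  apply: (nearI (z := [::])) => //; exists (s :: q'); last by perm_count.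
  exact: walk_cons sw hq'.
have [|x /and3P[xV gx lx]] := @pick_link _ _ _ _ _ _ sp F ([:: s; w; mu t] ++ low F V1 n).
  by rewrite size_cat /=; arith.
rewrite mem_cat !inE !negb_or => /andP[/and3P[xs xw xt] xl].
have hw : w \in gnb F V1 s by rewrite e mem_head.
have sx : s != x by rewrite eq_sym.
have ex : el F V1 s x by apply/hasP; exists w; rewrite // eq_sym.
have [p [z [sz hp pz]]] := pp sV1 h1 hs gx sx ex (el_notlow _ sV1 gx xl).
apply: (nearI sz); apply: (exit0 sp hc hn3 lx ht _ hp pz).
by rewrite (split_mu_eq sp) // (gd2V ht).
Qed.

End Evenly.

Lemma pp_half s t : s \in gd F V -> t \in gd F V -> s != t ->
  el F V s t -> el F V t s -> near F V s t.
Proof.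
have [h1|h1] := leqP (nf V1 F) (2 * n - 10).
  move=> + + st es et; rewrite !(mem_gd_split _ _ sp) => /orP[hs|hs] /orP[ht|ht].
  - exact: even11.
  - exact: even12.
  - by apply: near_rev; apply: even12.
  - exact: even22.
have h1' : 2 * n - 9 <= nf V1 F by arith.
have [h2|h2] := leqP (nf V F) (nf V1 F).
  have al x : x \in gd F V1 -> link F mu x by apply: (all_link sp).
  have h3 : nf V F <= nf V1 F + 1 by arith.
  move=> + + st es et; rewrite !(mem_gd_split _ _ sp) => /orP[hs|hs] /orP[ht|ht].
  - exact: (near11_none n7 sp pp hF h1' h3).
  - exact: (near12_none n7 sp hF al h1').
  - by apply: near_rev; apply: (near12_none n7 sp hF al h1').
  - exact: (near22_none n7 sp hF al h1').
have h3 : nf V F <= nf V1 F + 1 by arith.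
have h9 : nf V1 F <= 2 * n - 9 by arith.
move=> + + st es et; rewrite !(mem_gd_split _ _ sp) => /orP[hs|hs] /orP[ht|ht].
- exact: (near11_one n7 sp pp hF h1' h3).
- exact: (near12_one n7 sp hF h1' h3).
- by apply: near_rev; apply: (near12_one n7 sp hF h1' h3).
- exact: (near22_one n7 sp hF h1' h3).
Qed.

End Half.

(** At n = 7 the bound 2n - 10 is the n - 3 of [HC], and the path found misses nothing. *)
Lemma pp_all n : 7 <= n -> PP G n.
Proof.
elim: n => // n IH; rewrite leq_eqVlt => /orP[/eqP n7|n7].
  rewrite -n7 => V F s t sV hF hs ht st _ _.
  by have [p h1 h2] := @hc_all G 7 isT V F s t sV hF hs ht st; exists p, [::].
have {}n7 : 7 <= n by arith.
move=> V F s t sV hF hs ht st es et; have n3 : 3 <= n by arith.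
have [V1 [V2 [mu sp]]] := sub_split n3 sV; have spS := split_sym sp.
have {}hF : nf V F <= 2 * n - 8 by arith.
have pp := IH n7.
have [h|h] := leqP (nf V2 F) (nf V1 F); first exact: (pp_half n7 sp pp).
by apply: (pp_half n7 spS pp) => //; apply: ltnW.
Qed.

End PathStep3.

(** * From the recursive definition and fault sets to lists *)

Lemma ltqn_irr : all (fun i => ~~ ltqn i i) (iota 0 8). Proof. by []. Qed.

Lemma thln_rel n (T : finType) (e : rel T) : THLN n e -> symmetric e /\ irreflexive e.
Proof.
elim=> {n T e} [T e f _ he|n T1 T2 e1 e2 phi T e g _ _ [s1 i1] _ [s2 i2] _ _ he].
  split=> [x y|x]; rewrite !he; first by rewrite /ltq3 orbC.
  by apply/negbTE; apply: (allP ltqn_irr); rewrite mem_iota ltn_ord.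
split=> [x y|x]; rewrite !he; last by case: (g x) => u /=.
by case: (g x) => u; case: (g y) => v /=.
Qed.

(** The embedding [i] is general because the induction applies to the halves, which are separate
    types, embedded in the same ambient graph. *)
Lemma thln_sub (G : sgraph) n (T : finType) (e : rel T) (i : T -> G) : THLN n e ->
  injective i -> (forall x y, edge (i x) (i y) = e x y) ->
  exists2 V, sub n V & perm_eq V (map i (enum T)).
Proof.
move=> h; elim: h i => {n T e} [T e f [f' fK f'K] he|
  n T1 T2 e1 e2 phi T e g n3 _ IH1 _ IH2 [phi' phiK phi'K] [g' gK g'K] he] i i_inj ie.
  pose h k := i (f' (inord k)).
  have hinj : {in iota 0 8 &, injective h}.
    move=> a b; rewrite !mem_iota => /andP[_ ha] /andP[_ hb] /i_inj /(can_inj f'K) /(congr1 val).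
    by rewrite /= !inordK.
  have uh : uniq (map h (iota 0 8)) by rewrite map_inj_in_uniq // iota_uniq.
  exists (map h (iota 0 8)).
    by apply: sub3 uh _ => a b ha hb; rewrite ie he !f'K /ltq3 /= !inordK.
  apply: uniq_perm => //; first by rewrite map_inj_uniq // enum_uniq.
  move=> x; apply/mapP/mapP => [[k _ ->]|[y _ ->]]; first by exists (f' (inord k)); rewrite ?mem_enum.
  by exists (val (f y)); rewrite ?mem_iota ?ltn_ord // /h inord_val fK.
pose i1 u := i (g' (inl u)); pose i2 v := i (g' (inr v)).
have i1_inj : injective i1 by move=> a b /i_inj /(can_inj g'K) [].
have i2_inj : injective i2 by move=> a b /i_inj /(can_inj g'K) [].
have [|V1 s1 p1] := IH1 i1 i1_inj; first by move=> a b; rewrite ie he !g'K.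
have [|V2 s2 p2] := IH2 i2 i2_inj; first by move=> a b; rewrite ie he !g'K.
have m1 u : i1 u \in V1 by rewrite (perm_mem p1) map_f // mem_enum.
have m2 u : i2 u \in V2 by rewrite (perm_mem p2) map_f // mem_enum.
have w1 x : x \in V1 -> exists u, x = i1 u.
  by rewrite (perm_mem p1) => /mapP[u _ ->]; exists u.
have w2 x : x \in V2 -> exists u, x = i2 u.
  by rewrite (perm_mem p2) => /mapP[u _ ->]; exists u.
have uV : uniq (V1 ++ V2).
  rewrite cat_uniq (sub_uniq s1) (sub_uniq s2) andbT /=; apply/hasPn => x /w2[u ->].
  by apply/negP => /w1[v] /i_inj /(can_inj g'K).
(* A point of the ambient graph is pulled back along [i]; outside the image, x itself is a default
   value. *)
pose mu x := if [pick y | i y == x] is Some y then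
    (if g y is inl u then i2 (phi u) else if g y is inr v then i1 (phi' v) else x) else x.
have mu1 u : mu (i1 u) = i2 (phi u).
  rewrite /mu; case: pickP => [y /eqP /i_inj ->|/(_ (g' (inl u)))]; first by rewrite g'K.
  by rewrite eqxx.
have mu2 u : mu (i2 u) = i1 (phi' u).
  rewrite /mu; case: pickP => [y /eqP /i_inj ->|/(_ (g' (inr u)))]; first by rewrite g'K.
  by rewrite eqxx.
exists (V1 ++ V2).
  apply: (@subS _ n (V1 ++ V2) V1 V2 mu n3 s1 s2 uV (perm_refl _)).
  - by move=> x /w1[u ->]; rewrite mu1.
  - by move=> x /w2[u ->]; rewrite mu2.
  - by move=> x; rewrite mem_cat => /orP[/w1|/w2] [u ->]; rewrite ?mu1 mu2 ?mu1 ?phiK ?phi'K.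
  move=> x y /w1[u ->] /w2[v ->].
  by rewrite mu1 ie he !g'K /= eq_sym (inj_eq i2_inj).
apply: uniq_perm => //; first by rewrite map_inj_uniq // enum_uniq.
move=> x; rewrite mem_cat; apply/idP/mapP => [/orP[/w1|/w2][u ->]|[y _ ->]].
- by exists (g' (inl u)); rewrite ?mem_enum.
- by exists (g' (inr u)); rewrite ?mem_enum.
rewrite -[y]gK; case: (g y) => u; first by rewrite m1.
by rewrite m2 orbT.
Qed.

Section Faults.
Variables (G : sgraph) (T : finType) (e : rel T) (Fv : {set T}) (Fe : {set {set T}}).
Hypotheses (eS : symmetric e) (eI : irreflexive e) (hFe : edge_set e Fe).
Variable (d : T * T).

(** One orientation is picked for each faulty edge, so that the list has exactly as many entries as
    there are faults; [d] is the default for sets that are no edges. *)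
Definition edge_ends A := odflt d [pick f | (A == [set f.1; f.2]) && e f.1 f.2].
Definition fault_list := [seq (v, v) | v <- enum Fv] ++ [seq edge_ends A | A <- enum Fe].

Lemma edge_endsP A : A \in Fe -> A = [set (edge_ends A).1; (edge_ends A).2] /\
  e (edge_ends A).1 (edge_ends A).2.
Proof.
move=> hA; rewrite /edge_ends; case: pickP => [f /andP[/eqP]|h] //=.
by have [x [y [exy eA]]] := hFe hA; have := h (x, y); rewrite /= eA eqxx exy.
Qed.

Lemma set2_eq (x y u v : T) : x != y -> [set x; y] = [set u; v] ->
  (x, y) = (u, v) \/ (x, y) = (v, u).
Proof.
move=> xy h.
have : x \in [set u; v] by rewrite -h set21.
have : y \in [set u; v] by rewrite -h set22.
rewrite !inE => /orP[/eqP yu|/eqP yv] /orP[/eqP xu|/eqP xv]; subst; first by rewrite eqxx in xy.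
- by right.
- by left.
by rewrite eqxx in xy.
Qed.

Lemma fault_list_vertex x : ((x, x) \in fault_list) = (x \in Fv).
Proof.
rewrite mem_cat; apply/orP/idP => [[/mapP[v]|/mapP[A]]|hx].
- by rewrite mem_enum => hv [->].
- rewrite mem_enum => /edge_endsP[_ h] eA; move: h; rewrite -eA /= eI //.
by left; apply/mapP; exists x; rewrite ?mem_enum.
Qed.

Lemma fault_list_edge x y : e x y ->
  ((x, y) \in fault_list) || ((y, x) \in fault_list) = ([set x; y] \in Fe).
Proof.
move=> exy; have xy : x != y by apply: contraTneq exy => ->; rewrite eI.
have one a b : a != b -> (a, b) \in fault_list -> [set a; b] \in Fe.
  move=> ab; rewrite mem_cat => /orP[/mapP[v _ [av bv]]|/mapP[A]].
    by rewrite av bv eqxx in ab.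
  by rewrite mem_enum => hA eA; have [+ _] := edge_endsP hA; rewrite -eA /= => <-.
apply/orP/idP => [[h|h]|hA]; first exact: one.
  by rewrite setUC; apply: one => //; rewrite eq_sym.
have [eA _] := edge_endsP hA.
have hm : edge_ends [set x; y] \in fault_list.
  by rewrite mem_cat; apply/orP; right; apply: map_f; rewrite mem_enum.
move: eA hm; case: (edge_ends _) => u v /= /(set2_eq xy) [] [-> ->] ?; by [left|right].
Qed.

Lemma fault_list_size : size fault_list = #|Fv| + #|Fe|.
Proof. by rewrite size_cat !size_map -!cardE. Qed.

End Faults.

Theorem theorem1 (n : nat) (T : finType) (e : rel T) (Fv : {set T})
  (Fe : {set {set T}}) :
  7 <= n -> THLN n e -> edge_set e Fe ->
  #|Fv| + #|Fe| <= 2 * n - 10 ->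
  forall s t : T, s \notin Fv -> t \notin Fv -> s != t ->
  (exists x, (x != t) && del_adj e Fv Fe s x) ->
  (exists x, (x != s) && del_adj e Fv Fe t x) ->
  exists p : seq T,
    simple_path (del_adj e Fv Fe) s t p /\ ham_or_near_ham Fv s p.
Proof.
move=> n7 he hFe hF s t hs ht st [ws /andP[ws1 ws2]] [wt /andP[wt1 wt2]].
have [eS eI] := thln_rel he.
pose G := SGraph eS eI; pose F : seq (G * G) := fault_list e Fv Fe (s, s).
have [V sV pV] := @thln_sub G n T e id he (@inj_id _) (fun _ _ => erefl).
have inV (x : G) : x \in V by rewrite (perm_mem pV) map_id mem_enum.
have gE (x : G) : good F x = (x \notin Fv) by rewrite /good fault_list_vertex.
have aE : adj F =2 del_adj e Fv Fe.
  move=> x y; rewrite /adj /del_adj !gE /=; case exy : (e x y) => //=.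
  by rewrite -(fault_list_edge Fv eI hFe (s, s) exy) negb_or.
have gdE (x : G) : (x \in gd F V) = (x \notin Fv) by rewrite mem_gd gE inV andbT.
have nF : nf V F <= 2 * n - 10.
  by apply: leq_trans hF; rewrite -(fault_list_size e Fv Fe (s, s)); apply: count_size.
have es : el F V s t by apply/hasP; exists ws => //; rewrite mem_gnb inV aE ws2.
have et : el F V t s by apply/hasP; exists wt => //; rewrite mem_gnb inV aE wt2.
have [||p [z [sz hp pz]]] := pp_all n7 sV nF _ _ st es et; rewrite ?gdE //.
have : uniq (z ++ p) by rewrite (perm_uniq pz) (gd_uniq _ sV).
rewrite cat_uniq => /and3P[_ _ up].
case: p hp pz up => // a p /and3P[/eqP-> hp /eqP hl] pz up.
exists p; split; first by split => //; rewrite -(eq_path aE).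
rewrite /ham_or_near_ham; apply: leq_trans sz; apply: leq_trans (card_size z).
apply: subset_leq_card; apply/subsetP => x; rewrite inE => /andP[xF xp].
by have := perm_mem pz x; rewrite gdE xF mem_cat (negPf xp) orbF => ->.
Qed.
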